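(* Let $t\in[0,1)$ and let $X$ belong to any one of the sets $\{d_p,\ell^p:1\le p<\infty\}\cup\{ces(p):1<p<\infty\}$, or $\{\ell(p+),ces(p+),d(p+):1\le p<\infty\}$, or $\{\ell(p-),ces(p-),d(p-):1<p\le\infty\}$. (i) The dual operator $C_t'\in\mathcal{L}(X'_\beta)$ of $C_t\in\mathcal{L}(X)$ is compact and is given by $$C_t'y=\left(\sum_{k=i}^\infty\frac{t^{k-i}}{k+1}y_k\right)_{i\in\mathbb{N}_0},\qquad y=(y_k)_{k\in\mathbb{N}_0}\in X'_\beta.$$ (ii) The point spectrum of $C_t'\in\mathcal{L}(X'_\beta)$ is given by $$\sigma_{pt}(C_t';X'_\beta)=\sigma_{pt}(C_t;X)=\Lambda.$$ Each eigenvalue $\frac{1}{n+1}$, for $n\in\mathbb{N}_0$, is simple and its corresponding eigenspace is spanned by $$y^{[n]}=\sum_{i=0}^n(-1)^i\binom{n}{i}t^ie_{n-i}\in X'_\beta\setminus\{0\}.$$ Moreover, $$\sigma^*(C_t';X'_\beta)=\sigma(C_t';X'_\beta)=\Lambda\cup\{0\}.$$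
   Context: $\mathbb{N}_0=\{0,1,2,\dots\}$, $\omega:=\mathbb{C}^{\mathbb{N}_0}$, $e_n:=(\delta_{nj})_{j\in\mathbb{N}_0}$. For $t\in[0,1]$, $C_tx:=\left(\frac{t^nx_0+t^{n-1}x_1+\dots+x_n}{n+1}\right)_{n\in\mathbb{N}_0}$ for $x\in\omega$ (with $0^0:=1$); $C_t$ acts on a sequence space $X\subseteq\omega$ by restriction. $\Lambda:=\{\frac{1}{n+1}:n\in\mathbb{N}_0\}$. Banach spaces: $\ell^q=\ell^q(\mathbb{N}_0)$ with its usual norm $\|\cdot\|_q$, $1\le q<\infty$; $ces(q):=\{x\in\omega: C_1|x|\in\ell^q\}$ with norm $\|x\|_{ces(q)}:=\|C_1|x|\,\|_q$, $1<q<\infty$, where $|x|=(|x_n|)_n$; $d_q:=\{x\in\ell^\infty:\hat x\in\ell^q\}$ with norm $\|x\|_{d_q}:=\|\hat x\|_q$, $1\le q<\infty$, where $\hat x:=(\sup_{k\ge n}|x_k|)_{n\in\mathbb{N}_0}$. Fréchet spaces: for $1\le p<\infty$ and a strictly decreasing sequence $(p_k)_{k\in\mathbb{N}}\subseteq(p,\infty)$ with $p_k\downarrow p$, $\ell(p+):=\bigcap_k\ell^{p_k}$, $ces(p+):=\bigcap_k ces(p_k)$, $d(p+):=\bigcap_k d_{p_k}$, with the topology generated by the corresponding norms. (LB)-spaces: for $1<p\le\infty$ and a strictly increasing sequence $(p_k)_{k\in\mathbb{N}}\subseteq(1,p)$ with $p_k\uparrow p$, $\ell(p-):=\mathrm{ind}_k\,\ell^{p_k}$,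 $ces(p-):=\mathrm{ind}_k\,ces(p_k)$, $d(p-):=\mathrm{ind}_k\,d_{p_k}$, i.e. the union of the respective Banach spaces with the finest locally convex topology making all their inclusions continuous. $X'_\beta$ is the topological dual $X'$ with the strong topology $\beta(X',X)$ (uniform convergence on bounded subsets of $X$). In all the spaces $X$ above $\{e_n\}$ is a Schauder basis, and an element $y\in X'$ is identified with the sequence $(y_n)_{n\in\mathbb{N}_0}$, $y_n:=y(e_n)$, so that $\langle x,y\rangle=\sum_{n=0}^\infty x_ny_n$. The dual operator $T'$ of $T\in\mathcal{L}(X)$ is $T'y:=y\circ T$. For a locally convex Hausdorff space $Z$, $\mathcal{L}(Z)$ is the space of continuous linear operators on $Z$. $T:Z\to Z$ linear is compact if there is a neighbourhood $\mathcal{U}$ of $0$ with $T(\mathcal{U})$ relatively compact in $Z$. For $T\in\mathcal{L}(Z)$: $\rho(T;Z)$ is the set of $\lambda\in\mathbb{C}$ such that $R(\lambda,T):=(\lambda I-T)^{-1}$ exists in $\mathcal{L}(Z)$; $\sigma(T;Z):=\mathbb{C}\setminus\rho(T;Z)$; $\sigma_{pt}(T;Z)$ is the set of $\lambda$ such that $\lambda I-T$ is not injective; an eigenvalue $\lambda$ is simple if $\dim\mathrm{Ker}(\lambda I-T)=1$; $\rho^*(T;Z)$ is the set of $\lambda$ for which there is $\delta>0$ such that the open disc $B(\lambda,\delta)\subseteq\rho(T;Z)$ and $\{R(\mu,T):\mu\in B(\lambda,\delta)\}$ is equicontinuous in $\mathcal{L}(Z)$; $\sigma^*(T;Z):=\mathbb{C}\setminus\rho^*(T;Z)$.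 *)

(* Defs.v *)
From HB Require Import structures.
From mathcomp Require Import all_boot all_order all_algebra.
From mathcomp Require Import all_classical all_reals all_analysis.
From mathcomp Require Import complex.

Set Implicit Arguments.
Unset Strict Implicit.
Unset Printing Implicit Defensive.

Import Order.TTheory GRing.Theory Num.Theory.
Import numFieldNormedType.Exports.

Local Open Scope classical_set_scope.
Local Open Scope ring_scope.
Local Open Scope complex_scope.

Notation omega R := (nat -> R[i]^o).

Section Sequences.
Context {R : realType}.
Implicit Types (x y : omega R) (q : R).

(* In R[i] the library norm `|z| takes its values in R[i]; cmod is the same
   modulus as an element of R. *)
Definition cmod (z : R[i]) : R := complex.Re `|z|.

Definition unit_seq (n : nat) : omega R := fun j => (n == j)%:R.

Definition cesaro_op (t : R) x : omega R :=
  fun n => (\sum_(i < n.+1) t%:C ^+ (n - i) * x i) / n.+1%:R.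

Definition abs_seq x : omega R := fun n => `|x n|.

(* The real sup is meaningful for bounded x only: dsp below asks for
   boundedness separately. *)
Definition tail_sup x : omega R :=
  fun n => (sup [set cmod (x k) | k in [set k | (n <= k)%N]])%:C.

Definition lnorm q x : \bar R := ('N[counting]_(q%:E)[EFin \o (cmod \o x)])%E.

Definition ell q : set (omega R) := [set x | (lnorm q x < +oo)%E].
Definition ell_norm q x : R := fine (lnorm q x).

Definition ell_infty : set (omega R) :=
  [set x | exists M : R, forall n, cmod (x n) <= M].

Definition ces q : set (omega R) := [set x | ell q (cesaro_op 1 (abs_seq x))].
Definition ces_norm q x : R := ell_norm q (cesaro_op 1 (abs_seq x)).

Definition dsp q : set (omega R) :=
  [set x | ell_infty x /\ ell q (tail_sup x)].
Definition dsp_norm q x : R := ell_norm q (tail_sup x).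

Definition linear_subspace (A : set (omega R)) : Prop :=
  [/\ A 0, forall x y, A x -> A y -> A (x + y) &
      forall (a : R[i]) x, A x -> A (a *: x)].

Definition seminorm_on (A : set (omega R)) (p : omega R -> R) : Prop :=
  (forall x y, A x -> A y -> p (x + y) <= p x + p y) /\
  (forall (a : R[i]) x, A x -> p (a *: x) = cmod a * p x).

Lemma cmodE (z : R[i]) : `|z| = (cmod z)%:C.
Proof. by rewrite /cmod normc_def. Qed.

Lemma cmod_ge0 z : 0 <= cmod z.
Proof. by rewrite -lecR -cmodE normr_ge0. Qed.

Lemma cmodD (z w : R[i]) : cmod (z + w) <= cmod z + cmod w.
Proof. by rewrite -lecR rmorphD /= -!cmodE ler_normD. Qed.

Lemma cmodM (z w : R[i]) : cmod (z * w) = cmod z * cmod w.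
Proof. by apply: complexI; rewrite rmorphM /= -!cmodE normrM. Qed.

Lemma cmodR (r : R) : cmod r%:C = `|r|.
Proof. by rewrite /cmod normc_def /= expr0n /= addr0 sqrtr_sqr. Qed.

Lemma cmod0 : cmod 0 = 0.
Proof. by rewrite (cmodR 0) normr0. Qed.

Lemma lnormE q x : 0 < q ->
  lnorm q x = ((\sum_(k <oo) ((cmod (x k)) `^ q)%:E) `^ q^-1)%E.
Proof.
move=> q0; rewrite /lnorm Lnorm_counting//; congr poweR.
by apply: eq_eseriesr => k _ /=; rewrite ger0_norm ?cmod_ge0.
Qed.

Lemma lnorm_ge0 q x : (0 <= lnorm q x)%E.
Proof. exact: Lnorm_ge0. Qed.

Lemma ellE q x : 0 < q ->
  ell q x <-> (\sum_(k <oo) ((cmod (x k)) `^ q)%:E < +oo)%E.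
Proof.
move=> q0; rewrite /ell /= lnormE//.
split; last exact: poweR_lty.
by apply: lty_poweRy; rewrite invr_eq0 gt_eqF.
Qed.

Lemma le_lnorm q x y : 0 < q -> (forall n, cmod (x n) <= cmod (y n)) ->
  (lnorm q x <= lnorm q y)%E.
Proof.
move=> q0 xy; rewrite !lnormE//.
apply: gt0_ler_poweR.
- by rewrite invr_ge0 ltW.
- rewrite in_itv /= leey andbT.
  by apply: nneseries_ge0 => k _ _; rewrite lee_fin powR_ge0.
- rewrite in_itv /= leey andbT.
  by apply: nneseries_ge0 => k _ _; rewrite lee_fin powR_ge0.
apply: lee_nneseries => k _; first by rewrite lee_fin powR_ge0.
by rewrite lee_fin ge0_ler_powR ?nnegrE ?cmod_ge0 // ltW.
Qed.

Lemma eq_lnorm q x y : (forall n, cmod (x n) = cmod (y n)) ->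
  lnorm q x = lnorm q y.
Proof. by move=> xy; apply: eq_Lnorm => n /=; rewrite xy. Qed.

Lemma lnormD q x y z : 1 <= q ->
  (forall n, cmod (z n) <= cmod (x n) + cmod (y n)) ->
  (lnorm q z <= lnorm q x + lnorm q y)%E.
Proof.
move=> q1 zxy.
have q0 : 0 < q by apply: lt_le_trans q1.
have /(_ (fun n => cmod (x n)) (fun n => cmod (y n)) q _ _ q1) :=
  @minkowski_EFin _ nat R counting.
move=> H; apply: le_trans (H _ _); [|by []|by []].
apply: (@le_trans _ _ (lnorm q (fun n => (cmod (x n) + cmod (y n))%:C))).
  apply: le_lnorm => // n; rewrite (cmodR (_ + _)) ger0_norm ?addr_ge0 ?cmod_ge0//.
rewrite le_eqVlt; apply/orP; left; apply/eqP.
apply: eq_Lnorm => n /=.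
by rewrite (cmodR (_ + _)) ger0_norm ?addr_ge0 ?cmod_ge0.
Qed.

Lemma lnormZ q (c : R) x y : 0 < q -> 0 <= c ->
  (forall n, cmod (y n) = c * cmod (x n)) ->
  lnorm q y = (c%:E * lnorm q x)%E.
Proof.
move=> q0 c0 yx; rewrite !lnormE//.
have -> : (\sum_(k <oo) ((cmod (y k)) `^ q)%:E =
    (c `^ q)%:E * \sum_(k <oo) ((cmod (x k)) `^ q)%:E)%E.
  rewrite -nneseriesZl; last by move=> k _; rewrite lee_fin powR_ge0.
  by apply: eq_eseriesr => k _; rewrite yx powRM ?cmod_ge0// EFinM.
rewrite poweRM ?lee_fin ?powR_ge0//; last first.
  by apply: nneseries_ge0 => k _ _; rewrite lee_fin powR_ge0.
by rewrite poweR_EFin -powRrM mulfV ?gt_eqF// powRr1.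
Qed.

End Sequences.

Section SpaceFacts.
Context {R : realType}.
Implicit Types (x y z : omega R) (q : R).

Lemma ellD q x y z : 1 <= q ->
  (forall n, cmod (z n) <= cmod (x n) + cmod (y n)) -> ell q x -> ell q y ->
  ell q z /\ ell_norm q z <= ell_norm q x + ell_norm q y.
Proof.
move=> q1 zxy lx ly; have xyz := lnormD q1 zxy.
have fx : lnorm q x \is a fin_num by rewrite ge0_fin_numE ?lnorm_ge0.
have fy : lnorm q y \is a fin_num by rewrite ge0_fin_numE ?lnorm_ge0.
have lz : ell q z by apply: le_lt_trans xyz _; rewrite lte_add_pinfty.
have fz : lnorm q z \is a fin_num by rewrite ge0_fin_numE ?lnorm_ge0.
by split => //; rewrite -lee_fin EFinD !fineK.
Qed.

Lemma ellZ q (a : R[i]) x y : 0 < q ->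
  (forall n, cmod (y n) = cmod a * cmod (x n)) -> ell q x ->
  ell q y /\ ell_norm q y = cmod a * ell_norm q x.
Proof.
move=> q0 yx lx; have xyz := lnormZ q0 (cmod_ge0 a) yx.
have fx : lnorm q x \is a fin_num by rewrite ge0_fin_numE ?lnorm_ge0.
by rewrite /ell /= /ell_norm xyz -(fineK fx) -EFinM ltry.
Qed.

Lemma le_ell q x y : 0 < q -> (forall n, cmod (x n) <= cmod (y n)) ->
  ell q y -> ell q x.
Proof. by move=> q0 xy; apply: le_lt_trans; exact: le_lnorm. Qed.

Lemma ell0 q : 0 < q -> ell q (0 : omega R).
Proof.
move=> q0; apply/ellE => //.
rewrite eseries0 ?ltry// => k _ _ /=.
by rewrite [cmod _]cmod0 powR0// gt_eqF.
Qed.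

Lemma ell_subspace q : 1 <= q -> linear_subspace (@ell R q).
Proof.
move=> q1; have q0 : 0 < q by apply: lt_le_trans q1.
split; first exact: ell0.
- by move=> x y lx ly; apply: (proj1 (ellD q1 _ lx ly)) => n; exact: cmodD.
- by move=> a x lx; apply: (proj1 (ellZ q0 (a := a) _ lx)) => n; exact: cmodM.
Qed.

Lemma ell_seminorm q : 1 <= q -> seminorm_on (@ell R q) (ell_norm q).
Proof.
move=> q1; have q0 : 0 < q by apply: lt_le_trans q1.
split; first by move=> x y lx ly; apply: (proj2 (ellD q1 _ lx ly)) => n; exact: cmodD.
by move=> a x lx; apply: (proj2 (ellZ q0 (a := a) _ lx)) => n; exact: cmodM.
Qed.

Lemma ell_unit q n : 0 < q -> ell q (@unit_seq R n).
Proof.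
move=> q0; apply/ellE => //.
rewrite (nneseries_split 0 n.+1); last by move=> k _; rewrite lee_fin powR_ge0.
rewrite [X in (_ + X)%E]eseries0; last first.
  move=> k; rewrite add0n => nk _ /=; rewrite /unit_seq ltn_eqF//.
  by rewrite [cmod _]cmod0 powR0// gt_eqF.
by rewrite adde0 sumEFin ltry.
Qed.

Lemma ell_le q r : 0 < q -> q <= r -> @ell R q `<=` ell r.
Proof.
move=> q0 qr x lx; have r0 : 0 < r by apply: lt_le_trans qr.
have fx : lnorm q x \is a fin_num by rewrite ge0_fin_numE ?lnorm_ge0.
pose S := (\sum_(k <oo) ((cmod (x k)) `^ q)%:E)%E.
have S0 : (0 <= S)%E by apply: nneseries_ge0 => k _ _; rewrite lee_fin powR_ge0.
have Sfin : S \is a fin_num by rewrite ge0_fin_numE//; apply/ellE.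
have xS n : (cmod (x n)) `^ q <= fine S.
  rewrite -lee_fin fineK// /S.
  apply: le_trans (nneseries_lim_ge n.+1 _) => //; last first.
    by move=> k _ _; rewrite lee_fin powR_ge0.
  rewrite big_nat_recr//= leeDr// sumEFin lee_fin.
  by apply: sumr_ge0 => k _; rewrite powR_ge0.
have fS0 : 0 <= fine S by rewrite fine_ge0.
pose M := (fine S) `^ q^-1.
have xM n : cmod (x n) <= M.
  have := @ge0_ler_powR R q^-1 _ _ _ _ _ (xS n).
  rewrite -powRrM mulfV ?gt_eqF// powRr1 ?cmod_ge0//; apply.
  - by rewrite invr_ge0 ltW.
  - by rewrite nnegrE powR_ge0.
  - by rewrite nnegrE.
apply/ellE => //.
apply: (@le_lt_trans _ _ (\sum_(k <oo) ((M `^ (r - q))%:E * ((cmod (x k)) `^ q)%:E))%E).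
  apply: lee_nneseries => k _ ; first by move=> _; rewrite lee_fin powR_ge0.
  rewrite -EFinM lee_fin.
  have -> : (cmod (x k)) `^ r = (cmod (x k)) `^ (r - q) * (cmod (x k)) `^ q.
    have [->|x0] := eqVneq (cmod (x k)) 0.
      by rewrite (@powR0 _ r) ?gt_eqF// (@powR0 _ q) ?gt_eqF// mulr0.
    rewrite -powRD ?subrK//.
    by apply/implyP; rewrite gt_eqF.
  apply: ler_wpM2r; first exact: powR_ge0.
  by rewrite ge0_ler_powR ?nnegrE ?cmod_ge0 ?powR_ge0// subr_ge0.
rewrite nneseriesZl; last by move=> k _; rewrite lee_fin powR_ge0.
by rewrite -/S -(fineK Sfin) -EFinM ltry.
Qed.

Lemma ces1E x n : cmod (cesaro_op 1 (abs_seq x) n) =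
  (\sum_(i < n.+1) cmod (x i)) / n.+1%:R.
Proof.
have -> : cesaro_op 1 (abs_seq x) n = ((\sum_(i < n.+1) cmod (x i)) / n.+1%:R)%:C.
  rewrite /cesaro_op rmorphM rmorph_sum fmorphV rmorph_nat; congr (_ / _).
  apply: eq_bigr => i _; rewrite rmorph1 expr1n mul1r.
  by rewrite /abs_seq cmodE.
rewrite cmodR ger0_norm// divr_ge0// sumr_ge0// => i _; exact: cmod_ge0.
Qed.

Lemma ces1D x y n : cmod (cesaro_op 1 (abs_seq (x + y)) n) <=
  cmod (cesaro_op 1 (abs_seq x) n) + cmod (cesaro_op 1 (abs_seq y) n).
Proof.
rewrite !ces1E -mulrDl ler_wpM2r ?invr_ge0// -big_split/=.
by apply: ler_sum => i _; exact: cmodD.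
Qed.

Lemma ces1Z (a : R[i]) x n : cmod (cesaro_op 1 (abs_seq (a *: x)) n) =
  cmod a * cmod (cesaro_op 1 (abs_seq x) n).
Proof.
rewrite !ces1E mulrA mulr_sumr; congr (_ / _).
by apply: eq_bigr => i _; exact: cmodM.
Qed.

Lemma ces_subspace q : 1 <= q -> linear_subspace (@ces R q).
Proof.
move=> q1; have q0 : 0 < q by apply: lt_le_trans q1.
split.
- apply: (le_ell q0 (y := 0)); last exact: ell0.
  move=> n; rewrite ces1E big1 ?mul0r ?cmod_ge0// => i _; exact: cmod0.
- move=> x y lx ly; exact: (proj1 (ellD q1 (ces1D x y) lx ly)).
- move=> a x lx; exact: (proj1 (ellZ q0 (ces1Z a x) lx)).
Qed.

Lemma ces_seminorm q : 1 <= q -> seminorm_on (@ces R q) (ces_norm q).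
Proof.
move=> q1; have q0 : 0 < q by apply: lt_le_trans q1.
split; first by move=> x y lx ly; exact: (proj2 (ellD q1 (ces1D x y) lx ly)).
by move=> a x lx; exact: (proj2 (ellZ q0 (ces1Z a x) lx)).
Qed.

Lemma ces_le q r : 0 < q -> q <= r -> @ces R q `<=` ces r.
Proof. by move=> q0 qr x; exact: ell_le. Qed.

Lemma powR_telescope q n : 1 < q ->
  (q - 1) * (n.+2%:R `^ (- q)) <= n.+1%:R `^ (1 - q) - n.+2%:R `^ (1 - q) :> R.
Proof.
move=> q1; set s := q - 1; have s0 : 0 < s by rewrite subr_gt0.
have n2 : (0 : R) < n.+2%:R by [].
have n1 : (0 : R) < n.+1%:R by [].
pose u : R := n.+1%:R / n.+2%:R.
have u0 : 0 < u by rewrite divr_gt0.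
have uE : u = 1 + - n.+2%:R^-1.
  apply: (mulIf (lt0r_neq0 n2)); rewrite mulrDl mulNr mulVf ?gt_eqF// mul1r.
  by rewrite divfK ?gt_eqF// -[n.+2]addn1 natrD addrK.
have lnu : ln u <= - n.+2%:R^-1.
  rewrite uE; apply: le_ln1Dx.
  by rewrite ltrN2 invf_lt1// ltr1n.
have us : 1 + s / n.+2%:R <= u `^ (- s).
  rewrite /powR gt_eqF//; apply: le_trans (expR_ge1Dx _).
  by rewrite lerD2l mulNr -mulrN ler_pM2l// lerNr.
have -> : 1 - q = - s by rewrite opprB.
have -> : n.+1%:R `^ (- s) = n.+2%:R `^ (- s) * u `^ (- s) :> R.
  by rewrite -powRM ?ltW// mulrC divfK ?gt_eqF.
have -> : - q = - s + - 1 by rewrite -opprD /s subrK.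
rewrite powRD; last by rewrite (gt_eqF n2) implybT.
rewrite powR_inv1 ?ler0n// mulrCA.
set A := n.+2%:R `^ (- s); have -> : A * u `^ (- s) - A = A * (u `^ (- s) - 1).
  by rewrite mulrBr mulr1.
by apply: ler_wpM2l; rewrite ?powR_ge0// lerBrDl.
Qed.

Lemma cvg_riemann q (c : R) : 1 < q -> 0 <= c ->
  ((\sum_(k <oo) (c * (k.+1%:R `^ (- q)))%:E)%E < +oo)%E.
Proof.
move=> q1 c0.
under eq_eseriesr do rewrite EFinM.
rewrite nneseriesZl; last by move=> k _; rewrite lee_fin powR_ge0.
suff: (\sum_(k <oo) (k.+1%:R `^ (- q))%:E <= (1 + (q - 1)^-1)%:E)%E.
  move=> H; apply: (@le_lt_trans _ _ (c%:E * (1 + (q - 1)^-1)%:E)%E).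
    by rewrite lee_pmul// nneseries_ge0// => k _ _; rewrite lee_fin powR_ge0.
  by rewrite -EFinM ltry.
apply: lime_le.
  by apply: is_cvg_nneseries => k _ _; rewrite lee_fin powR_ge0.
have s0 : 0 < q - 1 by rewrite subr_gt0.
apply: nearW => -[|n].
  by rewrite big_nil lee_fin addr_ge0// invr_ge0 ltW.
rewrite sumEFin lee_fin big_mkord big_ord_recl /= powR1 lerD2l.
rewrite -(ler_pM2l s0) mulfV ?gt_eqF// mulr_sumr.
apply: (@le_trans _ _ (\sum_(i < n) (i.+1%:R `^ (1 - q) - i.+2%:R `^ (1 - q)))).
  by apply: ler_sum => i _; exact: powR_telescope.
rewrite -(big_mkord xpredT (fun i => i.+1%:R `^ (1 - q) - i.+2%:R `^ (1 - q))).
have -> : \sum_(0 <= i < n) (i.+1%:R `^ (1 - q) - i.+2%:R `^ (1 - q)) =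
    1 - n.+1%:R `^ (1 - q) :> R.
  elim: n => [|n IH]; first by rewrite big_nil powR1 subrr.
  by rewrite big_nat_recr//= IH addrA subrK.
by rewrite gerBl powR_ge0.
Qed.

Lemma ces_unit q n : 1 < q -> ces q (@unit_seq R n).
Proof.
move=> q1; have q0 : 0 < q by apply: lt_trans q1.
apply/ellE => //.
apply: le_lt_trans (cvg_riemann q1 ler01).
apply: lee_nneseries => k _; first by move=> _; rewrite lee_fin powR_ge0.
rewrite lee_fin mul1r.
have -> : k.+1%:R `^ (- q) = (k.+1%:R^-1) `^ q :> R.
  by rewrite -(@powR_inv1 _ k.+1%:R)// -powRrM mulN1r.
rewrite ge0_ler_powR ?nnegrE ?(ltW q0) ?cmod_ge0// ces1E.
rewrite -[leRHS]mul1r ler_wpM2r ?invr_ge0//.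
suff -> : \sum_(i < k.+1) cmod (@unit_seq R n i) = (n < k.+1)%N%:R.
  by case: ltnP.
elim: k.+1 => [|m IH]; first by rewrite big_ord0.
rewrite big_ord_recr /= IH ltnS [(n <= m)%N]leq_eqVlt /unit_seq.
have [->|nm] := eqVneq n m; first by rewrite ltnn add0r (cmodR 1) normr1.
by rewrite [cmod _]cmod0 addr0.
Qed.

Lemma has_sup_tail x n : ell_infty x ->
  has_sup [set cmod (x k) | k in [set k | (n <= k)%N]].
Proof.
move=> [M xM]; split; first by exists (cmod (x n)), n => /=.
by exists M => _ [k _ <-].
Qed.

Lemma tail_sup_ge x n k : ell_infty x -> (n <= k)%N ->
  cmod (x k) <= cmod (tail_sup x n).
Proof.
move=> lx nk; rewrite cmodR; apply: le_trans (ler_norm _).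
apply: ub_le_sup; first exact: (proj2 (has_sup_tail n lx)).
by exists k.
Qed.

Lemma tail_sup_le x n M : ell_infty x -> 
  (forall k, (n <= k)%N -> cmod (x k) <= M) -> cmod (tail_sup x n) <= M.
Proof.
move=> lx xM; rewrite cmodR ger0_norm.
  apply: ge_sup; first exact: (proj1 (has_sup_tail n lx)).
  by move=> _ [k nk <-]; exact: xM.
apply: le_trans (cmod_ge0 (x n)) _.
apply: ub_le_sup; first exact: (proj2 (has_sup_tail n lx)).
by exists n => /=.
Qed.

Lemma ell_infty_subspace : linear_subspace (@ell_infty R).
Proof.
split; first by exists 0 => n; rewrite [cmod _]cmod0.
- move=> x y [M xM] [N yN]; exists (M + N) => n.
  by apply: le_trans (cmodD _ _) _; exact: lerD.
- move=> a x [M xM]; exists (cmod a * M) => n.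
  by rewrite [cmod _]cmodM ler_wpM2l ?cmod_ge0.
Qed.

Lemma tail_supD x y n : ell_infty x -> ell_infty y ->
  cmod (tail_sup (x + y) n) <= cmod (tail_sup x n) + cmod (tail_sup y n).
Proof.
move=> lx ly; apply: tail_sup_le; first by case: ell_infty_subspace => _ + _; exact.
move=> k nk; apply: le_trans (cmodD _ _) _.
by rewrite lerD// tail_sup_ge.
Qed.

Lemma tail_supZ (a : R[i]) x n : ell_infty x ->
  cmod (tail_sup (a *: x) n) = cmod a * cmod (tail_sup x n).
Proof.
move=> lx; have lax : ell_infty (a *: x).
  by case: ell_infty_subspace => _ _; exact.
apply/eqP; rewrite eq_le; apply/andP; split.
  apply: tail_sup_le => // k nk.
  by rewrite [cmod _]cmodM ler_wpM2l ?cmod_ge0// tail_sup_ge.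
have [a0|a0] := eqVneq (cmod a) 0; first by rewrite a0 mul0r cmod_ge0.
have a_gt0 : 0 < cmod a by rewrite lt_neqAle eq_sym a0 cmod_ge0.
rewrite mulrC -ler_pdivlMr//; apply: tail_sup_le => // k nk.
rewrite ler_pdivlMr// mulrC.
apply: le_trans (tail_sup_ge lax nk).
by rewrite -cmodM.
Qed.

Lemma dsp_subspace q : 1 <= q -> linear_subspace (@dsp R q).
Proof.
move=> q1; have q0 : 0 < q by apply: lt_le_trans q1.
have [i0 iD iZ] := ell_infty_subspace.
split.
- split=> //; apply: (le_ell q0 (y := 0)); last exact: ell0.
  by move=> n; apply: tail_sup_le.
- move=> x y [bx lx] [by_ ly]; split; first exact: iD.
  by apply: (proj1 (ellD q1 _ lx ly)) => n; exact: tail_supD.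
- move=> a x [bx lx]; split; first exact: iZ.
  by apply: (proj1 (ellZ q0 (a := a) _ lx)) => n; exact: tail_supZ.
Qed.

Lemma dsp_seminorm q : 1 <= q -> seminorm_on (@dsp R q) (dsp_norm q).
Proof.
move=> q1; have q0 : 0 < q by apply: lt_le_trans q1.
split.
  move=> x y [bx lx] [by_ ly].
  by apply: (proj2 (ellD q1 _ lx ly)) => n; exact: tail_supD.
move=> a x [bx lx].
by apply: (proj2 (ellZ q0 (a := a) _ lx)) => n; exact: tail_supZ.
Qed.

Lemma dsp_le q r : 0 < q -> q <= r -> @dsp R q `<=` dsp r.
Proof. by move=> q0 qr x [bx lx]; split => //; exact: ell_le lx. Qed.

Lemma dsp_unit q n : 0 < q -> dsp q (@unit_seq R n).
Proof.
move=> q0.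
have b : ell_infty (@unit_seq R n).
  exists 1 => k; rewrite /unit_seq; case: eqP => _.
    by rewrite (cmodR 1) normr1.
  by rewrite [cmod _]cmod0.
split=> //; apply/ellE => //.
rewrite (nneseries_split 0 n.+1); last by move=> k _; rewrite lee_fin powR_ge0.
rewrite [X in (_ + X)%E]eseries0; last first.
  move=> k; rewrite add0n => nk _ /=.
  suff -> : cmod (tail_sup (@unit_seq R n) k) = 0 by rewrite powR0// gt_eqF.
  apply/eqP; rewrite eq_le cmod_ge0 andbT; apply: tail_sup_le => // j kj.
  by rewrite /unit_seq ltn_eqF ?(leq_trans nk)// [cmod _]cmod0.
by rewrite adde0 sumEFin ltry.
Qed.

End SpaceFacts.

Section LocalBase.
Context {K : numFieldType} {E : preTopologicalLmodType K} (N : set (set E)).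
Hypothesis nbhsP : forall (x : E) (U : set E),
  nbhs x U <-> exists2 W, N W & forall y, W (y - x) -> U y.
Hypothesis Nconvex : forall W, N W -> forall x y (a b : K),
  W x -> W y -> 0 <= a -> 0 <= b -> a + b = 1 -> W (a *: x + b *: y).
Hypothesis Nbalanced : forall W, N W -> forall (a : K) x,
  `|a| <= 1 -> W x -> W (a *: x).
Hypothesis Nscale : forall W, N W -> forall c : K, 0 < c ->
  exists2 W', N W' & forall x, W' x -> W (c *: x).
Hypothesis Nabsorb : forall W, N W -> forall x, exists2 c : K, 0 < c & W (c *: x).
Hypothesis Nopen : forall W, N W -> forall x, W x ->
  exists2 W', N W' & forall y, W' y -> W (x + y).

Let half (W : set E) : N W -> exists2 W', N W' &
  forall x y, W' x -> W' y -> W (x + y).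
Proof.
move=> NW; have [W' NW' W'W] := Nscale NW (ltr0Sn K 1).
exists W' => // x y W'x W'y.
have h0 : (0 : K) <= 2^-1 by rewrite invr_ge0.
have := Nconvex NW (W'W _ W'x) (W'W _ W'y) h0 h0.
rewrite !scalerA mulVf ?pnatr_eq0// !scale1r; apply.
by rewrite -mulr2n -[_ *+ 2]mulr_natl mulfV ?pnatr_eq0.
Qed.

Lemma base_add_continuous : continuous (fun z : E * E => z.1 + z.2).
Proof.
move=> [x y] U /= /nbhsP[W NW WU].
have [W' NW' W'W] := half NW.
exists ([set x' | W' (x' - x)], [set y' | W' (y' - y)]) => /=.
  by split; apply/nbhsP; exists W'.
move=> [x' y'] /= [W'x W'y]; apply: WU.
by rewrite opprD addrACA; exact: W'W.
Qed.

Lemma base_scale_continuous : continuous (fun z : K^o * E => z.1 *: z.2).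
Proof.
move=> [a x] U /= /nbhsP[W NW WU].
have [W1 NW1 W1W] := half NW.
have [c c0 W1c] := Nabsorb NW1 x.
have M0 : 0 < `|a| + 1 by rewrite ltr_wpDl.
have [W2 NW2 W2W] := Nscale NW1 M0.
exists (ball a c `&` ball a 1, [set x' | W2 (x' - x)]) => /=.
  split; last by apply/nbhsP; exists W2.
  by apply: filterI; apply: nbhsx_ballx.
move=> [a' x'] /= [[ac a1] W2x]; apply: WU.
rewrite -ball_normE /= in ac a1.
have -> : a' *: x' - a *: x = (a' - a) *: x + a' *: (x' - x).
  by rewrite scalerBl scalerBr [RHS]addrC addrA subrK.
apply: W1W.
  have -> : (a' - a) *: x = ((a' - a) / c) *: (c *: x).
    by rewrite scalerA divfK ?gt_eqF.
  apply: Nbalanced => //.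
  by rewrite normrM normfV (gtr0_norm c0) ler_pdivrMr// mul1r distrC ltW.
have -> : a' *: (x' - x) = (a' / (`|a| + 1)) *: ((`|a| + 1) *: (x' - x)).
  by rewrite scalerA divfK ?gt_eqF.
apply: Nbalanced => //; last exact: W2W.
rewrite normrM normfV (gtr0_norm M0) ler_pdivrMr// mul1r.
rewrite -[a'](subrK a) addrC (le_trans (ler_normD _ _))// lerD2l.
by rewrite distrC ltW.
Qed.

Lemma base_locally_convex : exists2 B : set_system E,
  (forall b, b \in B -> convex_set b) & basis B.
Proof.
exists [set b | exists x, exists2 W, N W & b = [set y | W (y - x)]].
  move=> _ /set_mem[x [W NW ->]] y z l /set_mem /= Wy /set_mem /= Wz.
  apply/mem_set => /=.
  have l1 : l%:num + (1 - l%:num) = 1 by rewrite addrC subrK.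
  have -> : conv l (y : convex_lmodType E) z - x =
      l%:num *: (y - x) + (1 - l%:num) *: (z - x).
    by rewrite !scalerBr addrACA -opprD -scalerDl l1 scale1r.
  by apply: Nconvex => //; rewrite subr_ge0.
split.
  move=> _ [x [W NW ->]]; rewrite openE => y /= Wy.
  have [W' NW' W'W] := Nopen NW Wy.
  apply/nbhsP; exists W' => // z W'z /=.
  have -> : z - x = y - x + (z - y) by rewrite [RHS]addrC addrA subrK.
  exact: W'W.
move=> x U /nbhsP[W NW WU]; exists [set y | W (y - x)]; last by move=> y /WU.
split; first by exists x, W.
have [c _ +] := Nabsorb NW 0.
by rewrite scaler0 /= subrr.
Qed.

End LocalBase.

(* A locally convex sequence space: a linear subspace of omega containing the e_n, with
   the topology generated by a family of seminorms, of which only the values on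
   the carrier matter. *)
Record lcseq (R : realType) := Lcseq {
  carrier : set (omega R) ;
  seminorms : set (omega R -> R) ;
  carrier_subspace : linear_subspace carrier ;
  carrier_unit : forall n, carrier (unit_seq n) ;
  seminormsP : forall p, seminorms p -> seminorm_on carrier p
}.

Definition carrier_pred (R : realType) (X : lcseq R) : {pred omega R} :=
  mem (carrier X).

Record elt (R : realType) (X : lcseq R) := Elt {
  seq_of :> nat -> R[i]^o ;
  seq_ofP : seq_of \in carrier_pred X
}.

Section EltLmodule.
Context {R : realType} (X : lcseq R).

HB.instance Definition _ := [isSub for @seq_of R X].
HB.instance Definition _ := [Choice of elt X by <:].

Let carrier_submod_closed : submod_closed (carrier_pred X).
Proof.
have [c0 cD cZ] := carrier_subspace X.
split; first exact/mem_set.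
move=> a x y /set_mem cx /set_mem cy; apply/mem_set.
by apply: cD => //; exact: cZ.
Qed.

HB.instance Definition _ :=
  GRing.isSubmodClosed.Build R[i] (omega R) (carrier_pred X) carrier_submod_closed.

HB.instance Definition _ := [SubChoice_isSubLmodule of elt X by <:].

End EltLmodule.

Lemma convex_lt (R : numFieldType) (a b u v e : R) :
  0 <= a -> 0 <= b -> a + b = 1 -> u < e -> v < e -> a * u + b * v < e.
Proof.
move=> a0 b0 ab ue ve; rewrite -[e]mul1r -ab mulrDl.
have [az|anz] := eqVneq a 0.
  by move: ab; rewrite az !mul0r !add0r => ->; rewrite !mul1r.
by apply: ltr_leD; rewrite ?ler_wpM2l ?(ltW ve)// ltr_pM2l// lt_neqAle eq_sym anz.
Qed.

Section SeminormTopology.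
Context {R : realType} (X : lcseq R).
Implicit Types (x y : elt X).

(* 0-neighbourhood base: finite intersections of open seminorm balls. *)
Definition seminorm_ball (n : nat) (p : 'I_n -> omega R -> R) (e : R) :
  set (elt X) := [set x | forall i, p i x < e].

Definition seminorm_base : set (set (elt X)) :=
  [set W | exists n (p : 'I_n -> omega R -> R) (e : R),
    [/\ forall i, seminorms X (p i), 0 < e & W = seminorm_ball p e]].

Definition seminorm_nbhs x : set_system (elt X) :=
  [set U | exists2 W, seminorm_base W & forall y, W (y - x) -> U y].

Lemma seminormD p x y : seminorms X p -> p (x + y) <= p x + p y.
Proof.
move=> /(@seminormsP _ X) [pD _]; have -> : seq_of (x + y) = seq_of x + seq_of y by [].
by apply: pD; apply/set_mem; exact: seq_ofP.
Qed.

Lemma seminormZ p (a : R[i]) x : seminorms X p -> p (a *: x) = cmod a * p x.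
Proof.
move=> /(@seminormsP _ X) [_ pZ]; have -> : seq_of (a *: x) = a *: seq_of x by [].
by apply: pZ; apply/set_mem; exact: seq_ofP.
Qed.

Lemma seminorm0 p : seminorms X p -> p (0 : elt X) = 0.
Proof. by move=> Xp; rewrite -(scale0r 0) seminormZ// cmod0 mul0r. Qed.

Lemma seminorm_ge0 p x : seminorms X p -> 0 <= p x.
Proof.
move=> Xp; have := seminormD x (- x) Xp.
rewrite subrr seminorm0// -scaleN1r seminormZ// -(rmorph1 (real_complex R)) -rmorphN cmodR.
by rewrite normrN1 mul1r -mulr2n pmulrn_lge0.
Qed.

Let base_convex W : seminorm_base W -> forall x y (a b : R[i]),
  W x -> W y -> 0 <= a -> 0 <= b -> a + b = 1 -> W (a *: x + b *: y).
Proof.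
move=> [n [p [e [Xp e0 ->]]]] x y a b Wx Wy a0 b0 ab1 i.
apply: le_lt_trans (seminormD _ _ (Xp i)) _; rewrite !seminormZ//.
have ab : cmod a + cmod b = 1.
  by apply: complexI; rewrite rmorphD/= -!cmodE !ger0_norm.
by apply: convex_lt => //; exact: cmod_ge0.
Qed.

Let base_balanced W : seminorm_base W -> forall (a : R[i]) x,
  `|a| <= 1 -> W x -> W (a *: x).
Proof.
move=> [n [p [e [Xp e0 ->]]]] a x a1 Wx i; rewrite seminormZ//.
apply: le_lt_trans (Wx i); rewrite -[leRHS]mul1r ler_wpM2r ?seminorm_ge0//.
by rewrite -lecR -cmodE.
Qed.

Let base_scale W : seminorm_base W -> forall c : R[i], 0 < c ->
  exists2 W', seminorm_base W' & forall x, W' x -> W (c *: x).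
Proof.
move=> [n [p [e [Xp e0 ->]]]] c c0.
have mc0 : 0 < cmod c by rewrite -ltcR -cmodE normr_gt0 gt_eqF.
exists (seminorm_ball p (e / cmod c)).
  by exists n, p, (e / cmod c); split => //; rewrite divr_gt0.
by move=> x Wx i; rewrite seminormZ// mulrC -ltr_pdivlMr//; exact: (Wx i).
Qed.

Let base_absorb W : seminorm_base W -> forall x,
  exists2 c : R[i], 0 < c & W (c *: x).
Proof.
move=> [n [p [e [Xp e0 ->]]]] x.
pose M := \sum_(i < n) p i x; have M0 : 0 <= M by apply: sumr_ge0 => i _; exact: seminorm_ge0.
have M1 : 0 < M + 1 by rewrite ltr_wpDl.
exists (e / (M + 1))%:C; first by rewrite ltcR divr_gt0.
move=> i; rewrite seminormZ// cmodR gtr0_norm ?divr_gt0//.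
rewrite mulrAC ltr_pdivrMr// ltr_pM2l//.
apply: (@le_lt_trans _ _ M); last by rewrite ltrDl.
by rewrite /M (bigD1 i)//= lerDl sumr_ge0// => j _; exact: seminorm_ge0.
Qed.

Let base_open W : seminorm_base W -> forall x, W x ->
  exists2 W', seminorm_base W' & forall y, W' y -> W (x + y).
Proof.
move=> [n [p [e [Xp e0 ->]]]] x Wx.
pose M := \big[Num.max/0]_(i < n) p i x.
have Me : M < e by apply: bigmax_lt => // i _; exact: (Wx i).
exists (seminorm_ball p (e - M)).
  by exists n, p, (e - M); split => //; rewrite subr_gt0.
move=> y Wy i; apply: le_lt_trans (seminormD _ _ (Xp i)) _.
rewrite -(subrKC M e) ler_ltD//.
exact: le_bigmax.
Qed.

Let baseI W1 W2 : seminorm_base W1 -> seminorm_base W2 ->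
  exists2 W, seminorm_base W & W `<=` W1 `&` W2.
Proof.
move=> [n1 [p1 [e1 [Xp1 e10 ->]]]] [n2 [p2 [e2 [Xp2 e20 ->]]]].
pose p (i : 'I_(n1 + n2)) :=
  match fintype.split i with inl j => p1 j | inr j => p2 j end.
exists (seminorm_ball p (Num.min e1 e2)).
  exists (n1 + n2)%N, p, (Num.min e1 e2); split => //; last by rewrite lt_min e10.
  by move=> i; rewrite /p; case: fintype.split.
move=> x Wx; split=> i.
  have := Wx (lshift n2 i); rewrite /p (unsplitK (inl i)).
  by rewrite lt_min => /andP[].
have := Wx (rshift n1 i); rewrite /p (unsplitK (inr i)).
by rewrite lt_min => /andP[].
Qed.

Let base0 W : seminorm_base W -> W 0.
Proof. by move=> [n [p [e [Xp e0 ->]]]] i; rewrite seminorm0. Qed.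

Let baseT : seminorm_base setT.
Proof.
exists 0%N, (fun _ _ => 0), 1; split => //; first by case.
by apply/seteqP; split => // x _ [].
Qed.

HB.instance Definition _ := hasNbhs.Build (elt X) seminorm_nbhs.

Let nbhs_filter x : ProperFilter (nbhs x).
Proof.
split.
  move=> [W bW /(_ x)]; apply; rewrite subrr; exact: base0.
split.
- by exists setT.
- move=> U V [W1 bW1 W1U] [W2 bW2 W2V]; have [W bW WW] := baseI bW1 bW2.
  by exists W => // y /WW[/W1U ? /W2V].
- by move=> U V UV [W bW WU]; exists W => // y /WU /UV.
Qed.

Let nbhs_singleton x U : nbhs x U -> U x.
Proof. by move=> [W bW]; apply; rewrite subrr; exact: base0. Qed.

Let nbhs_nbhs x U : nbhs x U -> nbhs x (nbhs^~ U).
Proof.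
move=> [W bW WU]; exists W => // y Wy.
have [W' bW' W'W] := base_open bW Wy.
exists W' => // z W'z; apply: WU.
have -> : z - x = y - x + (z - y) by rewrite [RHS]addrC addrA subrK.
exact: W'W.
Qed.

HB.instance Definition _ := Nbhs_isNbhsTopological.Build (elt X)
  nbhs_filter nbhs_singleton nbhs_nbhs.

Let nbhsP x U : nbhs x U <-> exists2 W, seminorm_base W & forall y, W (y - x) -> U y.
Proof. by []. Qed.

Let elt_add := base_add_continuous nbhsP base_convex base_scale.
Let elt_scale := base_scale_continuous nbhsP base_convex base_balanced
  base_scale base_absorb.
Let elt_convex := base_locally_convex nbhsP base_convex base_absorb base_open.

(* PreTopologicalLmod_isTvs only provides the uniform structure; the other three
   mixins have to be added. *)
HB.instance Definition _ :=
  PreTopologicalLmod_isTvs.Build R[i] (elt X) elt_add elt_scale elt_convex.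
HB.instance Definition _ :=
  PreTopologicalNmodule_isTopologicalNmodule.Build (elt X) elt_add.
HB.instance Definition _ :=
  TopologicalNmodule_isTopologicalLmodule.Build R[i] (elt X) elt_scale.
HB.instance Definition _ := Uniform_isTvs.Build R[i] (elt X) elt_convex.

End SeminormTopology.

Section Operators.
Context {K : numFieldType}.

Record lin_op (Z : tvsType K) := LinOp {
  op_fun :> Z -> Z ;
  op_linear : linear op_fun ;
  op_continuous : continuous op_fun
}.

Variable Z : tvsType K.
Implicit Types (T S : lin_op Z) (l m : K).

Definition compact_op T : Prop :=
  exists2 U : set Z, nbhs 0 U & compact (closure (T @` U)).

Definition is_resolvent T l S : Prop :=
  (forall z, S (l *: z - T z) = z) /\ (forall z, l *: S z - T (S z) = z).

Definition resolvent_set T : set K := [set l | exists S, is_resolvent T l S].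

Definition spectrum T : set K := ~` resolvent_set T.

Definition point_spectrum T : set K :=
  [set l | ~ injective (fun z => l *: z - T z)].

(* The library's equicontinuous asks for a pointed codomain; for linear
   operators equicontinuity is equicontinuity at 0. *)
Definition equicontinuous_ops (F : set (lin_op Z)) : Prop :=
  forall V : set Z, nbhs 0 V -> exists2 U : set Z, nbhs 0 U &
    forall S, F S -> S @` U `<=` V.

Definition resolvent_set_star T : set K :=
  [set l | exists2 d : K, 0 < d &
    [set m | `|m - l| < d] `<=` resolvent_set T /\
    equicontinuous_ops
      [set S | exists2 m, `|m - l| < d & is_resolvent T m S]].

Definition spectrum_star T : set K := ~` resolvent_set_star T.

Definition op_eigenspace T l : set Z := [set z | l *: z - T z = 0].

Definition line (z : Z) : set Z := [set a *: z | a in [set: K]].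

(* dim Ker (l I - T) = 1: the kernel has a basis with exactly one vector. *)
Definition simple_eigenvalue T l : Prop :=
  exists2 z, z != 0 & op_eigenspace T l = line z.

End Operators.

Section StrongDual.
Context {K : numFieldType}.

Definition tvs_bounded (X : tvsType K) (B : set X) : Prop :=
  forall U : set X, nbhs 0 U ->
    exists2 r : K, 0 < r & forall s, r <= s -> B `<=` [set s *: u | u in U].

Definition dual_pred (X : tvsType K) : {pred X -> K^o} :=
  mem [set f : X -> K^o | linear f /\ continuous f].
Arguments dual_pred : clear implicits.

Record strong_dual (X : tvsType K) := StrongDual {
  dual_fun :> X -> K^o ;
  dual_funP : dual_fun \in dual_pred X
}.

Variable X : tvsType K.

HB.instance Definition _ := [isSub for @dual_fun X].
HB.instance Definition _ := [Choice of strong_dual X by <:].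

Let dual_submod_closed : submod_closed (dual_pred X).
Proof.
split.
  apply/mem_set; split; last exact: cst_continuous.
  by move=> a x y /=; rewrite scaler0 addr0.
move=> a f g /set_mem[lf cf] /set_mem[lg cg]; apply/mem_set; split.
  move=> b x y /=; rewrite !fctE lf lg.
  by rewrite scalerDr !scalerA scalerDr scalerA mulrC addrACA.
move=> x; apply: cvgD; last exact: cg.
by apply: cvgZr; exact: cf.
Qed.

HB.instance Definition _ := GRing.isSubmodClosed.Build K (X -> K^o)
  (dual_pred X) dual_submod_closed.

HB.instance Definition _ := [SubChoice_isSubLmodule of strong_dual X by <:].

(* beta(X', X): uniform convergence on the bounded subsets of X *)
HB.instance Definition _ := Topological.copy (strong_dual X)
  (initial_topology (@dual_fun X : _ -> {family @tvs_bounded X, X -> K^o})).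

Definition dual_ball (B : set X) (e : K) : set (strong_dual X) :=
  [set f | exists2 d, 0 <= d < e & forall x, B x -> `|f x| <= d].

Definition dual_base : set (set (strong_dual X)) :=
  [set W | exists B e, [/\ tvs_bounded B, 0 < e & W = dual_ball B e]].

Lemma tvs_bounded0 : tvs_bounded (set0 : set X).
Proof. by move=> U _; exists 1 => // s _ x []. Qed.

Lemma tvs_boundedU (A B : set X) :
  tvs_bounded A -> tvs_bounded B -> tvs_bounded (A `|` B).
Proof.
move=> bA bB U U0; have [r r0 rA] := bA U U0; have [s s0 sB] := bB U U0.
exists (r + s); first exact: addr_gt0.
move=> t rst x [Ax|Bx].
  by apply: rA Ax; apply: le_trans rst; rewrite lerDl ltW.
by apply: sB Bx; apply: le_trans rst; rewrite lerDr ltW.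
Qed.

Lemma dual_bounded (f : strong_dual X) (B : set X) : tvs_bounded B ->
  exists2 M : K, 0 < M & forall x, B x -> `|f x| <= M.
Proof.
move=> bB; have [lf cf] := set_mem (dual_funP f).
have f0 : f 0 = 0 by have := lf (-1) 0 0; rewrite scaleN1r addNr scaleN1r addNr.
have fZ a x : f (a *: x) = a * f x by have := lf a x 0; rewrite !addr0 f0 addr0.
have /(_ (f @^-1` ball (0 : K^o) 1)) [] := bB.
  by apply: cf; rewrite f0; exact: nbhsx_ballx.
move=> r r0 /(_ r (lexx _)) rB; exists r => // x /rB[u /= + <-].
rewrite -ball_normE /= sub0r normrN => fu.
by rewrite fZ normrM (gtr0_norm r0) ler_piMr// ltW.
Qed.

Let baseI W1 W2 : dual_base W1 -> dual_base W2 ->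
  exists2 W, dual_base W & W `<=` W1 `&` W2.
Proof.
move=> [B1 [e1 [bB1 e10 ->]]] [B2 [e2 [bB2 e20 ->]]].
have e120 : 0 < e1 + e2 by exact: addr_gt0.
pose e := e1 * e2 / (e1 + e2); have e0 : 0 < e by rewrite divr_gt0// mulr_gt0.
have ee1 : e <= e1 by rewrite ler_pdivrMr// ler_pM2l// lerDr ltW.
have ee2 : e <= e2 by rewrite ler_pdivrMr// mulrC ler_pM2l// lerDl ltW.
exists (dual_ball (B1 `|` B2) e).
  by exists (B1 `|` B2), e; split => //; exact: tvs_boundedU.
move=> f [d /andP[d0 de] fd]; split; exists d.
- by rewrite d0 (lt_le_trans de).
- by move=> x Bx; apply: fd; left.
- by rewrite d0 (lt_le_trans de).
- by move=> x Bx; apply: fd; right.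
Qed.

Let base_filter (f : strong_dual X) :
  Filter [set U | exists2 W, dual_base W & forall g, W (g - f) -> U g].
Proof.
split.
- by exists (dual_ball set0 1) => //; exists set0, 1; split => //; exact: tvs_bounded0.
- move=> U V [W1 bW1 W1U] [W2 bW2 W2V]; have [W bW WW] := baseI bW1 bW2.
  by exists W => // y /WW[/W1U ? /W2V].
- by move=> U V UV [W bW WU]; exists W => // y /WU /UV.
Qed.

Let nbhsP (f : strong_dual X) U :
  nbhs f U <-> exists2 W, dual_base W & forall g, W (g - f) -> U g.
Proof.
pose i := @dual_fun X : strong_dual X -> {family @tvs_bounded X, X -> K^o}.
split; last first.
  move=> [_ [B [e [bB e0 ->]]] WU].
  have e20 : 0 < e / 2 by rewrite divr_gt0.
  have entE : entourage [set uv : K^o * K^o | ball uv.1 (e / 2) uv.2].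
    exact: entourage_ball (PosNum e20).
  have fV : nbhs f (i @^-1` [set g | forall y, B y -> ball (f y) (e / 2) (g y)]).
    exact: (@initial_continuous _ _ i f _ (@fam_nbhs X K^o _ B _ (i f) entE bB)).
  apply: filterS fV => g /= gf.
  apply: WU; exists (e / 2); first by rewrite ltW//= ltr_pdivrMr// ltr_pMr// ltr1n.
  move=> x /gf; rewrite -ball_normE /= distrC => /ltW; exact.
move=> fU.
pose G : set_system (strong_dual X) :=
  [set U | exists2 W, dual_base W & forall g, W (g - f) -> U g].
have FG : Filter G := base_filter f.
suff : {family @tvs_bounded X, fmap (@dual_fun X) G --> (f : X -> K^o)}.
  move: fU; rewrite nbhsE => -[_ [[V oV <-] Vf] VU] /(_ V) [].
    by apply: open_nbhs_nbhs.
  by move=> W bW WV; exists W => // g /WV /VU.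
apply/fam_cvgP => B bB V /uniform_nbhs[E [entE EV]].
move: entE; rewrite -entourage_ballE => -[e /= e0 eE].
exists (dual_ball B e); first by exists B, e.
move=> g [d /andP[d0 de] gd]; apply: EV => x Bx; apply: eE => /=.
rewrite -ball_normE /= distrC; apply: le_lt_trans de; exact: gd.
Qed.

Let base_convex W : dual_base W -> forall f g (a b : K),
  W f -> W g -> 0 <= a -> 0 <= b -> a + b = 1 -> W (a *: f + b *: g).
Proof.
move=> [B [e [bB e0 ->]]] f g a b [c /andP[c0 ce] fc] [d /andP[d0 de] gd].
move=> a0 b0 ab1; exists (a * c + b * d).
  by rewrite addr_ge0 ?mulr_ge0//= convex_lt.
move=> x Bx; apply: le_trans (ler_normD _ _) _.
by rewrite !normrM (ger0_norm a0) (ger0_norm b0) lerD// ler_wpM2l ?fc ?gd.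
Qed.

Let base_balanced W : dual_base W -> forall (a : K) f,
  `|a| <= 1 -> W f -> W (a *: f).
Proof.
move=> [B [e [bB e0 ->]]] a f a1 [c c0e fc]; exists c => // x Bx.
by rewrite normrM; apply: le_trans (fc _ Bx); rewrite ler_piMl.
Qed.

Let base_scale W : dual_base W -> forall c : K, 0 < c ->
  exists2 W', dual_base W' & forall f, W' f -> W (c *: f).
Proof.
move=> [B [e [bB e0 ->]]] c c0; exists (dual_ball B (e / c)).
  by exists B, (e / c); split => //; rewrite divr_gt0.
move=> f [d /andP[d0 de] fd]; exists (c * d).
  by rewrite mulr_ge0 ?(ltW c0)//= mulrC -ltr_pdivlMr.
by move=> x Bx; rewrite normrM (gtr0_norm c0) ler_pM2l// fd.
Qed.

Let base_absorb W : dual_base W -> forall f,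
  exists2 c : K, 0 < c & W (c *: f).
Proof.
move=> [B [e [bB e0 ->]]] f; have [M M0 fM] := dual_bounded f bB.
have c0 : 0 < e / 2 / M by rewrite !divr_gt0.
exists (e / 2 / M) => //; exists (e / 2).
  by rewrite divr_ge0 ?(ltW e0)//= ltr_pdivrMr// ltr_pMr// ltr1n.
move=> x Bx; rewrite normrM (gtr0_norm c0) -[leRHS](divfK (lt0r_neq0 M0)).
by rewrite ler_pM2l// fM.
Qed.

Let base_open W : dual_base W -> forall f, W f ->
  exists2 W', dual_base W' & forall g, W' g -> W (f + g).
Proof.
move=> [B [e [bB e0 ->]]] f [c /andP[c0 ce] fc].
exists (dual_ball B (e - c)).
  by exists B, (e - c); split => //; rewrite subr_gt0.
move=> g [d /andP[d0 de] gd]; exists (c + d).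
  by rewrite addr_ge0//= addrC -ltrBrDr.
move=> x Bx; apply: le_trans (ler_normD _ _) _.
by rewrite lerD ?fc ?gd.
Qed.

Let dual_add := base_add_continuous nbhsP base_convex base_scale.
Let dual_scale := base_scale_continuous nbhsP base_convex base_balanced
  base_scale base_absorb.
Let dual_convex := base_locally_convex nbhsP base_convex base_absorb base_open.

HB.instance Definition _ := PreTopologicalLmod_isTvs.Build K (strong_dual X)
  dual_add dual_scale dual_convex.
HB.instance Definition _ :=
  PreTopologicalNmodule_isTopologicalNmodule.Build (strong_dual X) dual_add.
HB.instance Definition _ :=
  TopologicalNmodule_isTopologicalLmodule.Build K (strong_dual X) dual_scale.
HB.instance Definition _ := Uniform_isTvs.Build K (strong_dual X) dual_convex.

End StrongDual.

Section SequenceSpaces.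
Context {R : realType}.
Implicit Types (X Y : lcseq R) (q : R).

Lemma set1_seminorm (A : set (omega R)) (nu : omega R -> R) :
  seminorm_on A nu -> forall p : omega R -> R, [set nu] p -> seminorm_on A p.
Proof. by move=> h p ->. Qed.

Let gt0 q : 1 <= q -> 0 < q. Proof. exact: lt_le_trans. Qed.

Definition ell_space q (q1 : 1 <= q) : lcseq R :=
  Lcseq (ell_subspace q1) (fun n => ell_unit n (gt0 q1))
        (set1_seminorm (ell_seminorm q1)).

Definition ces_space q (q1 : 1 < q) : lcseq R :=
  Lcseq (ces_subspace (ltW q1)) (fun n => ces_unit n q1)
        (set1_seminorm (ces_seminorm (ltW q1))).

Definition d_space q (q1 : 1 <= q) : lcseq R :=
  Lcseq (dsp_subspace q1) (fun n => dsp_unit n (gt0 q1))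
        (set1_seminorm (dsp_seminorm q1)).

Section ProjectiveLimit.
Variable E : nat -> lcseq R.

Let proj_seminorms : set (omega R -> R) := \bigcup_k seminorms (E k).
Let proj_carrier : set (omega R) := \bigcap_k carrier (E k).

Let proj_subspace : linear_subspace proj_carrier.
Proof.
split; first by move=> k _; case: (carrier_subspace (E k)).
- move=> x y cx cy k _; case: (carrier_subspace (E k)) => _ + _; apply.
    exact: cx.
  exact: cy.
- by move=> a x cx k _; case: (carrier_subspace (E k)) => _ _; apply; exact: cx.
Qed.

Let proj_unit n : proj_carrier (unit_seq n).
Proof. by move=> k _; exact: carrier_unit. Qed.

Let proj_seminormsP p : proj_seminorms p -> seminorm_on proj_carrier p.
Proof.
move=> [k _ /seminormsP[pD pZ]]; split.
  by move=> x y cx cy; apply: pD; [exact: cx|exact: cy].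
by move=> a x cx; apply: pZ; exact: cx.
Qed.

Definition proj_lim : lcseq R := Lcseq proj_subspace proj_unit proj_seminormsP.

End ProjectiveLimit.

Section InductiveLimit.
Variables (E : nat -> lcseq R)
          (mono : forall k, carrier (E k) `<=` carrier (E k.+1)).

Let ind_carrier : set (omega R) := \bigcup_k carrier (E k).

(* A locally convex topology on the union makes the inclusions continuous iff
   each of its continuous seminorms is continuous on every step, so the finest
   such topology is generated by all the seminorms with this property; see
   ind_lim_incl and ind_lim_finest. *)
Let ind_seminorms : set (omega R -> R) :=
  [set p | seminorm_on ind_carrier p /\
           forall k, continuous (fun x : elt (E k) => p x)].

Let mono_le j k : (j <= k)%N -> carrier (E j) `<=` carrier (E k).
Proof.
move=> /subnKC <-; elim: (k - j)%N => [|m IH]; first by rewrite addn0.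
by rewrite addnS; apply: subset_trans IH _; exact: mono.
Qed.

Let ind_subspace : linear_subspace ind_carrier.
Proof.
split; first by exists 0%N => //; case: (carrier_subspace (E 0)).
- move=> x y [j _ cx] [k _ cy]; exists (maxn j k) => //.
  case: (carrier_subspace (E (maxn j k))) => _ + _; apply.
    exact: mono_le (leq_maxl _ _) _ cx.
  exact: mono_le (leq_maxr _ _) _ cy.
- move=> a x [k _ cx]; exists k => //.
  by case: (carrier_subspace (E k)) => _ _; apply.
Qed.

Let ind_unit n : ind_carrier (unit_seq n).
Proof. by exists 0%N => //; exact: carrier_unit. Qed.

Let ind_seminormsP p : ind_seminorms p -> seminorm_on ind_carrier p.
Proof. by case. Qed.

Definition ind_lim : lcseq R := Lcseq ind_subspace ind_unit ind_seminormsP.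

End InductiveLimit.

Definition cont_incl X Y : Prop :=
  carrier X `<=` carrier Y /\
  forall f : elt X -> elt Y, (forall x, f x = x :> omega R) -> continuous f.

Lemma incl_continuous X Y (f : elt X -> elt Y) :
  (forall x, f x = x :> omega R) ->
  (forall p, seminorms Y p -> continuous (fun x : elt X => p x)) -> continuous f.
Proof.
move=> fx cp x U [W [n [p [e [Yp e0 ->]]]] WU].
have f0 : seq_of (0 : elt X) = seq_of (0 : elt Y) by [].
have pi_lt i : nbhs (0 : elt X) [set z : elt X | p i z < e].
  have pi0 : p i (0 : elt X) < e by rewrite f0 seminorm0.
  exact: (cvgr_lt _ (cp _ (Yp i) (0 : elt X)) _ pi0).
have FF : Filter (nbhs (0 : elt X)) by exact: nbhs_filter.
have [W0 bW0 W0p] := filter_forall FF pi_lt.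
exists W0 => // y W0y; apply: WU => i.
have -> : seq_of (f y - f x) = seq_of (y - x).
  have -> : seq_of (f y - f x) = seq_of (f y) - seq_of (f x) by [].
  by rewrite !fx.
by apply: W0p; rewrite subr0.
Qed.

Lemma seminorm_continuous X (p : omega R -> R) :
  seminorms X p -> continuous (fun x : elt X => p x).
Proof.
move=> Xp x; have FF : Filter (nbhs x) by exact: nbhs_filter.
apply/(@cvgrPdist_lt _ _ _ (nbhs x) FF) => e e0.
exists (seminorm_ball (fun _ : 'I_1 => p) e).
  by exists 1%N, (fun _ => p), e.
move=> y /(_ ord0) pyx; rewrite distrC; apply: le_lt_trans pyx.
have p_le (u v : elt X) : p u - p v <= p (u - v).
  by rewrite lerBlDr -[in leLHS](subrK v u) seminormD.
rewrite ler_norml p_le andbT lerNl opprB.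
apply: le_trans (p_le x y) _.
rewrite -opprB -scaleN1r seminormZ//.
by rewrite -(rmorph1 (real_complex R)) -rmorphN cmodR normrN1 mul1r.
Qed.

Lemma ind_lim_incl E (mono : forall k, carrier (E k) `<=` carrier (E k.+1)) k :
  cont_incl (E k) (ind_lim mono).
Proof.
split; first by move=> x cx; exists k.
by move=> f fE; apply: incl_continuous fE _ => p [_ +]; exact.
Qed.

Lemma ind_lim_finest E (mono : forall k, carrier (E k) `<=` carrier (E k.+1)) Y :
  carrier Y = carrier (ind_lim mono) -> (forall k, cont_incl (E k) Y) ->
  cont_incl (ind_lim mono) Y.
Proof.
move=> cY inclY; split; first by rewrite cY.
move=> f fE; apply: incl_continuous fE _ => p Yp.
apply: seminorm_continuous; split.
  by have := seminormsP Yp; rewrite cY.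
move=> k; have [EY incl] := inclY k.
pose g (x : elt (E k)) : elt Y := Elt (mem_set (EY _ (set_mem (seq_ofP x)))).
have cg : continuous g by exact: incl.
have -> : (fun x : elt (E k) => p x) = (fun y : elt Y => p y) \o g by [].
by move=> x; apply: continuous_comp; [exact: cg|exact: seminorm_continuous].
Qed.

Inductive seq_family := FamEll | FamCes | FamD.

Definition banach_space (F : seq_family) q (q1 : 1 < q) : lcseq R :=
  match F with
  | FamEll => ell_space (ltW q1)
  | FamCes => ces_space q1
  | FamD => d_space (ltW q1)
  end.

Lemma banach_space_le F q r (q1 : 1 < q) (r1 : 1 < r) : q <= r ->
  carrier (banach_space F q1) `<=` carrier (banach_space F r1).
Proof.
have q0 : 0 < q by apply: lt_trans q1.
by case: F => /= qr; [exact: ell_le|exact: ces_le|exact: dsp_le].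
Qed.

Definition decreasing_to (pk : nat -> R) (p : R) : Prop :=
  [/\ forall k, pk k.+1 < pk k, forall k, p < pk k & pk @ \oo --> p].

Definition increasing_to (pk : nat -> R) (p : \bar R) : Prop :=
  [/\ forall k, pk k < pk k.+1, forall k, 1 < pk k,
      forall k, ((pk k)%:E < p)%E & (pk k)%:E @[k --> \oo] --> p].

Lemma decreasing_gt1 pk (p : R) : 1 <= p -> decreasing_to pk p -> forall k, 1 < pk k.
Proof. by move=> p1 [_ ppk _] k; exact: le_lt_trans (ppk k). Qed.

Lemma increasing_gt1 pk (p : \bar R) : increasing_to pk p -> forall k, 1 < pk k.
Proof. by case. Qed.

Definition plus_space F (p : R) (p1 : 1 <= p) pk (pkp : decreasing_to pk p) : lcseq R :=
  proj_lim (fun k => banach_space F (decreasing_gt1 p1 pkp k)).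

Lemma minus_steps F pk (p : \bar R) (pkp : increasing_to pk p) k :
  carrier (banach_space F (increasing_gt1 pkp k)) `<=`
  carrier (banach_space F (increasing_gt1 pkp k.+1)).
Proof. by apply: banach_space_le; case: (pkp) => lt_pk _ _ _; exact: ltW. Qed.

Definition minus_space F pk (p : \bar R) (pkp : increasing_to pk p) : lcseq R :=
  ind_lim (@minus_steps F pk p pkp).

Inductive listed_space : lcseq R -> Prop :=
| ListedD (p : R) (p1 : 1 <= p) : listed_space (d_space p1)
| ListedEll (p : R) (p1 : 1 <= p) : listed_space (ell_space p1)
| ListedCes (p : R) (p1 : 1 < p) : listed_space (ces_space p1)
| ListedPlus F (p : R) (p1 : 1 <= p) pk (pkp : decreasing_to pk p) :
    listed_space (plus_space F p1 pkp)
| ListedMinus F (p : \bar R) (p1 : (1 < p)%E) pk (pkp : increasing_to pk p) :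
    listed_space (minus_space F pkp).

Definition unit_elt X n : elt X := Elt (mem_set (carrier_unit X n)).

(* y in X' is identified with the sequence (y (e_n))_n. *)
Definition dual_seq X (y : strong_dual (elt X : tvsType R[i])) : omega R :=
  fun n => y (unit_elt X n).

Definition Lambda : set R[i] := [set n.+1%:R^-1 | n in [set: nat]].

Definition eigen_seq (t : R) (n : nat) : omega R :=
  \sum_(i < n.+1) ((-1) ^+ i * 'C(n, i)%:R * t%:C ^+ i) *: unit_seq (n - i).

End SequenceSpaces.

(* Main.v *)
Require Import Defs.
From mathcomp Require Import all_boot all_order all_algebra.
From mathcomp Require Import all_classical all_reals all_analysis.
From mathcomp Require Import complex.
From mathcomp Require Import ring lra zify.

Set Implicit Arguments.
Unset Strict Implicit.
Unset Printing Implicit Defensive.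

Import Order.TTheory GRing.Theory Num.Theory.
Import numFieldNormedType.Exports.

Local Open Scope classical_set_scope.
Local Open Scope ring_scope.
Local Open Scope complex_scope.

(* C_t u is dominated by the geometric means (n+1)^-1 sum_(k <= n) t^(n-k) |u_k|, and every
   listed space is solid for this domination. Solving (mu - C_t) x = u coordinatewise gives
   v = C_t x with (n+1) v_n dominated by a geometric convolution of |u| with any ratio
   tau in (t, 1), uniformly for mu near a point outside Lambda and 0. Hence the resolvents
   exist on X and are equicontinuous, and their transposes are the resolvents of C_t'.
   For compactness, C_t maps X into l^1 (into d_1 for the spaces d), and its tails are
   small in that norm uniformly on bounded sets; so C_t' maps the polar of the unit ball
   of l^1 (of d_1) into a set of functionals on which pointwise and strong convergence
   agree, and which is therefore compact. The eigenvectors of C_t, and of C_t' by means of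
   (n+1) C_t (e_n - t e_(n+1)) = e_n, are determined by two-term recursions. *)

(** The relation [dominated] involves moduli only, so that C_t x, the resolvents and the
    eigenvectors of C_t stay in X for one and the same reason, checked once per family as a [step].
    The ratio must exceed t: the recursion for (n+1) v_n has factor t mu / (mu - 1/(n+1)), which
    tends to t but may stay above it. The inductive limits shape the rest: their seminorms are not
    explicit, so estimates are made for an arbitrary seminorm, uniformly over all v dominated by u,
    and the auxiliary norm used for compactness lives on all steps at once. The spaces d have their
    own auxiliary norm and ball, since the e_n have l^1 norm 1 but are unbounded in d_p. Compactness
    is shown for C_t' directly. Subtracting from x a combination of preimages of e_0, ..., e_(N-1)
    removes the first N entries of C_t x, so C_t' y is determined at x, up to a small error, by its
    values at N fixed vectors. The same preimages recover y from C_t' y, which turns the eigenvalue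
    equation into a recursion between neighbouring entries. *)

Section FiniteSums.
Context {R : realType}.
Implicit Types (x y u v a : omega R) (q tau : R).

(** * Moduli, l^q norms through finite sums, and geometric convolutions *)

Lemma cmodN (z : R[i]) : cmod (- z) = cmod z.
Proof. by apply: complexI; rewrite -!cmodE normrN. Qed.

Lemma cmodV (z : R[i]) : cmod z^-1 = (cmod z)^-1.
Proof. by apply: complexI; rewrite fmorphV -!cmodE normfV. Qed.

Lemma cmod_nat n : cmod (n%:R : R[i]) = n%:R.
Proof. by rewrite -(rmorph_nat (real_complex R)) cmodR ger0_norm. Qed.

Lemma cmodX (z : R[i]) n : cmod (z ^+ n) = cmod z ^+ n.
Proof. by apply: complexI; rewrite rmorphXn/= -!cmodE normrX. Qed.

Lemma cmod_eq0 (z : R[i]) : (cmod z == 0) = (z == 0).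
Proof. by rewrite -(inj_eq (@complexI R)) -cmodE normr_eq0. Qed.

Lemma cmod_sum (I : Type) (r : seq I) (P : pred I) (F : I -> R[i]) :
  cmod (\sum_(i <- r | P i) F i) <= \sum_(i <- r | P i) cmod (F i).
Proof.
elim/big_rec2: _ => [|i m z _ zm]; first by rewrite cmod0.
by apply: le_trans (cmodD _ _) _; rewrite lerD2l.
Qed.

(** Together with [ell_partial], this reduces estimates of l^q norms to finite real sums of q-th
    powers. *)
Lemma ell_bound q x (C : R) : 0 < q -> 0 <= C ->
  (forall n, \sum_(k < n) cmod (x k) `^ q <= C `^ q) ->
  ell q x /\ ell_norm q x <= C.
Proof.
move=> q0 C0 xC.
have S_le : (\sum_(k <oo) ((cmod (x k)) `^ q)%:E <= (C `^ q)%:E)%E.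
  apply: lime_le.
    by apply: is_cvg_nneseries => k _ _; rewrite lee_fin powR_ge0.
  by apply: nearW => n; rewrite sumEFin lee_fin big_mkord.
have S_ge0 : (0 <= \sum_(k <oo) ((cmod (x k)) `^ q)%:E)%E.
  by apply: nneseries_ge0 => k _ _; rewrite lee_fin powR_ge0.
have lC : (lnorm q x <= C%:E)%E.
  rewrite lnormE// -[C in leRHS]powRr1// -(mulfV (lt0r_neq0 q0)) powRrM -poweR_EFin.
  apply: gt0_ler_poweR => //; rewrite ?invr_ge0 ?(ltW q0)//.
    by rewrite in_itv /= leey andbT.
  by rewrite in_itv /= leey andbT lee_fin powR_ge0.
have lx : ell q x by apply: le_lt_trans lC (ltry _).
split => //; rewrite -lee_fin fineK// ge0_fin_numE ?lnorm_ge0//.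
Qed.

Lemma ell_partial q x n : 0 < q -> ell q x ->
  \sum_(k < n) cmod (x k) `^ q <= ell_norm q x `^ q.
Proof.
move=> q0 lx; have l0 := lnorm_ge0 q x.
have fx : lnorm q x \is a fin_num by rewrite ge0_fin_numE.
have S0 : (0 <= \sum_(k <oo) ((cmod (x k)) `^ q)%:E)%E.
  by apply: nneseries_ge0 => k _ _; rewrite lee_fin powR_ge0.
rewrite -lee_fin -poweR_EFin fineK// lnormE// -poweRrM mulVf ?gt_eqF// poweRe1//.
rewrite -sumEFin -(big_mkord xpredT (fun k => (cmod (x k) `^ q)%:E)).
by apply: nneseries_lim_ge => k _ _; rewrite lee_fin powR_ge0.
Qed.

Lemma ell_norm_ge0 q x : 0 <= ell_norm q x.
Proof. by rewrite fine_ge0 ?lnorm_ge0. Qed.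

Lemma ell_coord q x n : 0 < q -> ell q x -> cmod (x n) <= ell_norm q x.
Proof.
move=> q0 lx; have := ell_partial n.+1 q0 lx.
rewrite big_ord_recr /= => h.
have {h} : cmod (x n) `^ q <= ell_norm q x `^ q.
  by apply: le_trans h; rewrite lerDr sumr_ge0// => i _; rewrite powR_ge0.
move=> /(ge0_ler_powR (r := q^-1)); rewrite invr_ge0 (ltW q0) !nnegrE !powR_ge0.
by move=> /(_ isT isT isT); rewrite -!powRrM mulfV ?gt_eqF// !powRr1 ?cmod_ge0 ?ell_norm_ge0.
Qed.

Lemma ell1_bound x (C : R) : (forall n, \sum_(k < n) cmod (x k) <= C) ->
  ell 1 x /\ ell_norm 1 x <= C.
Proof.
move=> xC; have C0 : 0 <= C by have := xC 0%N; rewrite big_ord0.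
apply: ell_bound => // n; rewrite powRr1//.
by apply: le_trans (xC n); apply: ler_sum => i _; rewrite powRr1 ?cmod_ge0.
Qed.

Lemma ell1_partial x n : ell 1 x -> \sum_(k < n) cmod (x k) <= ell_norm 1 x.
Proof.
move=> /(ell_partial n ltr01); rewrite powRr1 ?ell_norm_ge0//; apply: le_trans.
by apply: ler_sum => i _; rewrite powRr1 ?cmod_ge0.
Qed.

Lemma le_ell_norm q x y (C : R) : 0 < q -> 0 <= C ->
  (forall n, cmod (x n) <= C * cmod (y n)) -> ell q y ->
  ell q x /\ ell_norm q x <= C * ell_norm q y.
Proof.
move=> q0 C0 xy ly; apply: ell_bound => //; first by rewrite mulr_ge0 ?ell_norm_ge0.
move=> n; rewrite powRM ?ell_norm_ge0//.
apply: le_trans (ler_wpM2l (powR_ge0 _ _) (ell_partial n q0 ly)).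
rewrite mulr_sumr; apply: ler_sum => k _; rewrite -powRM ?cmod_ge0//.
by rewrite ge0_ler_powR ?nnegrE ?(ltW q0) ?mulr_ge0 ?cmod_ge0.
Qed.

(** The convolution of |u| with the powers of tau, kept undivided so that it obeys the one-step
    recursion [geoS]. *)
Definition geo tau u (n : nat) : R := \sum_(k < n.+1) tau ^+ (n - k) * cmod (u k).

Lemma geo0 tau u : geo tau u 0 = cmod (u 0%N).
Proof. by rewrite /geo big_ord1 mul1r. Qed.

Lemma geoS tau u n : geo tau u n.+1 = cmod (u n.+1) + tau * geo tau u n.
Proof.
rewrite /geo big_ord_recr /= subnn mul1r addrC mulr_sumr; congr (_ + _).
by apply: eq_bigr => k _; rewrite mulrA -exprS subSn// -ltnS.
Qed.

Lemma geo_ge0 tau u n : 0 <= tau -> 0 <= geo tau u n.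
Proof. by move=> t0; rewrite sumr_ge0// => k _; rewrite mulr_ge0 ?exprn_ge0 ?cmod_ge0. Qed.

Lemma geo_mono tau u v n : 0 <= tau ->
  (forall k, (k <= n)%N -> cmod (u k) <= cmod (v k)) -> geo tau u n <= geo tau v n.
Proof.
move=> t0 uv; apply: ler_sum => k _.
by rewrite ler_wpM2l ?exprn_ge0// uv// -ltnS.
Qed.

Lemma geoD tau u v n : 0 <= tau -> geo tau (u + v) n <= geo tau u n + geo tau v n.
Proof.
move=> t0; rewrite /geo -big_split /=; apply: ler_sum => k _.
by rewrite -mulrDr ler_wpM2l ?exprn_ge0// cmodD.
Qed.

Lemma geoZ tau (c : R[i]) u n : geo tau (c *: u) n = cmod c * geo tau u n.
Proof.
rewrite /geo mulr_sumr; apply: eq_bigr => k _.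
by rewrite [cmod ((c *: u) k)]cmodM mulrCA.
Qed.

(* Convexity of the q-th power turns [geo (n+1) = |u (n+1)| + tau * geo n] into
   [geo (n+1) ^ q <= (1-tau)^(1-q) |u (n+1)| ^ q + tau * geo n ^ q], which can be summed. *)
Lemma geo_ell q tau u v (K : R) : 1 <= q -> 0 <= tau < 1 -> 0 <= K ->
  (forall n, cmod (v n) <= K * geo tau u n) -> ell q u ->
  ell q v /\ ell_norm q v <= K / (1 - tau) * ell_norm q u.
Proof.
move=> q1 /andP[t0 t1] K0 vu lu; have q0 : 0 < q by apply: lt_le_trans q1.
have s0 : 0 < 1 - tau by rewrite subr_gt0.
pose a k := (cmod (u k) / (1 - tau)) `^ q.
pose g k := geo tau u k `^ q.
have a0 k : 0 <= a k by exact: powR_ge0.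
have g0 k : 0 <= g k by exact: powR_ge0.
have geoE0 k : 0 <= geo tau u k by exact: geo_ge0.
have conv (b c : R) : 0 <= b -> 0 <= c ->
    ((1 - tau) * b + tau * c) `^ q <= (1 - tau) * b `^ q + tau * c `^ q.
  move=> b0 c0.
  have s1 : 1 - tau <= 1 by rewrite gerBl.
  have := @convex_powR R q q1 (Itv01 (ltW s0) s1) b c.
  rewrite !inE /= !in_itv /= !andbT => /(_ b0 c0) h.
  rewrite convRE in h.
  rewrite [X in X `^ _ <= _]convRE in h; move: h => /=.
  have -> : unstable.onem (1 - tau) = tau by rewrite /unstable.onem opprB addrC subrK.
  by [].
have gS k : g k.+1 <= (1 - tau) * a k.+1 + tau * g k.
  rewrite /g geoS.
  have -> : cmod (u k.+1) = (1 - tau) * (cmod (u k.+1) / (1 - tau)).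
    by rewrite mulrC divfK ?gt_eqF.
  by apply: conv => //; rewrite divr_ge0 ?cmod_ge0 ?ltW.
have g00 : g 0%N <= (1 - tau) * a 0%N.
  rewrite /g geo0; have -> : cmod (u 0%N) = (1 - tau) * (cmod (u 0%N) / (1 - tau)) + tau * 0.
    by rewrite mulr0 addr0 mulrC divfK ?gt_eqF.
  apply: le_trans (conv _ _ _ _) _; rewrite ?divr_ge0 ?cmod_ge0 ?(ltW s0)//.
  by rewrite powR0 ?gt_eqF// mulr0 addr0.
(* Summing [gS] leaves tau times the sum of g on the right; the sums are finite, so it can be
   subtracted. *)
have gsum n : \sum_(k < n) g k <= \sum_(k < n) a k.
  have : \sum_(k < n) g k <= (1 - tau) * \sum_(k < n) a k + tau * \sum_(k < n) g k.
    case: n => [|n]; first by rewrite !big_ord0 !mulr0 addr0.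
    apply: (@le_trans _ _ ((1 - tau) * \sum_(k < n.+1) a k + tau * \sum_(k < n) g k)).
      rewrite big_ord_recl [in leRHS]big_ord_recl mulrDr -addrA lerD// !mulr_sumr -big_split /=.
      by apply: ler_sum => k _; exact: gS.
    rewrite lerD2l ler_wpM2l// big_ord_recr /= lerDl//.
  rewrite -lerBlDr -[X in X - _]mul1r -mulrBl ler_pM2l//.
apply: ell_bound => //; first by rewrite mulr_ge0 ?divr_ge0 ?ell_norm_ge0 ?(ltW s0).
move=> n; rewrite powRM ?divr_ge0 ?ell_norm_ge0 ?(ltW s0)//.
apply: le_trans (ler_wpM2l (powR_ge0 _ _) (ell_partial n q0 lu)).
rewrite powRM ?invr_ge0 ?(ltW s0)// -mulrA.
apply: (@le_trans _ _ (K `^ q * \sum_(k < n) g k)).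
  rewrite mulr_sumr; apply: ler_sum => k _; rewrite /g -powRM//.
  by rewrite ge0_ler_powR ?nnegrE ?(ltW q0) ?mulr_ge0 ?cmod_ge0.
rewrite ler_wpM2l ?powR_ge0//; apply: le_trans (gsum n) _.
rewrite mulr_sumr; apply: ler_sum => k _; rewrite -powRM ?invr_ge0 ?(ltW s0) ?cmod_ge0//.
by rewrite mulrC.
Qed.

Lemma ell_dominated_cvg q a (z : nat -> omega R) : 0 < q -> ell q a ->
  (forall N n, cmod (z N n) <= cmod (a n)) ->
  (forall n, cmod (z N n) @[N --> \oo] --> 0) ->
  ell_norm q (z N) @[N --> \oo] --> 0.
Proof.
move=> q0 la za z0; apply/cvgr0Pnorm_le => e e0.
have eq0 : 0 < e `^ q / 2 by rewrite divr_gt0// powR_gt0.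
pose S n := \sum_(0 <= k < n) cmod (a k) `^ q.
have S_mono : {homo S : m n / (m <= n)%N >-> m <= n}.
  by move=> m n mn; rewrite /S (big_cat_nat (leq0n m) mn)//= lerDl sumr_ge0// => k _; rewrite powR_ge0.
have Scvg : cvgn S.
  apply: nondecreasing_is_cvgn => //; exists (ell_norm q a `^ q) => _ [n _ <-].
  by rewrite /S big_mkord ell_partial.
have S_le n : S n <= limn S by apply: nondecreasing_cvgn_le.
have [L SL] : exists L, limn S - e `^ q / 2 <= S L.
  have /cvgrPdist_le /(_ _ eq0) [L _ /(_ L (leqnn L))] := Scvg.
  by move=> /ler_normlP[_]; rewrite lerBlDr addrC -lerBlDr => ?; exists L.
(* Beyond L the majorant a contributes at most e^q / 2; L entries of size [eta] contribute at most
   the other half. Dividing by L+1 covers L = 0. *)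
pose eta := (e `^ q / 2 / L.+1%:R) `^ q^-1.
have eta0 : 0 < eta by rewrite powR_gt0// divr_gt0.
have zL : \forall N \near \oo, forall k : 'I_L, cmod (z N k) <= eta.
  apply: filter_forall => k; have /cvgr0Pnorm_le /(_ _ eta0) := z0 k.
  by apply: filterS => N; rewrite ger0_norm ?cmod_ge0.
near=> N; rewrite ger0_norm ?ell_norm_ge0//.
have zN : forall k : 'I_L, cmod (z N k) <= eta by near: N.
apply: (proj2 (ell_bound q0 (ltW e0) _)) => n.
apply: (@le_trans _ _ (\sum_(0 <= k < maxn n L) cmod (z N k) `^ q)).
  rewrite -(big_mkord xpredT (fun k => cmod (z N k) `^ q)).
  rewrite (big_cat_nat (leq0n _) (leq_maxl n L))//= lerDl sumr_ge0// => k _; exact: powR_ge0.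
rewrite (big_cat_nat (leq0n _) (leq_maxr n L))//= [leRHS]splitr lerD//.
  rewrite big_mkord; apply: (@le_trans _ _ (\sum_(k < L) (e `^ q / 2 / L.+1%:R))).
    apply: ler_sum => k _.
    have <- : eta `^ q = e `^ q / 2 / L.+1%:R.
      by rewrite /eta -powRrM mulVf ?gt_eqF// powRr1// divr_ge0 ?(ltW eq0).
    by rewrite ge0_ler_powR ?nnegrE ?(ltW q0) ?cmod_ge0 ?powR_ge0.
  rewrite sumr_const card_ord -[leLHS]mulr_natr mulrAC ler_pdivrMr//.
  by rewrite ler_wpM2l ?ler_nat ?(ltW eq0).
apply: (@le_trans _ _ (\sum_(L <= k < maxn n L) cmod (a k) `^ q)).
  apply: ler_sum => k _.
  by rewrite ge0_ler_powR ?nnegrE ?(ltW q0) ?cmod_ge0.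
have := S_le (maxn n L); rewrite {1}/S (big_cat_nat (leq0n _) (leq_maxr n L))//= -/(S L).
by move: SL; lra.
Unshelve. all: by end_near.
Qed.

End FiniteSums.

(** * The weighted l^1 space that contains the l^q and ces(q) *)

Section Weights.
Context {R : realType}.
Implicit Types (x y u v a : omega R) (q tau t : R).

(* Any X in the list embeds continuously into the weighted l^1 space with weights
   lam k / (k+1), also X = l(infty-), since lam grows slower than every power; as lam
   is unbounded, the tails of C_t x are small uniformly on bounded sets. *)
Definition lam (k : nat) : R := 1 + ln k.+1%:R.

Definition weighted x : omega R := fun k => (lam k / k.+1%:R)%:C * x k.

Lemma lam_ge1 k : 1 <= lam k.
Proof. by rewrite lerDl ln_ge0// ler1n. Qed.

Lemma lam_gt0 k : 0 < lam k.
Proof. exact: lt_le_trans (lam_ge1 k). Qed.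

Lemma lam_le m n : (m <= n)%N -> lam m <= lam n.
Proof. by move=> mn; rewrite lerD2l ler_ln ?posrE ?ler_nat. Qed.

(** Allows the weight at n to be moved inside a convolution, onto earlier entries. It rests on ln
    (z/y) <= z/y - 1. *)
Lemma lam_anti m n : (m <= n)%N -> lam n / n.+1%:R <= lam m / m.+1%:R.
Proof.
move=> mn; rewrite ler_pdivrMr// mulrAC ler_pdivlMr//.
pose y : R := m.+1%:R; pose z : R := n.+1%:R.
have y0 : 0 < y by []. have z0 : 0 < z by [].
have yz : y <= z by rewrite ler_nat.
have lny : 0 <= ln y by rewrite ln_ge0// ler1n.
have lnz : ln z <= ln y + (z / y - 1).
  have -> : ln z = ln y + ln (z / y) by rewrite -lnM ?posrE ?divr_gt0// mulrC divfK ?gt_eqF.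
  have h : -1 < z / y - 1 by rewrite ltrBrDr addNr divr_gt0.
  by rewrite lerD2l; have := le_ln1Dx h; rewrite [1 + _]addrC subrK.
rewrite /lam -/y -/z.
apply: (@le_trans _ _ ((1 + (ln y + (z / y - 1))) * y)).
  by rewrite ler_wpM2r ?(ltW y0)// lerD2l.
have -> : (1 + (ln y + (z / y - 1))) * y = ln y * y + z.
  by field; rewrite gt_eqF.
rewrite mulrDl mul1r [leRHS]addrC lerD2r.
by rewrite ler_wpM2l.
Qed.

Lemma lam_powR q k : 0 < q -> lam k <= (1 + q^-1) * k.+1%:R `^ q.
Proof.
move=> q0; have y1 : (1 : R) <= k.+1%:R by rewrite ler1n.
have p1 : 1 <= k.+1%:R `^ q :> R by rewrite -[leLHS](powRr0 k.+1%:R) ler_powR// ltW.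
rewrite mulrDl mul1r lerD//.
rewrite mulrC ler_pdivlMr// mulrC -ln_powR.
apply: le_trans (_ : k.+1%:R `^ q - 1 <= _); last by rewrite gerBl.
have h : -1 < k.+1%:R `^ q - 1 :> R by apply: (@lt_le_trans _ _ 0); rewrite ?ltrN10 ?subr_ge0.
by have := le_ln1Dx h; rewrite [1 + _]addrC subrK.
Qed.

Lemma lam_cvgy : (lam k)^-1 @[k --> \oo] --> 0.
Proof.
apply/cvgr0Pnorm_le => e e0.
near=> k; rewrite ger0_norm ?invr_ge0 ?(ltW (lam_gt0 _))//.
rewrite -[e]invrK lef_pV2 ?posrE ?lam_gt0 ?invr_gt0//.
apply: (@le_trans _ _ (ln k.+1%:R)); last by rewrite lerDr.
rewrite -[e^-1]expRK ler_ln ?posrE ?expR_gt0//.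
apply: (@le_trans _ _ k%:R); last by rewrite ler_nat.
by near: k; exact: nbhs_infty_ger.
Unshelve. all: by end_near.
Qed.

Lemma cmod_weighted x k : cmod (weighted x k) = lam k / k.+1%:R * cmod (x k).
Proof. by rewrite /weighted cmodM cmodR ger0_norm// divr_ge0// ltW ?lam_gt0. Qed.

(* The two regimes |a_k| <= (k+1)^(-1/q) and |a_k| > (k+1)^(-1/q) replace Hoelder's inequality. *)
Lemma weighted_ell q : 1 <= q -> exists2 C : R, 0 <= C & forall a, ell q a ->
  ell 1 (weighted a) /\ ell_norm 1 (weighted a) <= C * ell_norm q a.
Proof.
move=> q1; have q0 : 0 < q by apply: lt_le_trans q1.
pose th := q^-1; have th0 : 0 < th by rewrite invr_gt0.
(* [th] is the threshold exponent 1/q, and [lam] is allowed to cost (k+1)^h: below the threshold the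
   exponents add up to (h - 1) - 2 h = -(1 + h), which is summable. *)
pose h := th / 2; have h0 : 0 < h by rewrite divr_gt0.
pose D := 1 + h^-1; have D0 : 0 < D by rewrite addr_gt0// invr_gt0.
have h1 : 1 < 1 + h by rewrite ltrDl.
pose T := (\sum_(k <oo) (D * k.+1%:R `^ (- (1 + h)))%:E)%E.
have T_ge0 : (0 <= T)%E.
  by apply: nneseries_ge0 => k _ _; rewrite lee_fin mulr_ge0 ?powR_ge0 ?ltW.
have Tfin : T \is a fin_num by rewrite ge0_fin_numE//; apply: cvg_riemann; rewrite ?ltW.
have Tle n : \sum_(k < n) D * k.+1%:R `^ (- (1 + h)) <= fine T.
  rewrite -lee_fin fineK// -sumEFin.
  rewrite -(big_mkord xpredT (fun k => (D * k.+1%:R `^ (- (1 + h)))%:E)).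
  by apply: nneseries_lim_ge => k _ _; rewrite lee_fin mulr_ge0 ?powR_ge0 ?ltW.
have term (b : R) k : 0 <= b ->
    lam k / k.+1%:R * b <= D * b `^ q + D * k.+1%:R `^ (- (1 + h)).
  move=> b0; have lk := lam_powR k h0.
  have y1 : (1 : R) <= k.+1%:R by rewrite ler1n.
  have y0 : (0 : R) < k.+1%:R by [].
  have wk : lam k / k.+1%:R <= D * k.+1%:R `^ (h - 1).
    rewrite powRD; last by rewrite (gt_eqF y0) implybT.
    by rewrite powR_inv1 ?(ltW y0)// mulrA ler_wpM2r ?invr_ge0 ?(ltW y0).
  have [bs|bl] := leP b (k.+1%:R `^ (- th)).
    rewrite -[leLHS]add0r lerD ?mulr_ge0 ?powR_ge0 ?(ltW D0)//.
    apply: le_trans (ler_pM _ b0 wk bs) _; first by rewrite divr_ge0 ?(ltW (lam_gt0 _)).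
    rewrite -mulrA -powRD; last by rewrite (gt_eqF y0) implybT.
    by rewrite le_eqVlt; apply/orP; left; apply/eqP; congr (_ * _ `^ _); rewrite /h; lra.
  have bp : 0 < b by apply: le_lt_trans bl; rewrite powR_ge0.
  rewrite -[leLHS]addr0 lerD ?mulr_ge0 ?powR_ge0 ?(ltW D0)//.
  (* Above the threshold b^(1-q) is at most (k+1)^(1-1/q), so the coefficient of b^q has exponent (h
     - 1) + (1 - 1/q) = -h and is bounded by D. *)
  have bE : b = b `^ (- (q - 1)) * b `^ q.
    rewrite -powRD; last by rewrite (gt_eqF bp) implybT.
    by rewrite opprB subrK powRr1.
  have bq : b `^ (- (q - 1)) <= k.+1%:R `^ (1 - th).
    have -> : k.+1%:R `^ (1 - th) = (k.+1%:R `^ (- th)) `^ (- (q - 1)) :> R.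
      rewrite -powRrM; congr (_ `^ _).
      by rewrite mulrNN mulrBr mulr1 /th mulVf ?gt_eqF.
    rewrite !powRN lef_pV2 ?posrE ?powR_gt0//.
    by rewrite ge0_ler_powR ?nnegrE ?subr_ge0 ?powR_ge0// -?powRN ltW.
  rewrite {1}bE mulrA ler_wpM2r ?powR_ge0//.
  apply: le_trans (ler_pM _ (powR_ge0 _ _) wk bq) _.
    by rewrite divr_ge0 ?(ltW (lam_gt0 _)).
  rewrite -mulrA -powRD; last by rewrite (gt_eqF y0) implybT.
  rewrite ler_piMr ?(ltW D0)// -[leRHS](powRr0 k.+1%:R) ler_powR//.
  by rewrite /h; lra.
exists (D + fine T); first by rewrite addr_ge0 ?(ltW D0) ?fine_ge0.
move=> a la; apply: ell1_bound => n.
(* The bound [term] is not homogeneous in b; it is applied to a divided by its norm, hence the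
   separate case of norm 0. *)
have [N0|N0] := eqVneq (ell_norm q a) 0.
  rewrite N0 mulr0 big1// => k _; rewrite cmod_weighted.
  have := ell_coord k q0 la; rewrite N0 => a0.
  have -> : cmod (a k) = 0 by apply/le_anti; rewrite a0 cmod_ge0.
  by rewrite mulr0.
have {}N0 : 0 < ell_norm q a by rewrite lt_neqAle eq_sym N0 ell_norm_ge0.
rewrite -ler_pdivrMr// mulr_suml.
pose b k := cmod (a k) / ell_norm q a.
apply: (@le_trans _ _ (\sum_(k < n) (D * b k `^ q + D * k.+1%:R `^ (- (1 + h))))).
  apply: ler_sum => k _; rewrite cmod_weighted -[leLHS]mulrA; apply: term.
  by rewrite divr_ge0 ?cmod_ge0 ?ltW.
rewrite big_split /=; apply: lerD; last exact: Tle.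
rewrite -mulr_sumr ler_piMr ?(ltW D0)//.
rewrite /b; under eq_bigr do rewrite powRM ?cmod_ge0 ?invr_ge0 ?(ltW N0)//.
rewrite -mulr_suml -powR_inv1 ?(ltW N0)// -powRrM mulN1r powRN.
by rewrite ler_pdivrMr ?powR_gt0// mul1r ell_partial.
Qed.

(** After exchanging the sums, |x_i| carries the weight sum over m >= i of lam m / (m+1)^2. The i+1
    terms with i <= m <= 2 i are each at least lam i / (2 (i+1))^2, which gives lam i / (4 (i+1)).
    For i < n these m lie below 2 n, whence the doubled range. *)
Lemma weighted_ces x : ell 1 (weighted (cesaro_op 1 (abs_seq x))) ->
  ell 1 (weighted x) /\
  ell_norm 1 (weighted x) <= 4 * ell_norm 1 (weighted (cesaro_op 1 (abs_seq x))).
Proof.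
move=> lx; apply: ell1_bound => n.
apply: le_trans (ler_wpM2l _ (ell1_partial n.*2 lx)); last by [].
pose c m : R := lam m / m.+1%:R / m.+1%:R.
have c0 m : 0 <= c m by rewrite !divr_ge0// ltW ?lam_gt0.
have -> : \sum_(m < n.*2) cmod (weighted (cesaro_op 1 (abs_seq x)) m) =
    \sum_(m < n.*2) \sum_(i < n.*2 | (i <= m)%N) c m * cmod (x i).
  apply: eq_bigr => m _.
  transitivity (c m * \sum_(i < m.+1) cmod (x i)).
    by rewrite cmod_weighted ces1E mulrA mulrAC.
  rewrite mulr_sumr (big_ord_widen n.*2 (fun i => c m * cmod (x i)))//.
rewrite (exchange_big_dep xpredT)//= mulr_sumr.
have nn : (n <= n.*2)%N by rewrite -addnn leq_addr.
rewrite (big_ord_widen _ (fun k => cmod (weighted x k)) nn) big_mkcond /=.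
apply: ler_sum => i _; rewrite -mulr_suml mulrA.
case: ifP => [lin|_]; last by rewrite mulr_ge0 ?cmod_ge0// mulr_ge0// sumr_ge0.
rewrite cmod_weighted ler_wpM2r ?cmod_ge0//.
have ii : (i.+1 + i <= n.*2)%N by have := leq_add lin (ltnW lin); rewrite addnn.
have ile : (i <= i.+1 + i)%N by rewrite leq_addl.
apply: (@le_trans _ _ (4 * \sum_(i <= m < i.+1 + i) c m)); last first.
  rewrite ler_wpM2l// -(big_mkord (fun m => (i <= m)%N) c).
  rewrite -(big_nat_widenl _ _ _ xpredT)// (big_cat_nat ile ii)//= lerDl.
  by rewrite sumr_ge0.
pose d : R := lam i / (4 * i.+1%:R * i.+1%:R).
apply: (@le_trans _ _ (4 * \sum_(i <= m < i.+1 + i) d)).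
  rewrite big_const_nat addnK iter_addr addr0 -[d *+ _]mulr_natr /d.
  rewrite le_eqVlt; apply/orP; left; apply/eqP.
  have : i.+1%:R != 0 :> R by rewrite pnatr_eq0.
  by move: (i.+1%:R : R) => y y0; field.
rewrite ler_wpM2l// [leRHS]big_nat_cond [leLHS]big_nat_cond ler_sum// => m /andP[/andP[im mi] _].
rewrite /c /d -[leRHS]mulrA -[X in _ <= _ * X]invfM ler_pM ?invr_ge0 ?(ltW (lam_gt0 _)) ?lam_le ?mulr_ge0//.
rewrite lef_pV2 ?posrE ?mulr_gt0//.
have -> : 4 * i.+1%:R * i.+1%:R = (2 * i.+1)%:R * (2 * i.+1)%:R :> R.
  by rewrite natrM; ring.
have mm : (m.+1 <= 2 * i.+1)%N by rewrite mul2n -addnn [(i.+1 + i.+1)%N]addnS leqW.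
by rewrite ler_pM// ler_nat.
Qed.

End Weights.

(** * Domination, and small tails of C_t x in l^1 and in d_1 *)

Section Control.
Context {R : realType}.
Implicit Types (x y u v a : omega R) (q tau t K : R).

Lemma omegaD x y n : (x + y) n = x n + y n. Proof. by []. Qed.

Lemma omegaB x y n : (x - y) n = x n - y n. Proof. by []. Qed.

Lemma omegaZ (c : R[i]) x n : (c *: x) n = c * x n. Proof. by []. Qed.

Lemma omega_sum (I : Type) (r : seq I) (F : I -> omega R) n :
  (\sum_(i <- r) F i) n = \sum_(i <- r) F i n.
Proof. by elim/big_rec2: _ => // i a b _ <-. Qed.

Lemma cesaro0 t x : cesaro_op t x 0 = x 0%N.
Proof. by rewrite /cesaro_op big_ord1 mul1r divr1. Qed.

Lemma cesaroS t x n : n.+2%:R * cesaro_op t x n.+1 =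
  x n.+1 + t%:C * (n.+1%:R * cesaro_op t x n).
Proof.
have E m : m.+1%:R * cesaro_op t x m = \sum_(i < m.+1) t%:C ^+ (m - i) * x i.
  by rewrite /cesaro_op mulrC divfK// pnatr_eq0.
rewrite !E big_ord_recr /= subnn mul1r addrC mulr_sumr; congr (_ + _).
apply: eq_bigr => i _; have /subSn -> : (i <= n)%N by rewrite -ltnS.
by rewrite exprS -mulrA.
Qed.

(** Identities for C_t (linearity, eigenvectors, resolvent equation) are obtained by checking this
    recursion rather than by manipulating the defining sum. *)
Lemma cesaro_unique t x v : v 0%N = x 0%N ->
  (forall n, n.+2%:R * v n.+1 = x n.+1 + t%:C * (n.+1%:R * v n)) ->
  v = cesaro_op t x.
Proof.
move=> v0 vS; apply/funext; elim=> [|n IH]; first by rewrite cesaro0.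
apply: (@mulfI _ n.+2%:R); first by rewrite pnatr_eq0.
by rewrite vS cesaroS IH.
Qed.

Lemma cesaroD t x y : cesaro_op t (x + y) = cesaro_op t x + cesaro_op t y.
Proof.
apply/esym/cesaro_unique; first by rewrite !omegaD !cesaro0.
by move=> n; rewrite !omegaD !mulrDr !cesaroS addrACA.
Qed.

Lemma cesaroZ t (c : R[i]) x : cesaro_op t (c *: x) = c *: cesaro_op t x.
Proof.
apply/esym/cesaro_unique; first by rewrite !omegaZ !cesaro0.
by move=> n; rewrite !omegaZ mulrCA cesaroS; ring.
Qed.

(** The factor n+1 records the gain of C_t over a plain convolution; both the weighted l^1 bound and
    the passage to [tail_sup] rely on it. *)
Definition dominated K tau u v : Prop :=
  forall n, n.+1%:R * cmod (v n) <= K * geo tau u n.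

Lemma cesaro_dominated t x : 0 <= t -> dominated 1 t x (cesaro_op t x).
Proof.
move=> t0 n; rewrite mul1r; elim: n => [|n IH]; first by rewrite mul1r cesaro0 geo0.
rewrite -cmod_nat -cmodM cesaroS geoS; apply: le_trans (cmodD _ _) _.
by rewrite lerD2l cmodM cmodR ger0_norm// ler_wpM2l// cmodM cmod_nat.
Qed.

Lemma dominated_le K tau u v n : 0 <= tau -> 0 <= K -> dominated K tau u v ->
  cmod (v n) <= K * geo tau u n.
Proof.
move=> t0 K0 /(_ n); apply: le_trans.
by rewrite ler_peMl ?cmod_ge0// ler1n.
Qed.

Definition trunc N x : omega R := fun n => if (n < N)%N then x n else 0.

Lemma trunc_sum N x : trunc N x = \sum_(i < N) x i *: unit_seq i.
Proof.
apply/funext => n; rewrite /trunc omega_sum.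
under eq_bigr do rewrite omegaZ /unit_seq.
have [nN|Nn] := ltnP n N.
  rewrite (bigD1 (Ordinal nN))//= eqxx big1 ?addr0; first by rewrite mulr1.
  by move=> i /negPf; rewrite -val_eqE /= => ->; rewrite mulr0.
by rewrite big1// => i _; rewrite ltn_eqF ?(leq_trans (ltn_ord i))// mulr0.
Qed.

(* B0 stands for the unit ball of l^1 or of d_1: control_trunc says that the tails of
   C_t x are small in its gauge, uniformly for s x <= 1. *)
Record control t (D : set (omega R)) (s : omega R -> R) (B0 : set (omega R)) : Prop := {
  control_seminorm : seminorm_on D s ;
  control_trunc : exists2 eps : nat -> R, eps n @[n --> \oo] --> 0 &
    forall x N M (c : R), D x -> (N <= M)%N -> 0 < c -> eps N * s x <= c ->
      B0 ((c^-1)%:C *: (trunc M (cesaro_op t x) - trunc N (cesaro_op t x))) ;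
  control_coord : forall x n, D x -> cmod (x n) <= n.+1%:R * s x ;
  control_unit : forall n, B0 (((n.+1%:R : R)^-1)%:C *: unit_seq n)
}.

Lemma cmod_truncB z N M n : (N <= M)%N ->
  cmod ((trunc M z - trunc N z) n) <= if (N <= n)%N then cmod (z n) else 0.
Proof.
move=> NM; rewrite omegaB /trunc.
have [Nn|Nn] := leqP N n; last by rewrite (leq_trans Nn NM) subrr cmod0.
by rewrite subr0; case: ifP => //; rewrite cmod0 cmod_ge0.
Qed.

Lemma weighted_linear (c : R[i]) x y : weighted (c *: x + y) = c *: weighted x + weighted y.
Proof.
apply/funext => n; rewrite /weighted !omegaD mulrDr; congr (_ + _).
by rewrite !omegaZ mulrCA.
Qed.

(** The factor n+1 in the domination turns lam k into lam k / (k+1), and these decreasing weights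
    pass inside the convolution; so lam v is dominated by a convolution of [weighted u]. The divisor
    k+1 is thus gained, and the unbounded weight lam forces small tails. *)
Lemma dominated_weighted tau u v : 0 <= tau < 1 -> dominated 1 tau u v ->
  ell 1 (weighted u) ->
  forall n, \sum_(k < n) lam k * cmod (v k) <= (1 - tau)^-1 * ell_norm 1 (weighted u).
Proof.
move=> t01 uv lu n; have /andP[t0 t1] := t01.
pose z : omega R := fun k => (lam k)%:C * v k.
have zE k : cmod (z k) = lam k * cmod (v k).
  by rewrite cmodM cmodR ger0_norm// ltW ?lam_gt0.
have zu k : cmod (z k) <= 1 * geo tau (weighted u) k.
  rewrite zE mul1r; apply: (@le_trans _ _ (lam k / k.+1%:R * geo tau u k)).
    rewrite mulrAC ler_pdivlMr// -mulrA ler_wpM2l ?(ltW (lam_gt0 _))// mulrC.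
    by have := uv k; rewrite mul1r.
  rewrite /geo mulr_sumr; apply: ler_sum => i _.
  rewrite mulrCA cmod_weighted ler_wpM2l ?exprn_ge0// ler_wpM2r ?cmod_ge0//.
  by rewrite lam_anti// -ltnS.
have [lz Nz] := geo_ell (lexx 1) t01 ler01 zu lu.
rewrite div1r in Nz; apply: le_trans Nz; apply: le_trans (ell1_partial n lz).
by apply: ler_sum => k _; rewrite zE.
Qed.

Lemma lam_half_cvg (C : R) : C / lam n./2 @[n --> \oo] --> 0.
Proof.
rewrite -(mulr0 C); apply: cvgMr.
have : (n./2) @[n --> \oo] --> \oo.
  apply/cvgnyPge => A; near=> n; rewrite geq_half_double.
  by near: n; exact: nbhs_infty_ge.
by move=> h; exact: (cvg_comp _ _ h lam_cvgy).
Unshelve. all: by end_near.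
Qed.

Lemma ell1_unit_ball (f : omega R) (c : R) : 0 < c -> (forall n, \sum_(k < n) cmod (f k) <= c) ->
  ell 1 ((c^-1)%:C *: f) /\ ell_norm 1 ((c^-1)%:C *: f) <= 1.
Proof.
move=> c0 fc; apply: ell1_bound => n.
under eq_bigr => k _.
  rewrite omegaZ cmodM cmodR gtr0_norm ?invr_gt0//.
  over.
by rewrite -mulr_sumr ler_pdivrMl// mulr1.
Qed.

Lemma weighted_seminorm : seminorm_on [set x | ell 1 (weighted x)]
  (fun x => ell_norm 1 (weighted x)).
Proof.
have [nD nZ] := @ell_seminorm R 1 (lexx 1); split.
  move=> x y lx ly; have -> : x + y = 1 *: x + y by rewrite scale1r.
  by rewrite weighted_linear scale1r; exact: nD.
move=> c x lx; rewrite -[c *: x]addr0 weighted_linear.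
have -> : weighted 0 = 0 :> omega R by apply/funext => n; rewrite /weighted mulr0.
by rewrite addr0; exact: nZ.
Qed.

Lemma weighted_coord x n : ell 1 (weighted x) ->
  cmod (x n) <= n.+1%:R * ell_norm 1 (weighted x).
Proof.
move=> lx; have := ell_coord n ltr01 lx; rewrite cmod_weighted mulrAC ler_pdivrMr// => h.
by rewrite mulrC; apply: le_trans h; rewrite ler_peMl ?cmod_ge0 ?lam_ge1.
Qed.

Lemma ell_control t : 0 <= t < 1 ->
  control t [set x | ell 1 (weighted x)] (fun x => ell_norm 1 (weighted x))
    [set b | ell 1 b /\ ell_norm 1 b <= 1].
Proof.
move=> t01; have /andP[t0 t1] := t01; split.
- exact: weighted_seminorm.
(* From index N on the weights are at least lam N, so the tail is at most the weighted sum divided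
   by lam N. *)
- exists (fun n => (1 - t)^-1 / lam n).
    by rewrite -(mulr0 (1 - t)^-1); apply: cvgMr; exact: lam_cvgy.
  move=> x N M c lx NM c0 sc; apply: ell1_unit_ball => // n.
  have h := dominated_weighted t01 (cesaro_dominated x t0) lx n.
  apply: le_trans sc; rewrite mulrAC ler_pdivlMr ?lam_gt0//; apply: le_trans h.
  rewrite mulr_suml; apply: ler_sum => k _.
  rewrite mulrC; apply: (@le_trans _ _ (lam N * (if (N <= k)%N then cmod (cesaro_op t x k) else 0))).
    by rewrite ler_wpM2l ?(ltW (lam_gt0 _))// cmod_truncB.
  case: ifP => Nk; last by rewrite mulr0 mulr_ge0 ?cmod_ge0 ?(ltW (lam_gt0 _)).
  by rewrite ler_wpM2r ?cmod_ge0// lam_le.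
- exact: weighted_coord.
- move=> n; apply: ell1_unit_ball => // k.
  apply: (@le_trans _ _ 1); last by rewrite ler1n.
  rewrite (eq_bigr (fun i : 'I_k => (n == i :> nat)%:R)); last first.
    by move=> i _; rewrite /unit_seq cmod_nat.
  have [nk|kn] := ltnP n k; last by rewrite big1// => i _; rewrite gtn_eqF ?(leq_trans (ltn_ord i)).
  rewrite (bigD1 (Ordinal nk))//= eqxx big1 ?addr0// => i /negPf.
  by rewrite -val_eqE /= eq_sym => ->.
Qed.

Lemma tail_sup_anti x m n : ell_infty x -> (m <= n)%N ->
  cmod (tail_sup x n) <= cmod (tail_sup x m).
Proof.
move=> bx mn; apply: tail_sup_le => // k nk.
by apply: tail_sup_ge => //; exact: leq_trans nk.
Qed.

(* If |a| is nonincreasing, so are its means [geo tau a n / (n+1)]: with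
   s = 1 + tau + ... + tau ^ n one has geo tau a n >= s |a (n+1)| and s >= (n+1) tau ^ (n+1). *)
Lemma geo_mean_anti tau a m n : 0 <= tau < 1 ->
  (forall k, cmod (a k.+1) <= cmod (a k)) -> (m <= n)%N ->
  geo tau a n / n.+1%:R <= geo tau a m / m.+1%:R.
Proof.
move=> /andP[t0 t1] aS; elim: n => [|n IH]; first by rewrite leqn0 => /eqP ->.
rewrite leq_eqVlt => /predU1P[->//|/IH]; apply: le_trans.
have amono i : (i <= n)%N -> cmod (a n) <= cmod (a i).
  elim: n {IH} => [|l IHl]; first by rewrite leqn0 => /eqP ->.
  by rewrite leq_eqVlt => /predU1P[->//|/IHl]; apply: le_trans.
rewrite ler_pdivrMr// mulrAC ler_pdivlMr// geoS.
pose s := \sum_(j < n.+1) tau ^+ (n - j).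
set b := cmod (a n.+1); have b0 : 0 <= b by exact: cmod_ge0.
have Gs : s * b <= geo tau a n.
  rewrite /s mulr_suml; apply: ler_sum => j _; rewrite ler_wpM2l ?exprn_ge0//.
  by apply: le_trans (aS n) _; rewrite amono// -ltnS.
have sE : (1 - tau) * s = 1 - tau ^+ n.+1.
  rewrite /s (reindex_inj rev_ord_inj)/=.
  rewrite (eq_bigr (fun j : 'I_n.+1 => tau ^+ j)); last first.
    by move=> j _; rewrite subSS subKn// -ltnS.
  by rewrite -opprB mulNr -subrX1 opprB.
have sn : n.+1%:R * tau ^+ n.+1 <= s.
  rewrite mulrC mulr_natr -[X in _ *+ X]card_ord -sumr_const; apply: ler_sum => j _.
  by rewrite ler_wiXn2l ?(ltW t1)// leqW// leq_subr.
set y : R := n.+1%:R in sn *; set G := geo tau a n in Gs *.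
have -> : n.+2%:R = y + 1 :> R by rewrite /y natr1.
have y0 : 0 <= y by [].
have d0 : 0 <= 1 + y * (1 - tau) by rewrite addr_ge0// mulr_ge0 ?subr_ge0// ltW.
have h1 : (1 + y * (1 - tau)) * (s * b) <= (1 + y * (1 - tau)) * G by exact: ler_wpM2l.
have h2 : (1 + y * (1 - tau)) * (s * b) = (s + y * (1 - tau ^+ n.+1)) * b.
  by rewrite -sE; ring.
have h3 : y * b <= (s + y * (1 - tau ^+ n.+1)) * b.
  by rewrite ler_wpM2r// mulrBr mulr1; lra.
by lra.
Qed.

(** The bound for v_n remains valid for all later entries, because the means of the decreasing
    sequence [tail_sup u] decrease; hence it also bounds their supremum. *)
Lemma dominated_tail_sup K tau u v : 0 <= tau < 1 -> 0 <= K -> ell_infty u ->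
  dominated K tau u v -> ell_infty v /\ dominated K tau (tail_sup u) (tail_sup v).
Proof.
move=> t01 K0 bu uv; have /andP[t0 t1] := t01.
have huS k : cmod (tail_sup u k.+1) <= cmod (tail_sup u k) by exact: tail_sup_anti.
have vG m : cmod (v m) <= K * (geo tau (tail_sup u) m / m.+1%:R).
  rewrite mulrA ler_pdivlMr// mulrC; apply: le_trans (uv m) _.
  by rewrite ler_wpM2l// geo_mono// => k _; exact: tail_sup_ge.
have bv : ell_infty v.
  exists (K * (geo tau (tail_sup u) 0 / 1%:R)) => n; apply: le_trans (vG n) _.
  by rewrite ler_wpM2l// geo_mean_anti.
split=> // n; rewrite mulrC -ler_pdivlMr//; apply: tail_sup_le => // k nk.
by apply: le_trans (vG k) _; rewrite -mulrA ler_wpM2l// geo_mean_anti.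
Qed.

Lemma d_control t : 0 <= t < 1 ->
  control t [set x | ell_infty x /\ ell 1 (weighted (tail_sup x))]
    (fun x => ell_norm 1 (weighted (tail_sup x)))
    [set b | ell_infty b /\ ell 1 (tail_sup b) /\ ell_norm 1 (tail_sup b) <= 1].
Proof.
move=> t01; have /andP[t0 t1] := t01.
have ball_d f (g : nat -> R) (c : R) : 0 < c ->
    (forall m k, (m <= k)%N -> cmod (f k) <= g m) -> (forall n, \sum_(k < n) g k <= c) ->
    [set b | ell_infty b /\ ell 1 (tail_sup b) /\ ell_norm 1 (tail_sup b) <= 1]
      ((c^-1)%:C *: f).
  move=> c0 fg gc; have ci0 : 0 < c^-1 by rewrite invr_gt0.
  have fcE k : cmod (((c^-1)%:C *: f) k) = c^-1 * cmod (f k).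
    by rewrite omegaZ cmodM cmodR gtr0_norm.
  have bf : ell_infty ((c^-1)%:C *: f).
    by exists (c^-1 * g 0%N) => n; rewrite fcE ler_pM2l// fg.
  split=> //; apply: ell1_bound => n.
  apply: (@le_trans _ _ (\sum_(k < n) c^-1 * g k)).
    apply: ler_sum => k _; apply: tail_sup_le => // m km.
    by rewrite fcE ler_pM2l// fg.
  by rewrite -mulr_sumr ler_pdivrMl// mulr1.
split.
- split.
    move=> x y [bx lx] [by_ ly].
    have [|lz] := @ellD R 1 (weighted (tail_sup x)) (weighted (tail_sup y))
      (weighted (tail_sup (x + y))) (lexx 1) _ lx ly; last by [].
    move=> n; rewrite !cmod_weighted -mulrDr ler_wpM2l ?tail_supD//.
    by rewrite divr_ge0// ltW ?lam_gt0.
  move=> c x [bx lx].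
  apply: (proj2 (@ellZ R 1 c (weighted (tail_sup x)) _ ltr01 _ lx)) => n.
  by rewrite !cmod_weighted tail_supZ// mulrCA.
(* The decreasing majorant of the tail is the constant G N before N and G afterwards. The flat part
   N G N is at most twice the sum of G over [N/2, N), where lam is at least lam (N/2), and costs 2 S
   / lam (N/2); the rest costs S / lam (N/2). *)
- exists (fun n => 3 * (1 - t)^-1 / lam n./2); first exact: lam_half_cvg.
  move=> x N M c [bx lx] NM c0 sc.
  pose h := tail_sup x; pose G k := geo t h k / k.+1%:R.
  have G0 k : 0 <= G k by rewrite divr_ge0 ?geo_ge0.
  have Ganti m n : (m <= n)%N -> G n <= G m.
    by apply: geo_mean_anti => // k; exact: tail_sup_anti.
  have zG k : cmod (cesaro_op t x k) <= G k.
    rewrite ler_pdivlMr// mulrC; apply: le_trans (cesaro_dominated x t0 k) _.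
    by rewrite mul1r geo_mono// => i _; exact: tail_sup_ge.
  pose S := (1 - t)^-1 * ell_norm 1 (weighted h).
  have Gsum n : \sum_(k < n) lam k * G k <= S.
    pose v : omega R := fun k => (G k)%:C.
    have vE k : cmod (v k) = G k by rewrite cmodR ger0_norm.
    have := @dominated_weighted t h v t01 _ lx n.
    under eq_bigr do rewrite vE; apply.
    by move=> k; rewrite vE mul1r mulrC divfK// pnatr_eq0.
  have hN : (N./2 <= N)%N by rewrite -{2}(odd_double_half N) -addnn addnA leq_addl.
  have L0 := @lam_gt0 R N./2.
  have lG0 k : 0 <= lam k * G k by rewrite mulr_ge0 ?(ltW (lam_gt0 _)).
  apply: (ball_d _ (fun n => if (N <= n)%N then G n else G N)) => //.
    move=> m k mk; apply: le_trans (cmod_truncB _ _ NM) _.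
    case: (leqP N k) => Nk; last by case: ifP.
    apply: le_trans (zG k) _; case: ifP => Nm; exact: Ganti.
  move=> n; apply: le_trans sc.
  have -> : 3 * (1 - t)^-1 / lam N./2 * ell_norm 1 (weighted h) = 3 * S / lam N./2.
    by rewrite /S; ring.
  rewrite ler_pdivlMr// mulrC.
  apply: (@le_trans _ _ (lam N./2 * (\sum_(0 <= k < N + n) if (N <= k)%N then G k else G N))).
    rewrite ler_wpM2l ?(ltW L0)// -(big_mkord xpredT (fun k => if (N <= k)%N then G k else G N)).
    rewrite (big_cat_nat (leq0n n) (leq_addl N n))//= lerDl sumr_ge0// => k _.
    by case: ifP.
  rewrite (big_cat_nat (leq0n N) (leq_addr n N))//= mulrDr.
  have -> : 3 * S = 2 * S + S by ring.
  apply: lerD.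
    rewrite big_nat_cond (eq_bigr (fun _ => G N)); last first.
      by move=> k /andP[/andP[_ kN] _]; rewrite leqNgt kN.
    rewrite -big_nat_cond big_const_nat subn0 iter_addr addr0.
    have : \sum_(N./2 <= k < N) lam N./2 * G N <= S.
      apply: le_trans (Gsum N); rewrite -(big_mkord xpredT (fun k => lam k * G k)).
      rewrite (big_cat_nat (leq0n N./2) hN)//= -[leLHS]add0r lerD ?sumr_ge0//.
      rewrite [leLHS]big_nat_cond [leRHS]big_nat_cond ler_sum// => k /andP[/andP[Nk kN] _].
      by rewrite ler_pM ?(ltW L0) ?lam_le ?Ganti// ltnW.
    rewrite big_const_nat iter_addr addr0 => h1.
    apply: le_trans (ler_wpM2l _ h1); last by [].
    have hh : N%:R <= 2 * (N - N./2)%:R :> R by rewrite -natrM ler_nat; lia.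
    rewrite -[_ *+ (N - _)]mulr_natr -[G N *+ N]mulr_natr mulrA [leRHS]mulrCA.
    by apply: ler_wpM2l hh; rewrite mulr_ge0 ?(ltW L0).
  apply: (@le_trans _ _ (\sum_(N <= k < N + n) lam k * G k)).
    rewrite mulr_sumr [leLHS]big_nat_cond [leRHS]big_nat_cond ler_sum// => k /andP[/andP[Nk kN] _].
    by rewrite Nk ler_wpM2r// lam_le// (leq_trans hN).
  apply: le_trans (Gsum (N + n)%N); rewrite -(big_mkord xpredT (fun k => lam k * G k)).
  by rewrite [leRHS](big_cat_nat (leq0n N) (leq_addr n N))//= lerDr sumr_ge0.
- move=> x n [bx lx]; apply: le_trans (weighted_coord n lx).
  exact: tail_sup_ge.
(* The decreasing majorant of e_n consists of n+1 ones; this is where the divisor in [control_unit]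
   comes from. *)
- move=> n; apply: (ball_d _ (fun k => (k <= n)%N%:R)) => //.
    move=> m k mk; rewrite /unit_seq cmod_nat ler_nat.
    by case: eqP => // nk; rewrite nk mk.
  move=> m; rewrite -natr_sum ler_nat.
  rewrite -(big_mkord xpredT (fun k => (k <= n)%N : nat)).
  apply: (@leq_trans (\sum_(0 <= k < m + n.+1) (k <= n)%N)).
    by rewrite (big_cat_nat (leq0n m) (leq_addr _ m))//= leq_addr.
  rewrite (big_cat_nat (leq0n n.+1) (leq_addl m _))//= [X in (_ + X)%N]big_nat_cond.
  rewrite [X in (_ + X)%N]big1 ?addn0.
    apply: (@leq_trans (\sum_(0 <= k < n.+1) 1)); last by rewrite sum_nat_const_nat subn0 muln1.
    by apply: leq_sum => k _; case: (leqP k n).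
  by move=> k /andP[/andP[nk _] _]; rewrite leqNgt nk.
Qed.

End Control.

(** * The Banach spaces l^q, ces(q) and d_q *)

Section Steps.
Context {R : realType}.
Implicit Types (x y u v a b : omega R) (q tau t K : R).

(** The demands on one Banach space E with norm nu. D, s and B0 are shared by all steps of a
    projective or inductive limit, so that a single tail estimate serves the whole limit. *)
Record step (D : set (omega R)) (s : omega R -> R) (B0 E : set (omega R))
    (nu : omega R -> R) : Prop := {
  step_dom : forall tau K, 0 <= tau < 1 -> 0 <= K -> exists2 C, 0 <= C &
    forall u v, E u -> dominated K tau u v -> E v /\ nu v <= C * nu u ;
  step_trunc : forall x, E x -> nu (x - trunc N x) @[N --> \oo] --> 0 ;
  step_ball : exists C, forall b, B0 b -> E b /\ nu b <= C ;
  step_control : exists2 C, 0 <= C & forall x, E x -> D x /\ s x <= C * nu x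
}.

Lemma cmod_subtrunc x N n :
  cmod ((x - trunc N x) n) = if (n < N)%N then 0 else cmod (x n).
Proof. by rewrite omegaB /trunc; case: ifP; rewrite ?subrr ?cmod0 ?subr0. Qed.

Lemma cmod_subtrunc_le x N n : cmod ((x - trunc N x) n) <= cmod (x n).
Proof. by rewrite cmod_subtrunc; case: ifP => //; rewrite cmod_ge0. Qed.

Lemma near_subtrunc x n : \forall N \near \oo, cmod ((x - trunc N x) n) = 0.
Proof.
near=> N; rewrite cmod_subtrunc; have -> // : (n < N)%N.
by near: N; exact: nbhs_infty_gt.
Unshelve. all: by end_near.
Qed.

Lemma ell_trunc q x : 0 < q -> ell q x ->
  ell_norm q (x - trunc N x) @[N --> \oo] --> 0.
Proof.
move=> q0 lx; apply: (ell_dominated_cvg q0 lx); first exact: cmod_subtrunc_le.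
move=> n; apply: (@cvg_near_cst _ R^o) => //; exact: near_subtrunc.
Qed.

Lemma ell_cvg0 q x : 0 < q -> ell q x -> cmod (x n) @[n --> \oo] --> 0.
Proof.
move=> q0 lx; apply: (squeeze_cvgr _ (cvg_cst 0) (ell_trunc q0 lx)).
apply: nearW => n; rewrite cmod_ge0 /=.
have -> : cmod (x n) = cmod ((x - trunc n x) n) by rewrite cmod_subtrunc ltnn.
apply: ell_coord => //.
have := @le_ell_norm _ q (x - trunc n x) x 1 q0 ler01.
by move=> /(_ _ lx)[]// k; rewrite mul1r cmod_subtrunc_le.
Qed.

Lemma ell1_ell q x : 1 <= q -> ell 1 x -> ell_norm 1 x <= 1 ->
  ell q x /\ ell_norm q x <= 1.
Proof.
move=> q1 lx x1; have q0 : 0 < q by apply: lt_le_trans q1.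
apply: ell_bound => // n; rewrite powR1.
apply: le_trans (le_trans (ell1_partial n lx) x1); apply: ler_sum => k _.
have xk := le_trans (ell_coord k ltr01 lx) x1.
have [->|x0] := eqVneq (cmod (x k)) 0; first by rewrite powR0 ?gt_eqF.
have {}x0 : 0 < cmod (x k) by rewrite lt_neqAle eq_sym x0 cmod_ge0.
by rewrite -[leRHS]powRr1 ?(ltW x0)//; apply: ger_powR => //; rewrite x0.
Qed.

Lemma ell_step q : 1 <= q ->
  step [set x | ell 1 (weighted x)] (fun x => ell_norm 1 (weighted x))
    [set b | ell 1 b /\ ell_norm 1 b <= 1] (ell q) (ell_norm q).
Proof.
move=> q1; have q0 : 0 < q by apply: lt_le_trans q1.
split.
- move=> tau K t01 K0; have /andP[t0 t1] := t01.
  exists (K / (1 - tau)); first by rewrite divr_ge0// subr_ge0 ltW.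
  move=> u v lu uv; apply: geo_ell => //.
  by move=> n; exact: dominated_le.
- by move=> x; exact: ell_trunc.
- by exists 1 => b [lb b1]; exact: ell1_ell.
- exact: weighted_ell.
Qed.

(** [geoS] summed. Without its last term it bounds partial sums of the convolution by those of |u|,
    so domination passes to the means entry by entry. *)
Lemma sum_geo tau u n : \sum_(k < n.+1) cmod (u k) =
  (1 - tau) * \sum_(k < n.+1) geo tau u k + tau * geo tau u n.
Proof.
elim: n => [|n IH]; first by rewrite !big_ord1 geo0; ring.
rewrite big_ord_recr /= IH [in RHS]big_ord_recr /= geoS; ring.
Qed.

Lemma dominated_ces K tau u v n : 0 <= tau < 1 -> 0 <= K -> dominated K tau u v ->
  cmod (cesaro_op 1 (abs_seq v) n) <= K / (1 - tau) * cmod (cesaro_op 1 (abs_seq u) n).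
Proof.
move=> /andP[t0 t1] K0 uv; have s0 : 0 < 1 - tau by rewrite subr_gt0.
rewrite !ces1E mulrA ler_wpM2r ?invr_ge0// mulrAC ler_pdivlMr//.
apply: (@le_trans _ _ (K * ((1 - tau) * \sum_(i < n.+1) geo tau u i))).
  rewrite mulrC mulrCA ler_wpM2l ?(ltW s0)// mulr_sumr; apply: ler_sum => i _.
  exact: dominated_le.
by rewrite ler_wpM2l// (sum_geo tau) lerDl mulr_ge0// geo_ge0.
Qed.

Lemma ces_step q : 1 < q ->
  step [set x | ell 1 (weighted x)] (fun x => ell_norm 1 (weighted x))
    [set b | ell 1 b /\ ell_norm 1 b <= 1] (ces q) (ces_norm q).
Proof.
move=> q1; have q0 : 0 < q by apply: lt_trans q1.
split.
- move=> tau K t01 K0; have /andP[t0 t1] := t01.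
  exists (K / (1 - tau)); first by rewrite divr_ge0// subr_ge0 ltW.
  move=> u v lu uv; apply: le_ell_norm => //; first by rewrite divr_ge0// subr_ge0 ltW.
  by move=> n; exact: dominated_ces.
- move=> x lx; apply: (ell_dominated_cvg q0 lx).
    move=> N n; rewrite !ces1E ler_wpM2r ?invr_ge0//.
    by apply: ler_sum => i _; exact: cmod_subtrunc_le.
  move=> n; apply: (@cvg_near_cst _ R^o) => //.
  near=> N; rewrite ces1E big1 ?mul0r// => i _.
  rewrite cmod_subtrunc (leq_trans (ltn_ord i))//.
  by near: N; exact: nbhs_infty_gt.
(* The means of a sequence in the l^1 ball are at most 1/(n+1), and r lies in l^q because q > 1. *)
- pose r : omega R := fun n => (n.+1%:R^-1)%:C.
  have rE n : cmod (r n) = n.+1%:R^-1 by rewrite cmodR ger0_norm ?invr_ge0.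
  have lr : ell q r.
    apply/ellE => //; have := @cvg_riemann R q 1 q1 ler01.
    apply: le_lt_trans; apply: lee_nneseries => k _; first by rewrite lee_fin powR_ge0.
    by rewrite lee_fin rE mul1r -[in leLHS]powR_inv1// -powRrM mulN1r.
  exists (ell_norm q r) => b [lb b1].
  have [|//|lcb] := @le_ell_norm _ q (cesaro_op 1 (abs_seq b)) r 1 q0 ler01.
    move=> n; rewrite mul1r rE ces1E ler_piMl ?invr_ge0//.
    exact: le_trans (ell1_partial _ lb) b1.
  by rewrite mul1r.
- have [C C0 wC] := weighted_ell (ltW q1).
  exists (4 * C); first by rewrite mulr_ge0.
  move=> x lx; have [lw nw] := wC _ lx; have [lx1 nx] := weighted_ces lw.
  by split=> //; apply: le_trans nx _; rewrite -mulrA ler_wpM2l.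
Unshelve. all: by end_near.
Qed.

Lemma d_step q : 1 <= q ->
  step [set x | ell_infty x /\ ell 1 (weighted (tail_sup x))]
    (fun x => ell_norm 1 (weighted (tail_sup x)))
    [set b | ell_infty b /\ ell 1 (tail_sup b) /\ ell_norm 1 (tail_sup b) <= 1]
    (dsp q) (dsp_norm q).
Proof.
move=> q1; have q0 : 0 < q by apply: lt_le_trans q1.
split.
- move=> tau K t01 K0; have /andP[t0 t1] := t01.
  exists (K / (1 - tau)); first by rewrite divr_ge0// subr_ge0 ltW.
  move=> u v [bu lu] uv; have [bv vu] := dominated_tail_sup t01 K0 bu uv.
  have [|lv nv] := geo_ell (v := tail_sup v) q1 t01 K0 _ lu; last by [].
  by move=> n; exact: dominated_le.
- move=> x [bx lx].
  have bxN N : ell_infty (x - trunc N x).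
    by case: bx => M xM; exists M => n; apply: le_trans (cmod_subtrunc_le _ _ _) _.
  apply: (ell_dominated_cvg q0 lx).
    move=> N n; apply: tail_sup_le => // k nk.
    by apply: le_trans (cmod_subtrunc_le _ _ _) _; exact: tail_sup_ge.
  (* Whatever n is, the supremum for the truncated sequence is at most [tail_sup x N], which tends
     to 0 as a sequence in l^q. *)
  move=> n; apply: (squeeze_cvgr _ (cvg_cst 0) (ell_cvg0 q0 lx)).
  apply: nearW => N; rewrite cmod_ge0 /=; apply: tail_sup_le => // k _.
  rewrite cmod_subtrunc; case: (leqP N k) => Nk; last exact: cmod_ge0.
  exact: tail_sup_ge.
- exists 1 => b [bb [lb b1]]; have [lq nq] := ell1_ell q1 lb b1.
  by split.
- have [C C0 wC] := weighted_ell q1; exists C => // x [bx lx].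
  by have [lw nw] := wC _ lx.
Qed.

End Steps.

(** * Passage to the projective and inductive limits *)

Section Tame.
Context {R : realType}.
Implicit Types (X : lcseq R) (x y u v b : omega R) (p q s : omega R -> R) (tau t K C : R).

(* What the proof needs to know about X. Solidity (tame_dom) gives C_t and its resolvents
   on X, and tame_compact the compactness of the dual operator. *)
Record tame t X : Prop := {
  tame_dom : forall tau K p, 0 <= tau < 1 -> 0 <= K -> seminorms X p ->
    exists p' C, [/\ seminorms X p', 0 <= C & forall u v, carrier X u ->
      dominated K tau u v -> carrier X v /\ p v <= C * p' u] ;
  tame_trunc : forall p x, seminorms X p -> carrier X x ->
    p (x - trunc N x) @[N --> \oo] --> 0 ;
  tame_compact : exists p (eps : nat -> R) K (B0 : set (omega R)),
    [/\ seminorms X p, eps n @[n --> \oo] --> 0, 0 <= K,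
      (forall x n, carrier X x -> cmod (x n) <= K * n.+1%:R * p x) &
      [/\ forall p', seminorms X p' -> exists C, forall b, B0 b -> carrier X b /\ p' b <= C,
        forall n, B0 (((n.+1%:R : R)^-1)%:C *: unit_seq n) &
        forall x N M c, carrier X x -> (N <= M)%N -> 0 < c -> eps N * p x <= c ->
          B0 ((c^-1)%:C *: (trunc M (cesaro_op t x) - trunc N (cesaro_op t x)))]]
}.

Definition elt_of X x (cx : carrier X x) : elt X := Elt (mem_set cx).

Lemma seminorm_on0 (A : set (omega R)) p : A 0 -> seminorm_on A p -> p 0 = 0.
Proof. by move=> A0 [_ pZ]; rewrite -(scale0r 0) pZ// cmod0 mul0r. Qed.

Lemma seminorm_on_ge0 (A : set (omega R)) p x : linear_subspace A -> seminorm_on A p ->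
  A x -> 0 <= p x.
Proof.
move=> [A0 _ AZ] [pD pZ] Ax.
have := pD x (- x) Ax; rewrite subrr (seminorm_on0 A0)// -scaleN1r.
rewrite pZ// cmodN (cmodR 1) normr1 mul1r => /(_ (AZ _ _ Ax)).
by rewrite -mulr2n pmulrn_lge0.
Qed.

Lemma seminorm_on_continuous X p q C : seminorm_on (carrier X) p -> seminorms X q ->
  0 <= C -> (forall x, carrier X x -> p x <= C * q x) ->
  continuous (fun x : elt X => p x).
Proof.
move=> sp Xq C0 pq x; have [pD pZ] := sp; have FF : Filter (nbhs x) by exact: nbhs_filter.
have cX (z : elt X) : carrier X z by apply: set_mem; exact: seq_ofP.
have p_le (y z : elt X) : p y - p z <= C * q (y - z).
  apply: le_trans (pq _ (cX (y - z))); rewrite lerBlDr.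
  have -> : seq_of y = seq_of (y - z) + seq_of z by rewrite -[LHS](subrK (seq_of z)).
  by apply: pD; exact: cX.
apply/(@cvgrPdist_lt _ _ _ (nbhs x) FF) => e e0.
have C1 : 0 < C + 1 by rewrite ltr_wpDl.
exists (seminorm_ball (fun _ : 'I_1 => q) (e / (C + 1))).
  by exists 1%N, (fun _ => q), (e / (C + 1)); split => //; rewrite divr_gt0.
move=> y /(_ ord0) qyx.
have {qyx} h : C * q (y - x) < e.
  apply: (@le_lt_trans _ _ ((C + 1) * q (y - x))); last by rewrite mulrC -ltr_pdivlMr.
  by rewrite ler_wpM2r ?lerDl//; exact: seminorm_ge0.
apply: le_lt_trans h; rewrite ler_norml; apply/andP; split; last first.
  have -> : q (y - x) = q (x - y).
    rewrite -opprB -scaleN1r seminormZ//.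
    by rewrite -(rmorph1 (real_complex R)) -rmorphN cmodR normrN1 mul1r.
  exact: p_le.
by rewrite lerNl opprB; exact: p_le.
Qed.

Lemma continuous_seminorm_bound X p q : seminorms X = [set q] ->
  seminorm_on (carrier X) p -> continuous (fun x : elt X => p x) ->
  exists2 C, 0 <= C & forall x, carrier X x -> p x <= C * q x.
Proof.
move=> Xq sp cp; have [pD pZ] := sp; have Xq1 : seminorms X q by rewrite Xq.
have FF : Filter (nbhs (0 : elt X)) by exact: nbhs_filter.
have p0 : p (0 : elt X) = 0.
  by apply: (seminorm_on0 _ sp); case: (carrier_subspace X).
have : nbhs (0 : elt X) [set z : elt X | p z < 1].
  apply: (cvgr_lt _ (cp (0 : elt X))); rewrite p0; exact: ltr01.
move=> [W [n [r [e [Xr e0 ->]]]] Wp].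
have rE i : r i = q by have := Xr i; rewrite Xq.
have small x : carrier X x -> q x < e -> p x < 1.
  move=> cx qe; apply: (Wp (elt_of cx)) => i.
  by rewrite rE subr0.
exists (2 / e); first by rewrite divr_ge0 ?ltW.
move=> x cx; have cZ (c : R[i]) : carrier X (c *: x) by case: (carrier_subspace X) => _ _; apply.
have q0 : 0 <= q x by exact: (seminorm_ge0 (elt_of cx)).
have qZ (c : R[i]) : q (c *: x) = cmod c * q x by exact: (seminormZ c (elt_of cx) Xq1).
(* If q x = 0, all multiples of x lie in the ball, which forces p x = 0; otherwise x is scaled to
   q-value e / 2, whence the constant 2 / e. *)
have [qx|qx] := eqVneq (q x) 0.
  rewrite qx mulr0 leNgt; apply/negP => px.
  have := @small (((p x)^-1)%:C *: x) (cZ _).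
  rewrite qZ qx mulr0 => /(_ e0); rewrite pZ// cmodR ger0_norm ?invr_ge0 ?ltW//.
  by rewrite mulVf ?gt_eqF// ltxx.
have {}qx : 0 < q x by rewrite lt_neqAle eq_sym qx.
have c0 : 0 < e / 2 / q x by rewrite !divr_gt0.
have := @small ((e / 2 / q x)%:C *: x) (cZ _).
rewrite qZ pZ// cmodR (gtr0_norm c0) divfK ?gt_eqF//.
have e2 : e / 2 < e by rewrite ltr_pdivrMr// ltr_pMr// ltr1n.
move=> /(_ e2)/ltW; rewrite -ler_pdivlMl// mulr1 => /le_trans; apply.
by rewrite invf_div [leLHS]mulrC invf_div.
Qed.

(** A single Banach space is the case where I is [unit]. The tail estimate is read off from one step
    i0, the boundedness of B0 from all of them. *)
Lemma tame_proj (I : Type) (i0 : I) t X D s B0 (E : I -> set (omega R))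
    (nu : I -> omega R -> R) :
  (forall x, carrier X x <-> forall i, E i x) ->
  (forall p, seminorms X p <-> exists i, p = nu i) ->
  control t D s B0 -> (forall i, step D s B0 (E i) (nu i)) -> tame t X.
Proof.
move=> XE Xnu [sD [eps eps0 sT] sC sU] stepE; split.
- move=> tau K p t01 K0 /Xnu[i ->]; have [C C0 CP] := step_dom (stepE i) t01 K0.
  exists (nu i), C; split=> //; first by apply/Xnu; exists i.
  move=> u v /XE cu uv; split; last by have [] := CP _ _ (cu i) uv.
  apply/XE => j; have [D' _ DP] := step_dom (stepE j) t01 K0.
  by have [] := DP _ _ (cu j) uv.
- by move=> p x /Xnu[i ->] /XE cx; apply: (step_trunc (stepE i)).
have [C C0 CP] := step_control (stepE i0).
exists (nu i0), (fun n => `|eps n| * C), C, B0; split=> //.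
- by apply/Xnu; exists i0.
- by rewrite -(mul0r C) -(normr0 R); apply: cvgMl; exact: cvg_norm.
- move=> x n /XE /(_ i0) /CP[Dx sx]; apply: le_trans (sC x n Dx) _.
  by rewrite mulrAC [leRHS]mulrC ler_wpM2l.
split=> //.
- move=> p /Xnu[i ->]; have [M MP] := step_ball (stepE i).
  exists M => b B0b; split; last by have [] := MP _ B0b.
  by apply/XE => j; have [M' MP'] := step_ball (stepE j); have [] := MP' _ B0b.
- move=> x N M c /XE /(_ i0) /CP[Dx sx] NM c0 ec; apply: sT => //.
  apply: le_trans ec; rewrite -mulrA.
  apply: (@le_trans _ _ (`|eps N| * s x)); last by rewrite ler_wpM2l.
  have s0 : 0 <= s x by have := le_trans (cmod_ge0 _) (sC x 0%N Dx); rewrite mul1r.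
  by rewrite ler_wpM2r// ler_norm.
Qed.

Lemma carrier_trunc X x N : carrier X (trunc N x).
Proof.
have [c0 cD cZ] := carrier_subspace X; rewrite trunc_sum.
elim: N => [|N IH]; first by rewrite big_ord0.
rewrite big_ord_recr /=; apply: cD; first exact: IH.
by apply: cZ; exact: carrier_unit.
Qed.

Lemma seminorm_on_sub (A B : set (omega R)) p : A `<=` B -> seminorm_on B p ->
  seminorm_on A p.
Proof.
move=> AB [pD pZ]; split; first by move=> x y /AB Bx /AB By; exact: pD.
by move=> a x /AB; exact: pZ.
Qed.

Lemma dominatedZ (c : R[i]) K tau u v : c != 0 -> dominated K tau (c *: u) v ->
  dominated K tau u (c^-1 *: v).
Proof.
move=> c0 uv n; have uvn := uv n; rewrite geoZ in uvn; rewrite omegaZ cmodM cmodV.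
have {}c0 : 0 < cmod c by rewrite lt_neqAle eq_sym cmod_eq0 c0 cmod_ge0.
by rewrite mulrCA ler_pdivrMl// [leRHS]mulrCA.
Qed.

(* On an inductive limit the supremum of [p v] over all v dominated by u is again
   a continuous seminorm of u; subadditivity is the Riesz decomposition property. *)
Lemma tame_ind t D s B0 (E : nat -> lcseq R) (nu : nat -> omega R -> R)
    (mono : forall k, carrier (E k) `<=` carrier (E k.+1)) :
  (forall k, seminorms (E k) = [set nu k]) ->
  control t D s B0 -> (forall k, step D s B0 (carrier (E k)) (nu k)) ->
  tame t (ind_lim mono).
Proof.
move=> Enu [sD [eps eps0 sT] sC sU] stepE.
have subD : carrier (ind_lim mono) `<=` D.
  by move=> x [k _ cx]; have [C _ CP] := step_control (stepE k); have [] := CP _ cx.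
have Enu1 k : seminorms (E k) (nu k) by rewrite Enu.
split.
- move=> tau K p t01 K0 [sp cp]; have /andP[t0 t1] := t01.
  have p_le k : exists2 C, 0 <= C & forall x, carrier (E k) x -> p x <= C * nu k x.
    apply: continuous_seminorm_bound (Enu k) _ (cp k).
    by apply: seminorm_on_sub sp => x cx; exists k.
  have [pD pZ] := sp.
  have dom_le k : exists2 C, 0 <= C & forall u v, carrier (E k) u -> dominated K tau u v ->
      carrier (E k) v /\ p v <= C * nu k u.
    have [C C0 CP] := step_dom (stepE k) t01 K0; have [M M0 MP] := p_le k.
    exists (M * C); first by rewrite mulr_ge0.
    move=> u v cu uv; have [cv nv] := CP _ _ cu uv; split=> //.
    by apply: le_trans (MP _ cv) _; rewrite -mulrA ler_wpM2l.
  pose S u := [set p v | v in [set v | dominated K tau u v]].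
  have dom0 u : dominated K tau u 0.
    by move=> n; rewrite [cmod _]cmod0 mulr0 mulr_ge0// geo_ge0.
  have S_sup u : carrier (ind_lim mono) u -> has_sup (S u).
    move=> [k _ cu]; split; first by exists (p 0); exists 0 => //; exact: dom0.
    have [C _ CP] := dom_le k; exists (C * nu k u) => _ [v uv <-].
    by have [] := CP _ _ cu uv.
  have dom_mem u v : carrier (ind_lim mono) u -> dominated K tau u v ->
      carrier (ind_lim mono) v.
    move=> [k _ cu] uv; have [C _ CP] := dom_le k.
    by exists k => //; have [] := CP _ _ cu uv.
  have S_ub u v : carrier (ind_lim mono) u -> dominated K tau u v -> p v <= sup (S u).
    by move=> cu uv; apply: ub_le_sup; [exact: (proj2 (S_sup _ cu))|exists v].
  have [i0 iD iZ] := carrier_subspace (ind_lim mono).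
  have SD : seminorm_on (carrier (ind_lim mono)) (fun u => sup (S u)).
    split.
      move=> u1 u2 c1 c2; apply: ge_sup; first exact: (proj1 (S_sup _ (iD _ _ c1 c2))).
      move=> _ [v uv <-].
      pose g1 n := geo tau u1 n; pose g2 n := geo tau u2 n.
      have g10 n : 0 <= g1 n by exact: geo_ge0.
      have g20 n : 0 <= g2 n by exact: geo_ge0.
      (* v is split in the ratio of the two convolutions. Where both vanish the quotient is 0 by
         convention, and v n = 0 there as well. *)
      pose c n := g1 n / (g1 n + g2 n).
      pose v1 : omega R := fun n => (c n)%:C * v n.
      have c01 n : 0 <= c n <= 1.
        rewrite /c divr_ge0 ?addr_ge0//=.
        have [->|h] := eqVneq (g1 n + g2 n) 0; first by rewrite invr0 mulr0.
        by rewrite ler_pdivrMr ?mul1r ?lerDl// lt_neqAle eq_sym h addr_ge0.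
      have cg n : (c n * (g1 n + g2 n) <= g1 n) /\ ((1 - c n) * (g1 n + g2 n) <= g2 n).
        rewrite /c; have [h|h] := eqVneq (g1 n + g2 n) 0; first by rewrite h !mulr0.
        by rewrite divfK// mulrBl divfK// mul1r addrAC subrr add0r.
      have uv' n : n.+1%:R * cmod (v n) <= K * (g1 n + g2 n).
        by apply: le_trans (uv n) _; rewrite ler_wpM2l// geoD.
      have d1 : dominated K tau u1 v1.
        move=> n; have /andP[c0 c1'] := c01 n.
        rewrite cmodM cmodR ger0_norm// mulrCA.
        apply: le_trans (ler_wpM2l c0 (uv' n)) _.
        by rewrite mulrCA ler_wpM2l//; case: (cg n).
      have d2 : dominated K tau u2 (v - v1).
        move=> n; have /andP[c0 c1'] := c01 n.
        have c2' : 0 <= 1 - c n by rewrite subr_ge0.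
        have -> : (v - v1) n = (1 - c n)%:C * v n.
          by rewrite omegaB /v1 rmorphB /= mulrBl mul1r.
        rewrite cmodM cmodR ger0_norm// mulrCA.
        apply: le_trans (ler_wpM2l c2' (uv' n)) _.
        by rewrite mulrCA ler_wpM2l//; case: (cg n).
      rewrite -(subrK v1 v) addrC; apply: le_trans (pD _ _ (dom_mem _ _ c1 d1) (dom_mem _ _ c2 d2)) _.
      by rewrite lerD// S_ub.
    have SZ_le (a : R[i]) u : carrier (ind_lim mono) u -> a != 0 ->
        sup (S (a *: u)) <= cmod a * sup (S u).
      move=> cu a0; apply: ge_sup; first exact: (proj1 (S_sup _ (iZ a _ cu))).
      move=> _ [v uv <-]; have uv1 := dominatedZ a0 uv.
      have -> : v = a *: (a^-1 *: v) by rewrite scalerA mulfV// scale1r.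
      rewrite pZ; last exact: dom_mem uv1.
      by rewrite ler_wpM2l ?cmod_ge0// S_ub.
    move=> a u cu; have [->|a0] := eqVneq a 0.
      rewrite cmod0 mul0r scale0r; apply/le_anti/andP; split; last first.
        by rewrite -(seminorm_on0 i0 sp) S_ub.
      apply: ge_sup; first exact: (proj1 (S_sup _ i0)).
      move=> _ [v v0 <-]; suff -> : v = 0 by rewrite (seminorm_on0 i0 sp).
      apply/funext => n; apply/eqP; rewrite -cmod_eq0 -[_ == 0]/(_ == 0).
      have := v0 n; rewrite [geo _ _ _]big1 ?mulr0; last first.
        by move=> i _; rewrite [cmod _]cmod0 mulr0.
      by rewrite pmulr_rle0// => h; apply/eqP/le_anti; rewrite h cmod_ge0.
    (* The reverse inequality is [SZ_le] for a^-1 applied to a u. *)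
    apply/le_anti; rewrite SZ_le//=.
    rewrite mulrC -ler_pdivlMr; last by rewrite lt_neqAle eq_sym cmod_eq0 a0 cmod_ge0.
    rewrite mulrC -cmodV -[u in leLHS](scalerK a0).
    by apply: SZ_le; rewrite ?invr_eq0//; exact: iZ.
  exists (fun u => sup (S u)), 1; split=> //; last first.
    by move=> u v cu uv; rewrite mul1r S_ub//; split=> //; exact: dom_mem uv.
  split=> // k; have [C C0 CP] := dom_le k.
  apply: (@seminorm_on_continuous (E k) (fun u => sup (S u)) (nu k) C) => //.
    by apply: seminorm_on_sub SD => x cx; exists k.
  move=> x cx; apply: ge_sup; first by apply: (proj1 (S_sup _ _)); exists k.
  by move=> _ [v uv <-]; have [] := CP _ _ cx uv.
- move=> p x [sp cp] [k _ cx].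
  have [C C0 CP] : exists2 C, 0 <= C & forall x, carrier (E k) x -> p x <= C * nu k x.
    apply: continuous_seminorm_bound (Enu k) _ (cp k).
    by apply: seminorm_on_sub sp => y cy; exists k.
  have cT N : carrier (E k) (x - trunc N x).
    have [c0 cD cZ] := carrier_subspace (E k).
    by apply: cD => //; rewrite -scaleN1r; apply: cZ; exact: carrier_trunc.
  apply: (squeeze_cvgr (f := fun=> 0) (h := fun N => C * nu k (x - trunc N x))).
  + apply: nearW => N; rewrite CP// andbT.
    apply: (seminorm_on_ge0 _ sp); first exact: (carrier_subspace (ind_lim mono)).
    by exists k.
  + exact: cvg_cst.
  + by rewrite -(mulr0 C); apply: cvgMr; exact: (step_trunc (stepE k)).
(* On each step s is at most a multiple of the norm, so s is itself one of the seminorms of the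
   limit and can serve as p in [tame_compact]. *)
have Es : seminorms (ind_lim mono) s.
  split; first exact: seminorm_on_sub sD.
  move=> k; have [C C0 CP] := step_control (stepE k).
  apply: (@seminorm_on_continuous (E k) s (nu k) C) => //.
    by apply: seminorm_on_sub sD => x cx; apply: subD; exists k.
  by move=> x /CP[].
exists s, eps, 1, B0; split=> //; first by move=> x n /subD/sC; rewrite mul1r.
split=> //; last by move=> x N M c /subD; exact: sT.
move=> p [sp cp]; have [M MP] := step_ball (stepE 0%N).
have [C C0 CP] : exists2 C, 0 <= C & forall x, carrier (E 0) x -> p x <= C * nu 0%N x.
  apply: continuous_seminorm_bound (Enu 0%N) _ (cp 0%N).
  by apply: seminorm_on_sub sp => y cy; exists 0%N.
exists (C * M) => b /MP[cb nb]; split; first by exists 0%N.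
by apply: le_trans (CP _ cb) _; rewrite ler_wpM2l.
Qed.

Lemma tame_listed t X : 0 <= t < 1 -> listed_space X -> tame t X.
Proof.
move=> t01 [p p1|p p1|p p1|F p p1 pk pkp|F p p1 pk pkp].
- apply: (@tame_proj unit tt t _ _ _ _ (fun=> dsp p) (fun=> dsp_norm p)) (d_control t01) _.
  + by move=> x; split=> // /(_ tt).
  + by move=> r; split=> [->|[_ ->]//]; exists tt.
  + by move=> _; exact: d_step.
- apply: (@tame_proj unit tt t _ _ _ _ (fun=> ell p) (fun=> ell_norm p)) (ell_control t01) _.
  + by move=> x; split=> // /(_ tt).
  + by move=> r; split=> [->|[_ ->]//]; exists tt.
  + by move=> _; exact: ell_step.
- apply: (@tame_proj unit tt t _ _ _ _ (fun=> ces p) (fun=> ces_norm p)) (ell_control t01) _.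
  + by move=> x; split=> // /(_ tt).
  + by move=> r; split=> [->|[_ ->]//]; exists tt.
  + by move=> _; exact: ces_step.
- have pk1 := decreasing_gt1 p1 pkp.
  have carE G x : carrier (plus_space G p1 pkp) x <->
      forall k, carrier (banach_space G (decreasing_gt1 p1 pkp k)) x.
    by split=> [cx k|cx]; [exact: (cx k I)|exact: (fun k _ => cx k)].
  case: F carE => carE.
  + apply: (@tame_proj nat 0%N t _ _ _ _ (fun k => ell (pk k)) (fun k => ell_norm (pk k)))
      (ell_control t01) _.
    * exact: (carE FamEll).
    * by move=> r; split=> [[k _ ->]|[k ->]]; exists k.
    * by move=> k; apply: ell_step; exact: ltW.
  + apply: (@tame_proj nat 0%N t _ _ _ _ (fun k => ces (pk k)) (fun k => ces_norm (pk k)))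
      (ell_control t01) _.
    * exact: (carE FamCes).
    * by move=> r; split=> [[k _ ->]|[k ->]]; exists k.
    * by move=> k; exact: ces_step.
  + apply: (@tame_proj nat 0%N t _ _ _ _ (fun k => dsp (pk k)) (fun k => dsp_norm (pk k)))
      (d_control t01) _.
    * exact: (carE FamD).
    * by move=> r; split=> [[k _ ->]|[k ->]]; exists k.
    * by move=> k; apply: d_step; exact: ltW.
have pk1 := increasing_gt1 pkp.
case: F.
- apply: (@tame_ind t _ _ _ _ (fun k => ell_norm (pk k)) _ _ (ell_control t01)) => // k.
  by apply: ell_step; exact: ltW.
- apply: (@tame_ind t _ _ _ _ (fun k => ces_norm (pk k)) _ _ (ell_control t01)) => // k.
  exact: ces_step.
- apply: (@tame_ind t _ _ _ _ (fun k => dsp_norm (pk k)) _ _ (d_control t01)) => // k.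
  by apply: d_step; exact: ltW.
Qed.

End Tame.

(** * Strong duals and transposed operators *)

Section Dual.
Context {K : numFieldType} {X : tvsType K}.
Implicit Types (y f g : strong_dual X) (B : set X) (S T : lin_op X).

Definition mk_dual (f : X -> K^o) (lf : linear f) (cf : continuous f) : strong_dual X :=
  @StrongDual K X f (mem_set (conj lf cf)).

Lemma dual_linear y a x z : y (a *: x + z) = a * y x + y z.
Proof. by have [ly _] := set_mem (dual_funP y); exact: ly. Qed.

Lemma dual_continuous y : continuous (y : X -> K^o).
Proof. by have [_ cy] := set_mem (dual_funP y); exact: cy. Qed.

Lemma dual0 y : y 0 = 0.
Proof. by have := dual_linear y (-1) 0 0; rewrite scaler0 addr0 mulN1r addNr. Qed.

Lemma dualZ y a x : y (a *: x) = a * y x.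
Proof. by have := dual_linear y a x 0; rewrite !addr0 dual0 addr0. Qed.

Lemma dualD y x z : y (x + z) = y x + y z.
Proof. by have := dual_linear y 1 x z; rewrite scale1r mul1r. Qed.

Lemma dualB y x z : y (x - z) = y x - y z.
Proof. by rewrite dualD -scaleN1r dualZ mulN1r. Qed.

Lemma dual_ext f g : (forall x, f x = g x) -> f = g.
Proof. by move=> fg; apply: val_inj; apply/funext. Qed.

Lemma dual_addE f g x : (f + g) x = f x + g x. Proof. by []. Qed.

Lemma dual_subE f g x : (f - g) x = f x - g x. Proof. by []. Qed.

Lemma dual_scaleE a f x : (a *: f) x = a * f x. Proof. by []. Qed.

Lemma dual_zeroE x : (0 : strong_dual X) x = 0. Proof. by []. Qed.

Lemma dual_nbhsP f (U : set (strong_dual X)) :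
  nbhs f U <-> exists B e, [/\ tvs_bounded B, 0 < e & forall g, dual_ball B e (g - f) -> U g].
Proof.
split; last first.
  move=> [B [e [bB e0 BU]]].
  have e20 : 0 < e / 2 by rewrite divr_gt0.
  have entE : entourage [set uv : K^o * K^o | ball uv.1 (e / 2) uv.2].
    exact: entourage_ball (PosNum e20).
  have : nbhs f [set g : strong_dual X | forall x, B x -> ball (f x) (e / 2) (g x)].
    exact: (@initial_continuous _ _
      (@dual_fun K X : strong_dual X -> {family @tvs_bounded K X, X -> K^o})
      f _ (@fam_nbhs X K^o _ B _ (f : {family @tvs_bounded K X, X -> K^o}) entE bB)).
  apply: filterS => g /= gf.
  apply: BU; exists (e / 2); first by rewrite ltW//= ltr_pdivrMr// ltr_pMr// ltr1n.
  by move=> x /gf /=; rewrite -ball_normE /= distrC => /ltW.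
move=> fU.
pose G : set_system (strong_dual X) :=
  [set U | exists B e, [/\ tvs_bounded B, 0 < e & forall g, dual_ball B e (g - f) -> U g]].
have FG : Filter G.
  split.
  - by exists set0, 1; split=> //; exact: tvs_bounded0.
  - move=> V W [B [e [bB e0 BV]]] [C [d [bC d0 CW]]].
    exists (B `|` C), (e * d / (e + d)); split.
    + exact: tvs_boundedU.
    + by rewrite divr_gt0 ?mulr_gt0 ?addr_gt0.
    have ede : e * d / (e + d) <= e.
      by rewrite ler_pdivrMr ?addr_gt0// ler_pM2l// lerDr ltW.
    have edd : e * d / (e + d) <= d.
      by rewrite ler_pdivrMr ?addr_gt0// mulrC ler_pM2l// lerDl ltW.
    move=> g [c /andP[c0 ce] gc]; split.
      apply: BV; exists c; first by rewrite c0 (lt_le_trans ce).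
      by move=> x Bx; apply: gc; left.
    apply: CW; exists c; first by rewrite c0 (lt_le_trans ce).
    by move=> x Cx; apply: gc; right.
  - by move=> V W VW [B [e [bB e0 BV]]]; exists B, e; split=> // g /BV /VW.
suff : {family @tvs_bounded K X, fmap (@dual_fun K X) G --> (f : X -> K^o)}.
  move: fU; rewrite nbhsE => -[_ [[V oV <-] Vf] VU] /(_ V) [].
    by apply: open_nbhs_nbhs.
  by move=> B [e [bB e0 BV]]; exists B, e; split=> // g /BV /VU.
apply/fam_cvgP => B bB V /uniform_nbhs[E [entE EV]].
move: entE; rewrite -entourage_ballE => -[e /= e0 eE].
exists B, e; split=> //.
move=> g [d /andP[d0 de] gd]; apply: EV => x Bx; apply: eE => /=.
rewrite -ball_normE /= distrC; apply: le_lt_trans de; exact: gd.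
Qed.

Lemma dual_nbhs0 B e : tvs_bounded B -> 0 < e -> nbhs (0 : strong_dual X) (dual_ball B e).
Proof. by move=> bB e0; apply/dual_nbhsP; exists B, e; split=> // g; rewrite subr0. Qed.

Lemma op_linear_at S a x z : S (a *: x + z) = a *: S x + S z.
Proof. exact: op_linear. Qed.

Lemma op_zero S : S 0 = 0.
Proof. by have := op_linear_at S (-1) 0 0; rewrite !scaleN1r addr0 oppr0 addNr. Qed.

Lemma op_bounded (F : set (lin_op X)) B : equicontinuous_ops F -> tvs_bounded B ->
  tvs_bounded [set x | exists2 S, F S & exists2 z, B z & x = S z].
Proof.
move=> eF bB U U0; have [V V0 FV] := eF U U0; have [r r0 rB] := bB V V0.
exists r => // s rs _ [S FS [z Bz ->]]; have [v Vv <-] := rB s rs z Bz.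
exists (S v); first by apply: FV FS _ _; exists v.
by have := op_linear_at S s v 0; rewrite op_zero !addr0.
Qed.

Lemma op_equicontinuous1 S : equicontinuous_ops [set S].
Proof.
move=> V V0; exists (S @^-1` V); first by apply: op_continuous; rewrite op_zero.
by move=> _ -> _ [x Vx <-].
Qed.

(** Closed with [Defined], so that [adjoint_funE] holds by computation. *)
Definition adjoint_fun S y : strong_dual X.
Proof.
apply: (@mk_dual (y \o S)).
- by move=> a x z /=; rewrite op_linear_at dual_linear.
- move=> x; apply: continuous_comp; first exact: op_continuous.
  exact: dual_continuous.
Defined.

Lemma adjoint_funE S y x : adjoint_fun S y x = y (S x). Proof. by []. Qed.

(** The images of a bounded B under all members of F together form a bounded set; its polar is a
    neighbourhood that works for every S in F. *)
Lemma adjoint_equi (F : set (lin_op X)) (V : set (strong_dual X)) :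
  equicontinuous_ops F -> nbhs 0 V ->
  exists2 U : set (strong_dual X), nbhs 0 U &
    forall S y, F S -> U y -> V (adjoint_fun S y).
Proof.
move=> eF /dual_nbhsP[B [e [bB e0 BV]]].
exists (dual_ball [set x | exists2 S, F S & exists2 z, B z & x = S z] e).
  by apply: dual_nbhs0 => //; exact: op_bounded.
move=> S y FS [d de yd]; apply: BV; rewrite subr0; exists d => // x Bx.
by rewrite adjoint_funE; apply: yd; exists S => //; exists x.
Qed.

Lemma adjoint_linear S : linear (adjoint_fun S).
Proof. by move=> a f g; apply: dual_ext. Qed.

Lemma adjoint_continuous S : continuous (adjoint_fun S).
Proof.
move=> f U /dual_nbhsP[B [e [bB e0 BU]]].
have [V V0 VB] := adjoint_equi (op_equicontinuous1 S) (dual_nbhs0 bB e0).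
have /dual_nbhsP[C [d [bC d0 CV]]] := V0.
apply/dual_nbhsP; exists C, d; split=> // g Cg; apply: BU.
have -> : adjoint_fun S g - adjoint_fun S f = adjoint_fun S (g - f) by apply: dual_ext.
by apply: VB => //; apply: CV; rewrite subr0.
Qed.

Definition adjoint S : lin_op (strong_dual X) :=
  LinOp (@adjoint_linear S) (@adjoint_continuous S).

Lemma adjoint_equicontinuous (F : set (lin_op X)) : equicontinuous_ops F ->
  equicontinuous_ops [set adjoint S | S in F].
Proof.
move=> eF V V0; have [U U0 UV] := adjoint_equi eF V0; exists U => //.
by move=> _ [S FS <-] _ [y Uy <-]; exact: UV.
Qed.

End Dual.

(** * Continuity and boundedness in terms of seminorms; expansion in the unit vectors *)

Section SeminormedSpaces.
Context {R : realType} (X : lcseq R).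
Implicit Types (p q : omega R -> R) (x z : elt X) (y : strong_dual (elt X)).

Lemma elt_carrier x : carrier X x.
Proof. by apply: set_mem; exact: seq_ofP. Qed.

Lemma elt_ext x z : (forall n, seq_of x n = seq_of z n) -> x = z.
Proof. by move=> xz; apply: val_inj; apply/funext. Qed.

Lemma seminorm_nbhs0 p (e : R) : seminorms X p -> 0 < e ->
  nbhs (0 : elt X) [set x | p x < e].
Proof.
move=> Xp e0; exists (seminorm_ball (fun _ : 'I_1 => p) e).
  by exists 1%N, (fun _ => p), e.
by move=> x /(_ ord0); rewrite subr0.
Qed.

(** Two seminorms on the right, because the resolvents are estimated by p x and p' x together and
    [seminorms X] need not be closed under sums. *)
Lemma equicontinuous_bound (I : Type) (T : I -> elt X -> elt X) :
  (forall p, seminorms X p -> exists p1 p2 C, [/\ seminorms X p1, seminorms X p2, 0 <= C &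
     forall i x, p (T i x) <= C * (p1 x + p2 x)]) ->
  forall V : set (elt X), nbhs 0 V -> exists2 U : set (elt X), nbhs 0 U &
    forall i x, U x -> V (T i x).
Proof.
move=> Tb V [W [n [p [e [Xp e0 ->]]]] WV].
have FF : Filter (nbhs (0 : elt X)) by exact: nbhs_filter.
have : forall j : 'I_n, \forall x \near (0 : elt X), forall i, p j (T i x) < e.
  move=> j; have [p1 [p2 [C [Xp1 Xp2 C0 CP]]]] := Tb _ (Xp j).
  have d0 : 0 < e / 2 / (C + 1) by rewrite !divr_gt0// ltr_wpDl.
  near=> x; move=> i; apply: le_lt_trans (CP i x) _.
  have x1 : p1 x < e / 2 / (C + 1) by near: x; exact: seminorm_nbhs0.
  have x2 : p2 x < e / 2 / (C + 1) by near: x; exact: seminorm_nbhs0.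
  have h : p1 x + p2 x < e / (C + 1).
    by rewrite [e in ltRHS]splitr mulrDl; exact: ltrD.
  apply: (@le_lt_trans _ _ ((C + 1) * (p1 x + p2 x))).
    by rewrite ler_wpM2r ?lerDl// addr_ge0// seminorm_ge0.
  by rewrite mulrC -ltr_pdivlMr// ltr_wpDl.
move=> /filter_forall h; exists [set x | forall (j : 'I_n) i, p j (T i x) < e] => //.
by move=> i x Ux; apply: WV => j; rewrite subr0; exact: Ux.
Unshelve. all: by end_near.
Qed.

Lemma linear_bound_continuous (T : elt X -> elt X) : linear T ->
  (forall p, seminorms X p -> exists p1 p2 C, [/\ seminorms X p1, seminorms X p2, 0 <= C &
     forall x, p (T x) <= C * (p1 x + p2 x)]) -> continuous T.
Proof.
move=> lT Tb x U [W bW WU].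
have W0 : nbhs (0 : elt X) W by exists W => // z; rewrite subr0.
have [V [W' bW' WV] VW] : exists2 V : set (elt X), nbhs 0 V &
    forall (i : unit) x, V x -> W (T x).
  apply: (@equicontinuous_bound unit (fun=> T)) => // p /Tb[p1 [p2 [C [Xp1 Xp2 C0 CP]]]].
  by exists p1, p2, C.
exists W' => // z W'z; apply: WU.
have -> : T z - T x = T (z - x).
  by rewrite -[RHS](addrK (T x)) -[in RHS](scale1r (T (z - x))) -lT scale1r subrK.
by apply: (VW tt); apply: WV; rewrite subr0.
Qed.

Lemma functional_bound_continuous (f : elt X -> R[i]^o) p C : linear f ->
  seminorms X p -> 0 <= C -> (forall x, cmod (f x) <= C * p x) -> continuous f.
Proof.
move=> lf Xp C0 fp x U; rewrite -nbhs_ballE => -[e /= e0 eU].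
have ec : e = (cmod e)%:C by rewrite -cmodE gtr0_norm.
have e0' : 0 < cmod e by rewrite -ltcR -ec.
exists (seminorm_ball (fun _ : 'I_1 => p) (cmod e / (C + 1))).
  by exists 1%N, (fun=> p), (cmod e / (C + 1)); split=> //; rewrite divr_gt0// ltr_wpDl.
move=> z /(_ ord0) pz; apply: eU; rewrite -ball_normE /= distrC.
have -> : f z - f x = f (z - x).
  by rewrite -[RHS](addrK (f x)) -[in RHS](scale1r (f (z - x))) -lf scale1r subrK.
rewrite ec cmodE ltcR; apply: le_lt_trans (fp _) _.
apply: (@le_lt_trans _ _ ((C + 1) * p (z - x))).
  by rewrite ler_wpM2r ?lerDl// seminorm_ge0.
by rewrite mulrC -ltr_pdivlMr// ltr_wpDl.
Qed.

Lemma bounded_seminorms (B : set (elt X)) :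
  (forall p, seminorms X p -> exists C, forall x, B x -> p x <= C) -> tvs_bounded B.
Proof.
move=> Bb U [W [n [p [e [Xp e0 ->]]]] WU].
have [C CP] := fin_all_exists (fun j : 'I_n => Bb _ (Xp j)).
pose M := \sum_j `|C j|.
have M0 : 0 <= M by rewrite sumr_ge0.
have M1 : 0 < M + 1 by rewrite ltr_wpDl.
have CM j : C j <= M.
  by rewrite /M (bigD1 j)//=; apply: le_trans (ler_norm _) _; rewrite lerDl sumr_ge0.
exists ((M + 1) / e)%:C; first by rewrite ltcR divr_gt0.
move=> s rs x Bx.
have s0 : 0 < s by apply: lt_le_trans rs; rewrite ltcR divr_gt0.
have sc : s = (cmod s)%:C by rewrite -cmodE gtr0_norm.
have rs' : (M + 1) / e <= cmod s by rewrite -lecR -sc.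
exists (s^-1 *: x); last by rewrite scalerA mulfV ?scale1r ?gt_eqF.
apply: WU => j; rewrite subr0 seminormZ// cmodV.
have cs0 : 0 < cmod s by rewrite -ltcR -sc.
rewrite ltr_pdivrMl//; apply: le_lt_trans (CP j _ Bx) _.
apply: (@lt_le_trans _ _ (M + 1)); first by rewrite ltr_pwDr.
by rewrite -ler_pdivrMr.
Qed.

Lemma seminorm_bounded (B : set (elt X)) p : tvs_bounded B -> seminorms X p ->
  exists2 C, 0 <= C & forall x, B x -> p x <= C.
Proof.
move=> bB Xp; have [r r0 rB] := bB _ (seminorm_nbhs0 Xp ltr01).
exists (cmod r); first exact: cmod_ge0.
move=> x /(rB r (lexx r))[z /= pz <-].
by rewrite seminormZ// ler_piMr ?cmod_ge0// ltW.
Qed.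

Lemma dual_eval_continuous x : continuous (fun f : strong_dual (elt X) => f x : R[i]^o).
Proof.
have bx : tvs_bounded [set x].
  by apply: bounded_seminorms => p _; exists (p x) => _ ->.
move=> f U; rewrite -nbhs_ballE => -[e /= e0 eU]; apply/dual_nbhsP.
exists [set x], e; split=> // g [d /andP[d0 de] /(_ x erefl) gd].
by apply: eU; rewrite -ball_normE /= distrC; apply: le_lt_trans de.
Qed.

Lemma truncP (x : omega R) N : trunc N x \in carrier_pred X.
Proof. by apply/mem_set; exact: carrier_trunc. Qed.

Definition elt_trunc N (x : omega R) : elt X := Elt (truncP x N).

Lemma elt_trunc_sum N (x : omega R) : elt_trunc N x = \sum_(i < N) x i *: unit_elt X i.
Proof.
apply: val_inj => /=; rewrite trunc_sum.
by elim/big_rec2: _ => // i a b _ ->.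
Qed.

Lemma dual_trunc y N (x : omega R) : y (elt_trunc N x) = \sum_(i < N) x i * dual_seq y i.
Proof.
rewrite elt_trunc_sum; elim/big_rec2: _ => [|i a b _ <-]; first exact: dual0.
by rewrite dual_linear.
Qed.

Variables (t : R) (tameX : tame t X).

Lemma elt_trunc_cvg x : elt_trunc N x @[N --> \oo] --> x.
Proof.
move=> U [W [n [p [e [Xp e0 ->]]]] WU].
have : \forall N \near \oo, forall j : 'I_n, p j (elt_trunc N x - x) < e.
  apply: filter_forall => j; have /cvgrPdist_lt /(_ _ e0) := tame_trunc tameX (Xp j) (elt_carrier x).
  apply: filterS => N; rewrite sub0r normrN; apply: le_lt_trans.
  rewrite -opprB -scaleN1r seminormZ// cmodN (cmodR 1) normr1 mul1r.
  exact: ler_norm.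
by apply: filterS => N h; apply: WU.
Qed.

Lemma dual_series y x : \sum_(i < N) x i * dual_seq y i @[N --> \oo] --> (y x : R[i]^o).
Proof.
have := cvg_comp _ _ (@elt_trunc_cvg x) (@dual_continuous _ _ y x).
by under eq_cvg do rewrite /= dual_trunc.
Qed.

Lemma dual_seq_inj (f g : strong_dual (elt X)) : dual_seq f = dual_seq g -> f = g.
Proof.
move=> fg; apply: dual_ext => x; have := @dual_series f x; rewrite fg => h.
exact: (cvg_unique _ h (@dual_series g x)).
Qed.

End SeminormedSpaces.

(** * Limits of bounded complex functions along ultrafilters *)

Section UltraLimits.
Context {R : realType}.

Lemma ultra_cvg (T : choiceType) (G : set_system T) (f : T -> R) (M : R) :
  UltraFilter G -> G [set z | `|f z| <= M] -> exists l : R, f @ G --> l.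
Proof.
move=> UG GM; have PG := @ultra_proper _ _ UG.
have fM : (f @ G) `[(- M), M]%classic.
  rewrite /fmap /=; apply: filterS GM => z /=; rewrite in_itv /= ler_norml => /andP[a b].
  by apply/andP; split.
have [l [_ cl]] := @segment_compact R (- M) M (f @ G) (fmap_proper_filter f PG) fM.
exists l => U Ul; have [//|GU] := in_ultra_setVsetC (f @^-1` U) UG.
by have [z [nUz Uz]] := cl (~` U) U GU Ul.
Qed.

(** The norm of [R[i]] has values in [R[i]]; this restates convergence with real tolerances. *)
Lemma cvg_cmod (T : Type) (F : set_system T) (FF : Filter F) (f : T -> R[i]^o) (l : R[i]^o) :
  f @ F --> l <-> forall e : R, 0 < e -> \forall z \near F, cmod (l - f z) <= e.
Proof.
split=> [/cvgrPdist_le fl e e0|h].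
  have e0' : 0 < e%:C by rewrite ltcR.
  by have := fl _ e0'; apply: filterS => z /=; rewrite cmodE lecR.
apply/cvgrPdist_le => e e0; have ec : e = (cmod e)%:C by rewrite -cmodE gtr0_norm.
have := h (cmod e); rewrite -ltcR -ec => /(_ e0).
by apply: filterS => z; rewrite cmodE ec lecR -ec.
Qed.

Lemma cmod_le_ReIm (z : R[i]) : cmod z <= `|complex.Re z| + `|complex.Im z|.
Proof.
case: z => a b /=; have -> : a +i* b = a%:C + 'i * b%:C by simpc.
apply: le_trans (cmodD _ _) _; rewrite cmodM !cmodR.
have -> : cmod 'i = 1 :> R by rewrite /cmod normc_def /= expr0n expr1n add0r sqrtr1.
by rewrite mul1r.
Qed.

Lemma Re_le_cmod (z : R[i]) : `|complex.Re z| <= cmod z.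
Proof. by rewrite -lecR -cmodE normc_ge_Re. Qed.

Lemma Im_le_cmod (z : R[i]) : `|complex.Im z| <= cmod z.
Proof.
case: z => a b /=; rewrite /cmod normc_def /= -[leLHS]sqrtr_sqr ler_sqrt.
  by rewrite lerDr sqr_ge0.
by rewrite addr_ge0 ?sqr_ge0.
Qed.

Lemma ultra_cvg_complex (T : choiceType) (G : set_system T) (f : T -> R[i]^o) (M : R) :
  UltraFilter G -> G [set z | cmod (f z) <= M] -> exists l : R[i]^o, f @ G --> l.
Proof.
move=> UG GM; have PG := @ultra_proper _ _ UG; have FG : Filter G by exact: filter_filter.
have [a fa] := @ultra_cvg T G (fun z => complex.Re (f z)) M UG
  (filterS (fun z => le_trans (Re_le_cmod _)) GM).
have [b fb] := @ultra_cvg T G (fun z => complex.Im (f z)) M UG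
  (filterS (fun z => le_trans (Im_le_cmod _)) GM).
exists (a +i* b); apply/cvg_cmod => e e0.
have e2 : 0 < e / 2 by rewrite divr_gt0.
have /cvgrPdist_le /(_ _ e2) fa' := fa; have /cvgrPdist_le /(_ _ e2) fb' := fb.
near=> z; apply: le_trans (cmod_le_ReIm _) _; rewrite [leRHS]splitr.
have -> : complex.Re (a +i* b - f z) = a - complex.Re (f z) by case: (f z).
have -> : complex.Im (a +i* b - f z) = b - complex.Im (f z) by case: (f z).
by apply: lerD; near: z.
Unshelve. all: by end_near.
Qed.

Lemma cvg_cmod_le (T : Type) (F : set_system T) (PF : ProperFilter F) (f : T -> R[i]^o)
    (l : R[i]^o) (M : R) :
  f @ F --> l -> (\forall z \near F, cmod (f z) <= M) -> cmod l <= M.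
Proof.
move=> /cvg_cmod fl fM; apply/ler_addgt0Pr => e e0.
have [z [fz lz]] := filter_ex (filterI fM (fl e e0)).
by rewrite -(subrK (f z) l) addrC; apply: le_trans (cmodD _ _) _; exact: lerD.
Qed.

End UltraLimits.

(** * C_t as an operator on X, and compactness of its transpose *)

Section CesaroOperator.
Context {R : realType} {X : lcseq R} {t : R}.
Hypotheses (t01 : 0 <= t < 1) (tameX : tame t X).
Implicit Types (x z : elt X) (y : strong_dual (elt X)).

Let t0 : 0 <= t. Proof. by case/andP: t01. Qed.

Lemma tame_mem tau K (u v : omega R) : 0 <= tau < 1 -> 0 <= K -> carrier X u ->
  dominated K tau u v -> carrier X v.
Proof.
move=> tau01 K0 cu uv; have [p [_ [_ [_ [Xp _ _ _ _]]]]] := tame_compact tameX.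
by have [p' [C [_ _ /(_ _ _ cu uv)[]]]] := tame_dom tameX tau01 K0 Xp.
Qed.

Lemma cesaro_carrier x : cesaro_op t x \in carrier_pred X.
Proof.
apply/mem_set; apply: tame_mem t01 ler01 (elt_carrier x) _.
exact: cesaro_dominated.
Qed.

Definition cesaro_elt x : elt X := Elt (cesaro_carrier x).

Lemma cesaro_elt_linear : linear cesaro_elt.
Proof.
move=> a x z; apply: elt_ext => n.
change (cesaro_op t (a *: seq_of x + seq_of z) n = (a *: cesaro_op t x + cesaro_op t z) n).
by rewrite cesaroD cesaroZ.
Qed.

Lemma cesaro_elt_continuous : continuous cesaro_elt.
Proof.
apply: linear_bound_continuous; first exact: cesaro_elt_linear.
move=> p Xp; have [q [C [Xq C0 qP]]] := tame_dom tameX t01 ler01 Xp.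
exists q, q, C; split=> // x.
have [_ h] := qP _ _ (elt_carrier x) (cesaro_dominated x t0).
by apply: le_trans h _; rewrite ler_wpM2l// lerDl seminorm_ge0.
Qed.

Definition cesaro_lin : lin_op (elt X) := LinOp cesaro_elt_linear cesaro_elt_continuous.

(** Combinations of these vectors cancel leading entries of C_t x, and the values of C_t' y at them
    are the entries of y. *)
Definition cesaro_pre n : elt X := n.+1%:R *: (unit_elt X n - t%:C *: unit_elt X n.+1).

Lemma cesaro_preE n : cesaro_lin (cesaro_pre n) = unit_elt X n.
Proof.
have preE k : seq_of (cesaro_pre n) k =
  n.+1%:R * (unit_seq n k - t%:C * unit_seq n.+1 k) by [].
apply: elt_ext => k.
suff /esym/(congr1 (fun v => v k)) : unit_seq n = cesaro_op t (cesaro_pre n) by [].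
apply: cesaro_unique => [|m]; rewrite preE /unit_seq /=.
  by rewrite mulr0 subr0; case: eqP => [->|_]; rewrite ?mulr1 ?mulr0.
rewrite eqSS; have [->|nm] := eqVneq n m.
  by rewrite ltn_eqF// mulr0 sub0r !mulr1; ring.
have [->|_] := eqVneq n m.+1; last by rewrite !mulr0 subr0 mulr0 addr0.
by rewrite !mulr0 subr0 !mulr1 addr0.
Qed.

Lemma cesaro_compact : compact_op (adjoint cesaro_lin).
Proof.
have [p [eps [K [B0 [Xp eps0 K0 coordP [B0b _ B0T]]]]]] := tame_compact tameX.
(* C_t (w N x) is C_t x without its first N entries, while f x - f (w N x) involves f only at N
   vectors independent of x. *)
pose w N x : elt X := x - \sum_(n < N) cesaro_lin x n *: cesaro_pre n.
have wE N x : cesaro_lin (w N x) = cesaro_lin x - elt_trunc X N (cesaro_lin x).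
  rewrite /w elt_trunc_sum -[in LHS]scaleN1r addrC op_linear_at scaleN1r addrC.
  congr (_ - _).
  elim/big_rec2: _ => [|n a b _ <-]; first exact: op_zero.
  by rewrite op_linear_at cesaro_preE.
(* KK is given by conditions on finitely many values of f at a time, so it is closed under
   pointwise limits; the bound eps N makes pointwise limits in KK uniform on bounded sets. *)
pose KK := [set f : strong_dual (elt X) | forall x N, cmod (f (w N x)) <= `|eps N| * p x].
have KKcvg (G : set_system (strong_dual (elt X))) (PG : ProperFilter G)
    (f : strong_dual (elt X)) : G KK ->
    (forall x, (fun g : strong_dual (elt X) => g x : R[i]^o) @ G --> (f x : R[i]^o)) -> KK f.
  move=> GK fx x N; apply: (cvg_cmod_le PG (fx (w N x))).
  by apply: filterS GK => g; exact.
have KKclosed : closure KK `<=` KK.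
  move=> f clf x N; apply/ler_addgt0Pr => e e0.
  have /cvg_cmod /(_ _ e0) h := @dual_eval_continuous R X (w N x) f.
  have [g [KKg fg]] := clf _ h.
  rewrite -(subrK (g (w N x)) (f (w N x))) addrC.
  by apply: le_trans (cmodD _ _) _; rewrite lerD.
have cKK : compact KK.
  rewrite compact_ultra => G UG GK.
  have PG := @ultra_proper _ _ UG; have FG : Filter G by exact: filter_filter.
  (* For N = 0 membership in [KK] reads |g x| <= |eps 0| p x: the values at x are bounded, hence
     converge along G, and the same bound makes the limit continuous. *)
  have /choice[L LP] : forall x, exists l : R[i]^o,
      (fun g : strong_dual (elt X) => g x : R[i]^o) @ G --> l.
    move=> x; apply: (ultra_cvg_complex (M := `|eps 0%N| * p x)) => //.
    apply: filterS GK => g /(_ x 0%N); congr (_ <= _); congr (cmod (g _)).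
    by rewrite /w big_ord0 subr0.
  have Lp x : cmod (L x) <= `|eps 0%N| * p x.
    apply: (cvg_cmod_le PG (LP x)); apply: filterS GK => g /(_ x 0%N).
    by rewrite /w big_ord0 subr0.
  have lL : linear L.
    move=> a x z; apply: (cvg_unique _ (LP (a *: x + z))) => //.
    have : (fun g : strong_dual (elt X) => (a * g x + g z : R[i]^o)) @ G --> a *: L x + L z.
      by apply: cvgD; [apply: cvgMr; exact: LP|exact: LP].
    by under eq_cvg do rewrite -dual_linear.
  have cL : continuous L by exact: (functional_bound_continuous lL Xp (normr_ge0 _) Lp).
  pose f := mk_dual lL cL.
  have KKf : KK f by exact: (KKcvg G).
  exists f; split=> // V /dual_nbhsP[B [e [bB e0 BV]]].
  have ec : e = (cmod e)%:C by rewrite -cmodE gtr0_norm.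
  have d0 : 0 < cmod e by rewrite -ltcR -ec.
  move: (cmod e) d0 ec => d d0 ec; rewrite ec in BV.
  have [P P0 BP] := seminorm_bounded bB Xp.
  have [Q Q0 BQ] : exists2 Q, 0 <= Q & forall x n, B x -> cmod (cesaro_lin x n) <= Q * n.+1%:R.
    have [q [C [Xq C0 qP]]] := tame_dom tameX t01 ler01 Xp.
    have [M M0 BM] := seminorm_bounded bB Xq.
    exists (K * (C * M)); first by rewrite !mulr_ge0.
    move=> x n Bx; apply: le_trans (coordP _ n (elt_carrier (cesaro_lin x))) _.
    rewrite mulrAC ler_wpM2r// ler_wpM2l//.
    have [_ h] := qP _ _ (elt_carrier x) (cesaro_dominated x t0).
    by apply: le_trans h _; rewrite ler_wpM2l// BM.
  have d4 : 0 < d / 4 / (P + 1) by rewrite !divr_gt0// ltr_wpDl.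
  have [N epsN] : exists N, `|eps N| <= d / 4 / (P + 1).
    have /cvgr0Pnorm_le /(_ _ d4) [N _ h] := eps0; exists N; exact: (h N (leqnn N)).
  pose S : R := \sum_(n < N) Q * n.+1%:R.
  have S0 : 0 <= S by rewrite sumr_ge0// => n _; rewrite mulr_ge0.
  have eta0 : 0 < d / 4 / (S + 1) by rewrite !divr_gt0// ltr_wpDl.
  have Gn : G [set g : strong_dual (elt X) | forall n : 'I_N,
      cmod (f (cesaro_pre n) - g (cesaro_pre n)) <= d / 4 / (S + 1)].
    by apply: filter_forall => n; have /cvg_cmod /(_ _ eta0) := LP (cesaro_pre n).
  apply: filterS (filterI Gn GK) => g [gn KKg].
  (* One quarter each for g and f at w N x and one for the finite sum; [dual_ball] asks for a bound
     strictly below d. *)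
  apply: BV; exists (3 * (d / 4))%:C.
    by rewrite lecR ltcR; lra.
  move=> x Bx; rewrite cmodE lecR dual_subE.
  have -> : g x - f x = g (w N x) - f (w N x) +
      \sum_(n < N) cesaro_lin x n * (g (cesaro_pre n) - f (cesaro_pre n)).
    have gE (h : strong_dual (elt X)) :
        h x = h (w N x) + \sum_(n < N) cesaro_lin x n * h (cesaro_pre n).
      rewrite /w dualB -[LHS]addr0 -addrA; congr (_ + _).
      rewrite addrC; apply/esym/eqP; rewrite subr_eq0; apply/eqP.
      by elim/big_rec2: _ => [|i a b _ ->]; rewrite ?dual0// dual_linear.
    rewrite [in LHS](gE g) [in LHS](gE f) opprD addrACA; congr (_ + _).
    by rewrite -sumrB; apply: eq_bigr => n _; rewrite mulrBr.
  have wle (h : strong_dual (elt X)) : KK h -> cmod (h (w N x)) <= d / 4.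
    move=> /(_ x N) hw; apply: le_trans hw _.
    apply: (@le_trans _ _ (d / 4 / (P + 1) * (P + 1))); last by rewrite divfK ?gt_eqF ?ltr_wpDl.
    apply: ler_pM => //; first by exact: seminorm_ge0.
    by apply: le_trans (BP _ Bx) _; rewrite lerDl.
  apply: le_trans (cmodD _ _) _.
  have -> : 3 * (d / 4) = d / 4 + d / 4 + d / 4 by ring.
  apply: lerD.
    by apply: le_trans (cmodD _ _) _; rewrite cmodN; apply: lerD; exact: wle.
  apply: le_trans (cmod_sum _ _ _) _.
  apply: (@le_trans _ _ (S * (d / 4 / (S + 1)))).
    rewrite /S mulr_suml; apply: ler_sum => n _; rewrite cmodM ler_pM ?cmod_ge0 ?BQ//.
    by rewrite -cmodN opprB.
  by rewrite mulrA ler_pdivrMr ?ltr_wpDl// mulrC ler_wpM2l ?divr_ge0 ?(ltW d0)// lerDl.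
pose U := dual_ball [set x : elt X | B0 x] (1 : R[i]).
have bB0 : tvs_bounded [set x : elt X | B0 x].
  by apply: bounded_seminorms => q /B0b[C CP]; exists C => x /CP[].
exists U; first exact: dual_nbhs0.
suff UK : adjoint cesaro_lin @` U `<=` KK.
  apply: (subclosed_compact _ cKK); first exact: closed_closure.
  by apply: subset_trans KKclosed; apply: closure_subset.
move=> _ [y Uy <-] x N; rewrite adjoint_funE wE.
apply/ler_addgt0Pr => e e0; have e2 : 0 < e / 2 by rewrite divr_gt0.
(* Adding e / 2 makes c positive, as eps N * p x may vanish; the other e / 2 absorbs the tail of C_t
   x beyond M. *)
set c := `|eps N| * p x + e / 2.
have pc : 0 <= `|eps N| * p x by rewrite mulr_ge0// seminorm_ge0.
have c0 : 0 < c by rewrite ltr_wpDl.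
have ec : eps N * p x <= c.
  apply: (@le_trans _ _ (`|eps N| * p x)); last by rewrite lerDl ltW.
  by rewrite ler_wpM2r ?ler_norm// seminorm_ge0.
have -> : `|eps N| * p x + e = c + e / 2 by rewrite /c -addrA -splitr.
have : elt_trunc X M (cesaro_lin x) @[M --> \oo] --> cesaro_lin x.
  exact: (elt_trunc_cvg tameX).
move=> /(cvg_comp _ _) /(_ (@dual_continuous _ _ y _)) /cvg_cmod /(_ _ e2) h.
near \oo => M.
have NM : (N <= M)%N by near: M; exact: nbhs_infty_ge.
have hM : cmod (y (cesaro_lin x) - y (elt_trunc X M (cesaro_lin x))) <= e / 2 by near: M.
rewrite dualB -(subrK (y (elt_trunc X M (cesaro_lin x))) (y (cesaro_lin x))) -addrA addrC.
apply: le_trans (cmodD _ _) _; apply: lerD => //.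
rewrite -dualB.
have := B0T x N M c (elt_carrier x) NM c0 ec.
pose b : elt X := (c^-1)%:C *: (elt_trunc X M (cesaro_lin x) - elt_trunc X N (cesaro_lin x)).
move=> B0b'; have [d /andP[d0 d1] /(_ b B0b')] := Uy.
rewrite dualZ => yb; have : `|(c^-1)%:C * y (elt_trunc X M (cesaro_lin x) - elt_trunc X N (cesaro_lin x))| <= 1.
  exact: le_trans yb (ltW d1).
rewrite cmodE -(rmorph1 (real_complex R)) lecR cmodM cmodR gtr0_norm ?invr_gt0//.
by rewrite ler_pdivrMl// mulr1.
Unshelve. all: by end_near.
Qed.

End CesaroOperator.

(** * Resolvents of an operator and of its transpose *)

Section OperatorFacts.
Context {K : numFieldType} {Z : tvsType K}.
Implicit Types (S T : lin_op Z) (l m : K).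

Lemma resolvent_unique T l S S' : is_resolvent T l S -> is_resolvent T l S' ->
  forall z, S z = S' z.
Proof. by move=> [Sl _] [_ S'r] z; rewrite -{1}(S'r z) Sl. Qed.

Lemma op_nbhs0 S (V : set Z) : nbhs 0 V -> nbhs 0 (S @^-1` V).
Proof. by move=> V0; apply: op_continuous; rewrite op_zero. Qed.

Lemma point_spectrum_sub T : point_spectrum T `<=` spectrum T.
Proof.
by move=> l nl [S [Sl _]]; apply: nl => z1 z2 h; rewrite -(Sl z1) h Sl.
Qed.

Lemma resolvent_star_sub T : resolvent_set_star T `<=` resolvent_set T.
Proof. by move=> l [d d0 [h _]]; apply: h; rewrite /= subrr normr0. Qed.

End OperatorFacts.

Lemma op_scaleB (K : numFieldType) (X : tvsType K) (S : lin_op X) (a : K) (x z : X) :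
  S (a *: x - z) = a *: S x - S z.
Proof. by rewrite addrC -scaleN1r op_linear_at scaleN1r addrC -[a *: x]addr0 op_linear_at op_zero addr0. Qed.

Lemma adjoint_resolvent (K : numFieldType) (X : tvsType K) (T S : lin_op X) (l : K) :
  is_resolvent T l S -> is_resolvent (adjoint T) l (adjoint S).
Proof.
move=> [Sl Sr]; split=> y; apply: dual_ext => x.
  rewrite adjoint_funE dual_subE dual_scaleE adjoint_funE.
  by rewrite -dualZ -dualB Sr.
rewrite dual_subE dual_scaleE !adjoint_funE.
by rewrite -dualZ -dualB -op_scaleB Sl.
Qed.

(** * Scalar recursions for the resolvents and the eigenvectors *)

Section RealAux.
Context {R : realType}.
Implicit Types (x u v : omega R) (t tau A sg : R) (mu l : R[i]).

Lemma dominated_rec tau sg A (N0 : nat) (rho : nat -> R) u v :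
  0 <= tau -> 1 <= sg -> 0 <= A ->
  (forall n, rho n <= sg * tau) -> (forall n, (N0 <= n)%N -> rho n <= tau) ->
  cmod (v 0%N) <= A * cmod (u 0%N) ->
  (forall n, n.+2%:R * cmod (v n.+1) <=
     A * cmod (u n.+1) + rho n * (n.+1%:R * cmod (v n))) ->
  dominated (A * sg ^+ N0) tau u v.
Proof.
move=> t0 sg1 A0 rho_sg rho_t v0 vS.
have sg0 : 0 <= sg by apply: le_trans sg1.
have key n : n.+1%:R * cmod (v n) <= A * sg ^+ minn n N0 * geo tau u n.
  elim: n => [|n IH]; first by rewrite mul1r min0n mulr1 geo0.
  apply: le_trans (vS n) _; rewrite geoS mulrDr.
  have sgA m : A <= A * sg ^+ m by rewrite ler_peMr// exprn_ege1.
  apply: lerD; first by rewrite ler_wpM2r ?cmod_ge0.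
  have G0 := @geo_ge0 R tau u n t0.
  have GA m : 0 <= A * sg ^+ m * geo tau u n by rewrite !mulr_ge0 ?exprn_ge0.
  have C0 : 0 <= n.+1%:R * cmod (v n) by rewrite mulr_ge0 ?cmod_ge0.
  have [Nn|nN] := leqP N0 n.
    apply: le_trans (ler_wpM2r C0 (rho_t n Nn)) _.
    apply: le_trans (ler_wpM2l t0 IH) _.
    by rewrite (minn_idPr Nn) (minn_idPr (leqW Nn)) mulrCA.
  apply: le_trans (ler_wpM2r C0 (rho_sg n)) _.
  apply: le_trans (ler_wpM2l _ IH) _; first by rewrite mulr_ge0.
  rewrite (minn_idPl (ltnW nN)) (minn_idPl nN) exprS.
  by rewrite le_eqVlt; apply/orP; left; apply/eqP; ring.
move=> n; apply: le_trans (key n) _.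
rewrite ler_wpM2r ?geo_ge0// ler_wpM2l// ler_weXn2l// geq_minr//.
Qed.

Lemma cesaro_first t x n : (forall k, (k < n)%N -> x k = 0) ->
  cesaro_op t x n = x n / n.+1%:R.
Proof.
move=> x0; rewrite /cesaro_op big_ord_recr /= subnn mul1r big1 ?add0r// => k _.
by rewrite x0 ?mulr0.
Qed.

(** C_t is lower triangular with diagonal entries 1/(n+1), so the entries of x vanish one after the
    other. *)
Lemma cesaro_eigen_inj t mu x : (forall n, mu != n.+1%:R^-1) ->
  mu *: x - cesaro_op t x = 0 -> x = 0.
Proof.
move=> muL E; apply/funext => n.
elim/ltn_ind: n => n IH.
have := congr1 (fun v : omega R => v n) E.
rewrite omegaB omegaZ cesaro_first// [(0 : omega R) n]/0 [x n / _]mulrC -mulrBl => /eqP.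
by rewrite mulf_eq0 subr_eq0 (negPf (muL n)) /= => /eqP.
Qed.

(* For mu x - C_t x = u, the sequence v = C_t x satisfies this recursion, and x = (u + v) / mu. *)
Fixpoint resolvent_aux t mu u n : R[i] :=
  if n is n'.+1
  then (u n + mu * t%:C * n%:R * resolvent_aux t mu u n') / (mu * n.+1%:R - 1)
  else u 0%N / (mu - 1).

Lemma cesaro_resolvent t mu u : mu != 0 -> (forall n, mu != n.+1%:R^-1) ->
  cesaro_op t (mu^-1 *: (u + resolvent_aux t mu u)) = resolvent_aux t mu u.
Proof.
move=> mu0 muL.
have d0 n : mu * n.+1%:R - 1 != 0.
  apply: contra (muL n); rewrite subr_eq0 => /eqP h.
  have -> : n.+1%:R^-1 = mu * n.+1%:R / n.+1%:R by rewrite h mul1r.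
  by rewrite mulfK ?pnatr_eq0.
set v := resolvent_aux t mu u; apply/esym/cesaro_unique.
  rewrite omegaZ omegaD /v /=; have := d0 0%N; rewrite mulr1 => d00.
  by field; rewrite mu0 d00.
move=> n; rewrite omegaZ omegaD.
have E : v n.+1 * (mu * n.+2%:R - 1) = u n.+1 + mu * t%:C * n.+1%:R * v n.
  by rewrite /v /= divfK.
apply: (mulfI mu0); rewrite mulrDr mulVKf//.
have -> : u n.+1 = v n.+1 * (mu * n.+2%:R - 1) - mu * t%:C * n.+1%:R * v n.
  by rewrite E addrK.
by ring.
Qed.

(** The ratio t |mu| / |mu - 1/(n+2)| is at most M / d, and at most tau once 1/(n+2) <= (tau - t) d.
    Both thresholds depend on d and M only, which makes K uniform in mu. *)
Lemma resolvent_dominated t tau (d M : R) : 0 <= t -> t < tau -> 2^-1 <= tau < 1 ->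
  0 < d -> exists2 K, 0 <= K & forall mu u, d <= cmod mu <= M ->
    (forall n, d <= cmod (mu - n.+1%:R^-1)) -> dominated K tau u (resolvent_aux t mu u).
Proof.
move=> t0 tt /andP[tau2 tau1] d0; have tau0 : 0 < tau by apply: lt_le_trans tau2; rewrite invr_gt0.
have td : 0 < (tau - t) * d by rewrite mulr_gt0// subr_gt0.
have [M0|M0] := ltP M 0.
  exists 0 => // mu u /andP[_ h]; have := le_lt_trans h M0.
  by rewrite ltNge cmod_ge0.
(* As tau >= 1/2, this gives sg * tau >= M / d; the summand 1 ensures sg >= 1. *)
pose sg := 2 * (M / d) + 1.
have sg1 : 1 <= sg by rewrite lerDr mulr_ge0// divr_ge0// ltW.
pose N0 := (Num.truncn ((tau - t) * d)^-1).+1.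
have N0P : ((tau - t) * d)^-1 <= N0%:R.
  by rewrite ltW// truncnS_gt.
exists (d^-1 * sg ^+ N0).
  by rewrite mulr_ge0 ?invr_ge0 ?exprn_ge0 ?(ltW d0) ?(le_trans _ sg1).
move=> mu u /andP[dmu muM] muL.
have muL0 n : 0 < cmod (mu - n.+1%:R^-1) by apply: lt_le_trans (muL n).
have denE n : mu * n.+1%:R - 1 = (mu - n.+1%:R^-1) * n.+1%:R.
  by rewrite mulrBl mulVf ?pnatr_eq0.
apply: (@dominated_rec tau sg d^-1 N0 (fun n => t * cmod mu / cmod (mu - n.+2%:R^-1))) => //.
- exact: ltW.
- by rewrite invr_ge0 ltW.
- move=> n; rewrite ler_pdivrMr//.
  have h1 : t * cmod mu <= M.
    apply: le_trans muM; rewrite ler_piMl ?cmod_ge0//.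
    by apply: le_trans (ltW tt) _; exact: ltW.
  apply: le_trans h1 _.
  have h2 : M <= sg * tau * d.
    have -> : M = 2 * (M / d) * 2^-1 * d by field; rewrite gt_eqF.
    rewrite ler_wpM2r ?(ltW d0)//; apply: ler_pM => //.
      by rewrite mulr_ge0// divr_ge0// ltW.
    by rewrite lerDl.
  apply: le_trans h2 _; rewrite ler_wpM2l// mulr_ge0 ?(ltW tau0)//.
  exact: le_trans sg1.
- move=> n Nn; rewrite ler_pdivrMr//.
  have h1 : cmod mu - n.+2%:R^-1 <= cmod (mu - n.+2%:R^-1).
    rewrite lerBlDr; have := cmodD (mu - n.+2%:R^-1) n.+2%:R^-1.
    by rewrite subrK cmodV cmod_nat.
  apply: le_trans (ler_wpM2l (ltW tau0) h1).
  have h2 : tau * n.+2%:R^-1 <= (tau - t) * d.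
    apply: (@le_trans _ _ n.+2%:R^-1); first by rewrite ler_piMl ?invr_ge0// ltW.
    rewrite -[leRHS]invrK lef_pV2 ?posrE ?invr_gt0//.
    by apply: le_trans N0P _; rewrite ler_nat; do 2 apply: leqW.
  have h3 : (tau - t) * d <= (tau - t) * cmod mu by rewrite ler_wpM2l// subr_ge0 ltW.
  by have := le_trans h2 h3; rewrite mulrBl lerBrDl mulrBr lerBrDr.
- have := denE 0%N; rewrite /= !mulr1 invr1 => _.
  rewrite cmodM cmodV mulrC ler_wpM2r ?cmod_ge0// lef_pV2 ?posrE//.
    by have := muL 0%N; rewrite invr1.
  by have := muL0 0%N; rewrite invr1.
move=> n /=; rewrite denE -cmod_nat -cmodM.
have -> : n.+2%:R * ((u n.+1 + mu * t%:C * n.+1%:R * resolvent_aux t mu u n) /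
    ((mu - n.+2%:R^-1) * n.+2%:R)) =
  (mu - n.+2%:R^-1)^-1 * u n.+1 + (mu - n.+2%:R^-1)^-1 * (mu * t%:C * n.+1%:R * resolvent_aux t mu u n).
  have : n.+2%:R != 0 :> R[i] by rewrite pnatr_eq0.
  have : mu - n.+2%:R^-1 != 0 by rewrite -cmod_eq0 gt_eqF.
  move: (mu - n.+2%:R^-1) => D D0; move: (n.+2%:R : R[i]) => y y0.
  by field; rewrite D0 y0.
apply: le_trans (cmodD _ _) _; apply: lerD.
  rewrite cmodM cmodV ler_wpM2r ?cmod_ge0// lef_pV2 ?posrE//.
rewrite !cmodM cmodV cmodR ger0_norm// cmod_nat.
by rewrite le_eqVlt; apply/orP; left; apply/eqP; ring.
Qed.

(** For n >= 2 / |l| the points 1/(n+1) have modulus at most |l| / 2, hence distance at least |l| /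
    2 from l; finitely many remain. *)
Lemma Lambda_separated (l : R[i]) : l != 0 -> (forall n, l != n.+1%:R^-1) ->
  exists2 d : R, 0 < d & forall n, d <= cmod (l - n.+1%:R^-1).
Proof.
move=> l0 lL; have r0 : 0 < cmod l by rewrite lt_neqAle eq_sym cmod_eq0 l0 cmod_ge0.
pose N := (Num.truncn (2 / cmod l)).+1.
have NP : 2 / cmod l <= N%:R by rewrite ltW// truncnS_gt.
have pos n : 0 < cmod (l - n.+1%:R^-1).
  by rewrite lt_neqAle eq_sym cmod_eq0 subr_eq0 lL cmod_ge0.
have [d d0 dP] : exists2 d : R, 0 < d & forall n, (n < N)%N -> d <= cmod (l - n.+1%:R^-1).
  elim: N {NP} => [|N [d d0 dP]]; first by exists 1.
  exists (Num.min d (cmod (l - N.+1%:R^-1))); first by rewrite lt_min d0 pos.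
  move=> n; rewrite ltnS leq_eqVlt => /predU1P[->|nN]; first by rewrite ge_min lexx orbT.
  by rewrite ge_min dP.
exists (Num.min d (cmod l / 2)); first by rewrite lt_min d0 divr_gt0.
move=> n; have [nN|Nn] := ltnP n N; first by rewrite ge_min dP.
rewrite ge_min; apply/orP; right.
have h1 : cmod l - n.+1%:R^-1 <= cmod (l - n.+1%:R^-1).
  rewrite lerBlDr; have := cmodD (l - n.+1%:R^-1) n.+1%:R^-1.
  by rewrite subrK cmodV cmod_nat.
apply: le_trans h1.
have h2 : n.+1%:R^-1 <= cmod l / 2.
  rewrite -[leRHS]invrK lef_pV2 ?posrE ?invr_gt0 ?divr_gt0// invf_div.
  by apply: le_trans NP _; rewrite ler_nat leqW.
by rewrite lerBrDr [leRHS]splitr lerD2l.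
Qed.

(** The coefficients of z^m / (1 - t z)^(m+1): the eigenvector of C_t for 1/(m+1). *)
Definition binomial_seq t (m : nat) : omega R :=
  fun n => t%:C ^+ (n - m) * 'C(n, m)%:R.

Lemma cesaro_binomial t m : cesaro_op t (binomial_seq t m) = m.+1%:R^-1 *: binomial_seq t m.
Proof.
apply/esym/cesaro_unique; rewrite ?omegaZ.
  rewrite /binomial_seq; case: m => [|m]; first by rewrite invr1 mul1r.
  by rewrite bin0n mulr0 mulr0.
move=> n; rewrite !omegaZ.
have m0 : m.+1%:R != 0 :> R[i] by rewrite pnatr_eq0.
apply: (mulfI m0).
rewrite mulrDr ![m.+1%:R * (_ * (m.+1%:R^-1 * _))]mulrCA mulVKf//.
rewrite ![m.+1%:R * (t%:C * _)]mulrCA ![m.+1%:R * (n.+1%:R * _)]mulrCA mulVKf//.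
rewrite /binomial_seq; have [nm|mn] := ltnP n.+1 m.
  by rewrite !bin_small ?(ltnW nm)//; ring.
have [->|nm] := eqVneq m n.+1; first by rewrite subnn !binn bin_small//; ring.
have {}mn : (m <= n)%N by rewrite -ltnS ltn_neqAle nm.
rewrite subSn// exprS.
have E : (n.+1 * 'C(n, m))%N%:R = ((n.+1 - m) * 'C(n.+1, m))%N%:R :> R[i].
  by rewrite mul_bin_down.
rewrite !natrM subSn// in E.
have -> : n.+2%:R * (t%:C * t%:C ^+ (n - m) * 'C(n.+1, m)%:R) =
  m.+1%:R * (t%:C * t%:C ^+ (n - m) * 'C(n.+1, m)%:R) +
  t%:C * t%:C ^+ (n - m) * ((n - m).+1%:R * 'C(n.+1, m)%:R) :> R[i].
  have -> : n.+2%:R = m.+1%:R + (n - m).+1%:R :> R[i].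
    by rewrite -natrD addSn addnS subnKC.
  by ring.
by rewrite -E; ring.
Qed.

(** Puts the eigenvector in every X at once, by solidity and since X contains e_m. The ratio t (n+2)
    / (n-m+1) of consecutive (n+1) v_n is at most t (m+2) and tends to t, so it exceeds (1+t)/2 only
    finitely often. *)
Lemma binomial_dominated t m : 0 <= t < 1 -> exists tau K,
  [/\ 0 <= tau < 1, 0 <= K & dominated K tau (unit_seq m) (binomial_seq t m)].
Proof.
move=> /andP[t0 t1]; pose tau := (1 + t) / 2.
have tau0 : 0 <= tau by rewrite divr_ge0// addr_ge0.
have tt : 0 < tau - t by rewrite /tau; lra.
pose sg : R := 2 * m.+2%:R.
have sg1 : 1 <= sg by rewrite /sg -natrM ler1n.
pose N0 := (Num.truncn (m.+2%:R / (tau - t))).+1.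
have N0P : m.+2%:R / (tau - t) <= N0%:R by rewrite ltW// truncnS_gt.
exists tau, (m.+1%:R * sg ^+ N0); split; first by rewrite tau0 /tau /=; lra.
  by rewrite mulr_ge0 ?exprn_ge0 ?(le_trans _ sg1).
apply: (@dominated_rec tau sg m.+1%:R N0
  (fun n => if (m <= n)%N then t * n.+2%:R / (n - m).+1%:R else 0)) => //.
- move=> n; case: leqP => mn; last by rewrite mulr_ge0// (le_trans _ sg1).
  rewrite ler_pdivrMr//.
  have h : n.+2%:R <= m.+2%:R * (n - m).+1%:R :> R.
    rewrite -natrM ler_nat; move: (subnKC mn); move: (n - m)%N => k <-.
    by nia.
  have -> : sg * tau = (1 + t) * m.+2%:R by rewrite /sg /tau; field.
  rewrite -mulrA; apply: ler_pM => //; by rewrite lerDr.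
- move=> n Nn; case: leqP => mn //.
  rewrite ler_pdivrMr//.
  have h1 : m.+2%:R <= n%:R * (tau - t).
    rewrite -ler_pdivrMr//; apply: le_trans N0P _; by rewrite ler_nat.
  have -> : n.+2%:R = n%:R + 2 :> R by rewrite -natrD addn2.
  have -> : (n - m).+1%:R = n%:R - m%:R + 1 :> R by rewrite -natr1 natrB.
  have h2 : m.+2%:R = m%:R + 2 :> R by rewrite -natrD addn2.
  have m0 : 0 <= m%:R :> R by [].
  have tau1 : tau <= 1 by rewrite /tau; lra.
  have h3 : tau * m%:R <= m%:R by rewrite ler_piMl.
  by rewrite h2 in h1; lra.
- rewrite /binomial_seq /unit_seq; case: m {sg sg1 N0 N0P} => [|m].
    by rewrite eqxx subnn !mul1r.
  by rewrite bin0n mulr0 cmod0 mulr_ge0 ?cmod_ge0.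
move=> n; rewrite /binomial_seq /unit_seq.
have [nm|mn] := ltnP n.+1 m.
  by rewrite bin_small// mulr0 cmod0 mulr0 addr_ge0 ?mulr_ge0 ?cmod_ge0//; case: ifP => // /leqW; rewrite leqNgt nm.
have [->|nm] := eqVneq m n.+1.
  by rewrite subnn binn !mul1r ltnn mul0r addr0.
have {}mn : (m <= n)%N by rewrite -ltnS ltn_neqAle nm.
rewrite cmod0 mulr0 add0r mn subSn// exprS.
have E : (n.+1 * 'C(n, m))%N%:R = ((n.+1 - m) * 'C(n.+1, m))%N%:R :> R.
  by rewrite mul_bin_down.
rewrite !natrM subSn// in E.
rewrite !cmodM !cmod_nat !cmodX cmodR ger0_norm//.
have k0 : (n - m).+1%:R != 0 :> R by rewrite pnatr_eq0.
have -> : 'C(n.+1, m)%:R = n.+1%:R * 'C(n, m)%:R / (n - m).+1%:R :> R.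
  by rewrite E mulrC mulKf.
by rewrite le_eqVlt; apply/orP; left; apply/eqP; ring.
Qed.

Lemma eigen_seqE t n i : eigen_seq t n i =
  if (i <= n)%N then (- t%:C) ^+ (n - i) * 'C(n, i)%:R else 0.
Proof.
rewrite /eigen_seq omega_sum; under eq_bigr do rewrite omegaZ /unit_seq.
case: leqP => [le_in|lt_ni]; last first.
  rewrite big1// => j _; rewrite ltn_eqF ?mulr0//.
  by apply: leq_ltn_trans lt_ni; exact: leq_subr.
have nin : (n - i < n.+1)%N by rewrite ltnS leq_subr.
rewrite (bigD1 (Ordinal nin))//= subKn// eqxx mulr1 big1 ?addr0.
  by rewrite bin_sub// [(- t%:C) ^+ _]exprNn mulrAC.
move=> j; rewrite -val_eqE /= => jn; case: eqP => [ji|_]; last by rewrite mulr0.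
by case/eqP: jn; rewrite -ji subKn// -ltnS.
Qed.

(** This is the equation C_t' y = y / (n+1) evaluated at [cesaro_pre] i. *)
Lemma eigen_seqS t n i : n.+1%:R * eigen_seq t n i =
  i.+1%:R * (eigen_seq t n i - t%:C * eigen_seq t n i.+1).
Proof.
rewrite !eigen_seqE; case: (ltngtP i n) => [lin|lni|->].
- have E : ((n - i) * 'C(n, i))%N%:R = (i.+1 * 'C(n, i.+1))%N%:R :> R[i].
    by rewrite -mul_bin_left.
  rewrite !natrM in E.
  have -> : n.+1%:R = i.+1%:R + (n - i)%:R :> R[i].
    by rewrite -natrD addSn subnKC// ltnW.
  rewrite mulrDl mulrBr; congr (_ + _).
  have nS : (n - i)%N = (n - i.+1).+1 by rewrite subnSK.
  rewrite mulrCA E nS exprS; ring.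
- by rewrite !mulr0 subr0 mulr0.
- by rewrite mulr0 subr0.
Qed.

End RealAux.

(** * Resolvents near a regular point, the value 0, and the eigenspaces *)

Section Spectra.
Context {R : realType} {X : lcseq R} {t : R}.
Hypotheses (t01 : 0 <= t < 1) (tameX : tame t X).
Implicit Types (x : elt X) (y z : strong_dual (elt X)) (l mu : R[i]).

Notation Ct := (cesaro_lin t01 tameX).
Notation Ct' := (adjoint Ct).
Notation pre := (@cesaro_pre R X t).

Lemma resolvent_elt mu x : carrier X (resolvent_aux t mu x) ->
  mu^-1 *: (seq_of x + resolvent_aux t mu x) \in carrier_pred X.
Proof.
move=> cv; apply/mem_set; have [c0 cD cZ] := carrier_subspace X.
by apply: cZ; apply: cD => //; exact: elt_carrier.
Qed.

Lemma cesaro_op_inj mu (x z : elt X) : (forall n, mu != n.+1%:R^-1) ->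
  mu *: x - Ct x = mu *: z - Ct z -> x = z.
Proof.
move=> muL h; apply/eqP; rewrite -subr_eq0; apply/eqP.
have E : mu *: (x - z) - Ct (x - z) = 0.
  have CB : Ct (x - z) = Ct x - Ct z by have := op_scaleB Ct 1 x z; rewrite !scale1r.
  have -> : mu *: (x - z) - Ct (x - z) = (mu *: x - Ct x) - (mu *: z - Ct z).
    by rewrite CB scalerBr !opprB addrACA [RHS]addrACA; congr (_ + _); exact: addrC.
  by rewrite h subrr.
have E' : mu *: seq_of (x - z) - cesaro_op t (seq_of (x - z)) = 0.
  by rewrite -[RHS]/(seq_of (0 : elt X)) -E.
by apply: elt_ext => n; rewrite (cesaro_eigen_inj muL E').
Qed.

Lemma cesaro_resolvent_op l : l != 0 -> (forall n, l != n.+1%:R^-1) ->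
  exists2 d : R[i], 0 < d & exists S : R[i] -> lin_op (elt X),
    (forall mu, `|mu - l| < d -> is_resolvent Ct mu (S mu)) /\
    equicontinuous_ops [set S mu | mu in [set mu | `|mu - l| < d]].
Proof.
move=> l0 lL; have /andP[t0 t1] := t01.
have [d' d'0 d'P] := Lambda_separated l0 lL.
(* Half the distance bound, so that every mu within d of l still has distance at least d from 0 and
   from all 1/(n+1). *)
pose d := Num.min d' (cmod l) / 2.
have r0 : 0 < cmod l by rewrite lt_neqAle eq_sym cmod_eq0 l0 cmod_ge0.
have m0 : 0 < Num.min d' (cmod l) by rewrite lt_min d'0.
have d0 : 0 < d by rewrite divr_gt0.
have dd : d + d = Num.min d' (cmod l) by rewrite /d -splitr.
pose tau := (1 + t) / 2.
have ttau : t < tau by rewrite /tau; lra.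
have tau2 : 2^-1 <= tau < 1 by rewrite /tau; apply/andP; split; lra.
have tau01 : 0 <= tau < 1 by case/andP: tau2 => h ->; rewrite andbT (le_trans _ h)// invr_ge0.
have [K K0 KP] := resolvent_dominated (cmod l + d) t0 ttau tau2 d0.
have disc mu : `|mu - l| < d%:C -> [/\ mu != 0, forall n, mu != n.+1%:R^-1 &
    forall x, dominated K tau x (resolvent_aux t mu x) /\ d <= cmod mu].
  rewrite cmodE ltcR => mul.
  have far (a : R[i]) : d + d <= cmod (l - a) -> d <= cmod (mu - a).
    move=> la; have h : cmod (l - a) <= cmod (mu - l) + cmod (mu - a).
      have := cmodD (- (mu - l)) (mu - a); rewrite cmodN.
      by have -> : - (mu - l) + (mu - a) = l - a by ring.
    by have := le_trans la h; lra.
  have dmu : d <= cmod mu by have := far 0; rewrite !subr0 dd ge_min lexx orbT; apply.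
  have muL n : d <= cmod (mu - n.+1%:R^-1) by apply: far; rewrite dd ge_min d'P.
  split.
  - by rewrite -cmod_eq0 gt_eqF// (lt_le_trans d0).
  - by move=> n; rewrite -subr_eq0 -cmod_eq0 gt_eqF// (lt_le_trans d0).
  move=> x; split=> //; apply: KP => //; rewrite dmu /=.
  by rewrite -(subrK l mu) addrC (le_trans (cmodD _ _))// lerD2l ltW.
exists d%:C; first by rewrite ltcR.
have bound mu (S : elt X -> elt X) : `|mu - l| < d%:C ->
    (forall x, seq_of (S x) = mu^-1 *: (seq_of x + resolvent_aux t mu x)) ->
  forall p p' C, seminorms X p -> 
    (forall u v, carrier X u -> dominated K tau u v -> carrier X v /\ p v <= C * p' u) ->
    forall x, p (S x) <= d^-1 * (p x + C * p' x).
  move=> /disc[mu0 muL h] SE p p' C Xp CP x; have [dom dmu] := h x.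
  have [cv pv] := CP _ _ (elt_carrier x) dom.
  have -> : p (S x) = p (mu^-1 *: (x + elt_of cv)) by rewrite SE.
  rewrite seminormZ// cmodV; apply: ler_pM.
  - by rewrite invr_ge0 cmod_ge0.
  - exact: seminorm_ge0.
  - by rewrite lef_pV2 ?posrE// (lt_le_trans d0).
  - by apply: le_trans (seminormD _ _ Xp) _; rewrite lerD2l.
have boundX (p : omega R -> R) : seminorms X p -> exists p1 p2 C,
    [/\ seminorms X p1, seminorms X p2, 0 <= C & forall mu (S : elt X -> elt X), `|mu - l| < d%:C ->
    (forall x, seq_of (S x) = mu^-1 *: (seq_of x + resolvent_aux t mu x)) ->
    forall x, p (S x) <= C * (p1 x + p2 x)].
  move=> Xp; have [p' [C [Xp' C0 CP]]] := tame_dom tameX tau01 K0 Xp.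
  exists p, p', (d^-1 * (1 + C)); split=> //.
    by rewrite mulr_ge0 ?invr_ge0 ?addr_ge0// ltW.
  move=> mu S mul SE x; apply: le_trans (bound mu S mul SE p p' C Xp CP x) _.
  rewrite -mulrA ler_wpM2l ?invr_ge0 ?(ltW d0)//.
  have h1 := seminorm_ge0 x Xp; have h2 := seminorm_ge0 x Xp'.
  have h3 : 0 <= C * p x by rewrite mulr_ge0.
  by rewrite mulrDl mul1r mulrDr; lra.
(* S is indexed by all complex mu; outside the disc [Ct] serves as a dummy value. *)
have /choice[S SP] mu : exists S : lin_op (elt X), `|mu - l| < d%:C ->
    is_resolvent Ct mu S /\
    (forall x, seq_of (S x) = mu^-1 *: (seq_of x + resolvent_aux t mu x)).
  have [mul|nmul] := boolP (`|mu - l| < d%:C); last by exists Ct.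
  have [mu0 muL h] := disc mu mul.
  have cv x : carrier X (resolvent_aux t mu x).
    by have [dom _] := h x; exact: (tame_mem tameX tau01 K0 (elt_carrier x) dom).
  pose S x : elt X := Elt (resolvent_elt (cv x)).
  have SE x : seq_of (S x) = mu^-1 *: (seq_of x + resolvent_aux t mu x) by [].
  have Sr x : mu *: S x - Ct (S x) = x.
    apply: elt_ext => n.
    change (mu * S x n - cesaro_op t (S x) n = x n).
    rewrite SE cesaro_resolvent// omegaZ mulVKf// omegaD.
    by rewrite addrK.
  have Sl x : S (mu *: x - Ct x) = x by apply: (cesaro_op_inj muL); rewrite Sr.
  have lS : linear S.
    move=> a x z; apply: (cesaro_op_inj muL); rewrite Sr op_linear_at.
    transitivity (a *: (mu *: S x - Ct (S x)) + (mu *: S z - Ct (S z))); first by rewrite !Sr.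
    by rewrite [in RHS]scalerDr scalerBr opprD [RHS]addrACA !scalerA [mu * a]mulrC.
  have cS : continuous S.
    apply: linear_bound_continuous => // p /boundX[p1 [p2 [C [Xp1 Xp2 C0 CP]]]].
    by exists p1, p2, C; split=> // x; exact: (CP mu).
  by exists (LinOp lS cS).
exists S; split; first by move=> mu /SP[].
move=> V V0.
have [p Xp|U U0 UV] := @equicontinuous_bound R X {mu : R[i] | `|mu - l| < d%:C}
  (fun i => S (sval i)) _ V V0.
  have [p1 [p2 [C [Xp1 Xp2 C0 CP]]]] := boundX p Xp; exists p1, p2, C; split=> //.
  by move=> [mu mul] x; apply: (CP mu) => //; case: (SP mu mul).
by exists U => // _ [mu mul <-] _ [x Ux <-]; exact: (UV (exist _ mu mul)).
Qed.

Lemma cesaro_resolvent_star l : l != 0 -> (forall n, l != n.+1%:R^-1) ->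
  resolvent_set_star Ct' l.
Proof.
move=> l0 lL; have [d d0 [S [Sr eS]]] := cesaro_resolvent_op l0 lL.
exists d => //; split.
  by move=> mu mul; exists (adjoint (S mu)); apply: adjoint_resolvent; exact: Sr.
move=> V /(adjoint_equicontinuous eS)[U U0 UV]; exists U => //.
move=> T [mu mul Tmu] _ [y Uy <-].
rewrite (resolvent_unique Tmu (adjoint_resolvent (Sr mu mul)) y).
by apply: (UV (adjoint (S mu))); [exists (S mu) => //; exists mu|exists y].
Qed.

Lemma adjoint_pre y n : Ct' y (pre n) = dual_seq y n.
Proof. by rewrite adjoint_funE cesaro_preE. Qed.

Lemma pre_dual y n :
  y (pre n) = n.+1%:R * (dual_seq y n - t%:C * dual_seq y n.+1).
Proof. by rewrite /cesaro_pre dualZ dualB dualZ. Qed.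

Lemma adjoint_cesaro_inj y1 y2 : Ct' y1 = Ct' y2 -> y1 = y2.
Proof.
move=> h; apply: (dual_seq_inj tameX); apply/funext => n.
by rewrite -!adjoint_pre h.
Qed.

Lemma coord_exists n : exists f : strong_dual (elt X), forall x, f x = x n.
Proof.
have [p [_ [K [_ [Xp _ K0 cP _]]]]] := tame_compact tameX.
have lf : linear (fun x : elt X => x n : R[i]^o) by [].
have cf : continuous (fun x : elt X => x n : R[i]^o).
  apply: (functional_bound_continuous (p := p) (C := K * n.+1%:R)) => //.
    by rewrite mulr_ge0.
  by move=> x; exact: cP (elt_carrier x).
by exists (mk_dual lf cf).
Qed.

(* An inverse S of - C_t' multiplies the n-th entry of the n-th coordinate functional by
   - (n+1), while the functionals of X grow only linearly: S^3 cannot be continuous. *)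
Lemma zero_spectrum : spectrum Ct' 0.
Proof.
move=> [S [_ Sr]].
have CS z : Ct' (S z) = - z by have := Sr z; rewrite scale0r sub0r => h; rewrite -[LHS]opprK h.
have Sz z n : dual_seq (S z) n = - (n.+1%:R * (dual_seq z n - t%:C * dual_seq z n.+1)).
  by rewrite -adjoint_pre CS -pre_dual -sub0r dual_subE dual_zeroE sub0r.
have [p [eps [K [B0 [Xp _ K0 cP [B0b B0u _]]]]]] := tame_compact tameX.
have bB0 : tvs_bounded [set x : elt X | B0 x].
  by apply: bounded_seminorms => q /B0b[C CP]; exists C => x /CP[].
have := op_nbhs0 S (op_nbhs0 S (op_nbhs0 S (dual_nbhs0 bB0 (@ltr01 R[i])))).
move=> /dual_nbhsP[B [e [bB e0 BS]]].
have ec : e = (cmod e)%:C by rewrite -cmodE gtr0_norm.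
have d0 : 0 < cmod e by rewrite -ltcR -ec.
move: (cmod e) d0 ec => d d0 ec; rewrite ec in BS.
have [P P0 BP] := seminorm_bounded bB Xp.
have KP0 : 0 < K * P + 1 by rewrite ltr_wpDl// mulr_ge0.
have small n : d * n.+1%:R < 2 * (K * P + 1).
  have [f fE] := coord_exists n.
  (* On B the n-th coordinate is at most K (n+1) P, so c f stays within d / 2 there; the summand 1
     covers K P = 0. *)
  pose c : R := d / 2 / (K * P + 1) / n.+1%:R.
  have c0 : 0 < c by rewrite !divr_gt0.
  have n0 : (0 : R) < n.+1%:R by [].
  have cf : dual_ball B d%:C (c%:C *: f - 0).
    rewrite subr0; exists (d / 2)%:C.
      by rewrite lecR ltcR divr_ge0 ?(ltW d0)//= ltr_pdivrMr// ltr_pMr// ltr1n.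
    move=> x Bx; rewrite dual_scaleE fE cmodE lecR cmodM cmodR gtr0_norm//.
    apply: (@le_trans _ _ (c * (K * n.+1%:R * P))).
      rewrite ler_wpM2l ?(ltW c0)//; apply: le_trans (cP x n (elt_carrier x)) _.
      by rewrite ler_wpM2l ?mulr_ge0// BP.
    have -> : c * (K * n.+1%:R * P) = d / 2 * (K * P) / (K * P + 1).
      rewrite /c; move: (K * P + 1) KP0 (n.+1%:R : R) n0 => a a0 b b0; field.
      by rewrite !gt_eqF.
    by rewrite ler_pdivrMr// ler_wpM2l ?divr_ge0 ?(ltW d0)// lerDl.
  have [d' /andP[d'0 d'1] /(_ ((n.+1%:R^-1)%:C *: unit_elt X n) (B0u n))] := BS _ cf.
  (* Entry i of S z involves only entries i and i+1 of z, so S preserves vanishing above n and acts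
     on the last entry as multiplication by -(n+1). *)
  have above z : (forall i, (n < i)%N -> dual_seq z i = 0) ->
      (forall i, (n < i)%N -> dual_seq (S z) i = 0) /\
      cmod (dual_seq (S z) n) = n.+1%:R * cmod (dual_seq z n).
    move=> z0; split=> [i ni|]; first by rewrite Sz !z0 ?(leqW ni)// mulr0 subr0 mulr0 oppr0.
    by rewrite Sz (z0 n.+1)// mulr0 subr0 cmodN cmodM cmod_nat.
  have f0 i : (n < i)%N -> dual_seq (c%:C *: f) i = 0.
    by move=> ni; rewrite /dual_seq dual_scaleE fE /= /unit_seq gtn_eqF// mulr0.
  have [z1 E1] := above _ f0; have [z2 E2] := above _ z1; have [z3 E3] := above _ z2.
  have cE : cmod (dual_seq (c%:C *: f) n) = c.
    by rewrite /dual_seq dual_scaleE fE /= /unit_seq eqxx mulr1 cmodR gtr0_norm.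
  rewrite dualZ -[S (S (S _)) (unit_elt X n)]/(dual_seq _ n) => h.
  have := le_lt_trans h d'1.
  rewrite cmodE -(rmorph1 (real_complex R)) ltcR cmodM cmodR E3 E2 E1 cE.
  rewrite gtr0_norm ?invr_gt0// mulKf ?gt_eqF//.
  have -> : n.+1%:R * (n.+1%:R * c) = d * n.+1%:R / (2 * (K * P + 1)).
    rewrite /c; move: (K * P + 1) KP0 (n.+1%:R : R) n0 => a a0 b b0; field.
    by rewrite !gt_eqF.
  by rewrite ltr_pdivrMr ?mulr_gt0// mul1r.
have := small (Num.truncn (2 * (K * P + 1) / d)).
rewrite mulrC -ltr_pdivlMr// => /lt_trans /(_ (truncnS_gt _)).
by rewrite ltxx.
Qed.

Lemma cesaro_unit_coord i k : Ct (unit_elt X i) k =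
  if (i <= k)%N then t%:C ^+ (k - i) / k.+1%:R else 0.
Proof.
change (cesaro_op t (unit_seq i) k = if (i <= k)%N then t%:C ^+ (k - i) / k.+1%:R else 0).
rewrite /cesaro_op; case: leqP => [ik|ki]; last first.
  rewrite big1 ?mul0r// => j _; rewrite /unit_seq gtn_eqF ?mulr0//.
  exact: leq_trans (ltn_ord j) ki.
have ik1 : (i < k.+1)%N by [].
rewrite (bigD1 (Ordinal ik1))//= /unit_seq eqxx mulr1 big1 ?addr0// => j.
by rewrite -val_eqE /= eq_sym => /negPf ->; rewrite mulr0.
Qed.

Lemma adjoint_series y i : \sum_(i <= k < n) t%:C ^+ (k - i) / k.+1%:R * dual_seq y k
  @[n --> \oo] --> (dual_seq (Ct' y) i : R[i]^o).
Proof.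
have := @dual_series R X t tameX y (Ct (unit_elt X i)).
rewrite (_ : (fun N => \sum_(k < N) Ct (unit_elt X i) k * dual_seq y k) =
  (fun n => \sum_(i <= k < n) t%:C ^+ (k - i) / k.+1%:R * dual_seq y k))//.
apply/funext => n.
under eq_bigr do rewrite cesaro_unit_coord.
rewrite -(big_mkord xpredT (fun k => (if (i <= k)%N then t%:C ^+ (k - i) / k.+1%:R else 0)
   * dual_seq y k)).
rewrite (big_nat_widenl i 0)//= [RHS]big_mkcond; apply: eq_bigr => k _.
by case: ifP => //; rewrite mul0r.
Qed.

Lemma eigen_dual n : exists y, dual_seq y = eigen_seq t n.
Proof.
have /choice[f fE] := coord_exists.
exists (\sum_(i < n.+1) ((-1) ^+ i * 'C(n, i)%:R * t%:C ^+ i) *: f (n - i)%N).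
rewrite /eigen_seq; elim/big_rec2: _ => [|i a b _ <-]; first exact/funext.
apply/funext => k; rewrite omegaD omegaZ {1}/dual_seq dual_addE dual_scaleE fE.
by rewrite /= /unit_seq eq_sym.
Qed.

(** Evaluation at [cesaro_pre] gives h k = t h (k+1) for the entries h of the difference, which
    alone does not force h = 0. The series formula shows h = 0 above n, and the recursion carries
    this down. *)
Lemma adjoint_eigen n y : dual_seq y = eigen_seq t n -> Ct' y = n.+1%:R^-1 *: y.
Proof.
move=> yE; apply: (dual_seq_inj tameX); apply/funext => i.
have n0 : n.+1%:R != 0 :> R[i] by rewrite pnatr_eq0.
pose h i := dual_seq (Ct' y) i - dual_seq (n.+1%:R^-1 *: y) i.
have h_above k : (n < k)%N -> h k = 0.
  move=> nk; rewrite /h /dual_seq dual_scaleE -/(dual_seq y k) yE eigen_seqE.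
  rewrite leqNgt nk /= mulr0 subr0 -/(dual_seq (Ct' y) k).
  apply/eqP; rewrite -cmod_eq0 eq_le cmod_ge0 andbT.
  apply: (cvg_cmod_le _ (@adjoint_series y k)); apply: nearW => m.
  rewrite big_nat_cond big1 ?cmod0// => j /andP[/andP[kj _] _].
  by rewrite yE eigen_seqE leqNgt (leq_trans nk kj) mulr0.
have hS k : h k = t%:C * h k.+1.
  have k0 : k.+1%:R != 0 :> R[i] by rewrite pnatr_eq0.
  have := adjoint_pre y k; rewrite pre_dual yE => E1.
  have E2 := eigen_seqS t n k.
  have hE m : h m = dual_seq (Ct' y) m - n.+1%:R^-1 * eigen_seq t n m by rewrite -yE.
  rewrite !hE.
  apply/eqP; rewrite -subr_eq0 -(mulrI_eq0 _ (lregP k0)); apply/eqP.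
  transitivity (k.+1%:R * (dual_seq (Ct' y) k - t%:C * dual_seq (Ct' y) k.+1) -
    n.+1%:R^-1 * (k.+1%:R * (eigen_seq t n k - t%:C * eigen_seq t n k.+1))); first by ring.
  by rewrite E1 -E2 mulKf// subrr.
have hk k m : h k = t%:C ^+ m * h (k + m)%N.
  elim: m k => [|m IH] k; first by rewrite mul1r addn0.
  by rewrite exprSr -mulrA addnS -hS -IH.
by apply/eqP; rewrite -subr_eq0 -/(h i) (hk i n.+1) h_above ?mulr0// addnS ltnS leq_addl.
Qed.

(** The difference h of z and z_n y obeys the recursion of [eigen_seqS] and vanishes at n. Downwards
    from n the recursion leaves (n - k) h k = 0; upwards it leaves t h (k+1) = 0. For t = 0 it is
    diagonal and gives h k = 0 for each k other than n. *)
Lemma adjoint_eigenspace n y z : dual_seq y = eigen_seq t n ->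
  n.+1%:R^-1 *: z - Ct' z = 0 -> z = dual_seq z n *: y.
Proof.
move=> yE zE; apply: (dual_seq_inj tameX).
have n0 : n.+1%:R != 0 :> R[i] by rewrite pnatr_eq0.
have zS k : n.+1%:R * dual_seq z k = k.+1%:R * (dual_seq z k - t%:C * dual_seq z k.+1).
  have Cz : Ct' z = n.+1%:R^-1 *: z by apply/esym/eqP; rewrite -subr_eq0 zE.
  have := adjoint_pre z k; rewrite Cz dual_scaleE pre_dual => E.
  by rewrite -{1}E mulVKf.
pose h k := dual_seq z k - dual_seq z n * eigen_seq t n k.
have hS k : n.+1%:R * h k = k.+1%:R * (h k - t%:C * h k.+1).
  rewrite /h mulrBr zS mulrCA eigen_seqS; ring.
have hn : h n = 0 by rewrite /h eigen_seqE leqnn subnn binn !mulr1 subrr.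
have below k : (k <= n)%N -> h (n - k)%N = 0.
  elim: k => [|k IH] kn; first by rewrite subn0.
  have := hS (n - k.+1)%N; rewrite subnSK// IH ?(ltnW kn)// mulr0 subr0 => /eqP.
  rewrite -subr_eq0 -mulrBl mulf_eq0 subr_eq0 eqr_nat => /orP[/eqP|/eqP //].
  by move=> ?; exfalso; lia.
have above k : h (n + k)%N = 0.
  elim: k => [|k IH]; first by rewrite addn0.
  have [tz|tnz] := eqVneq t 0.
    have := hS (n + k.+1)%N; rewrite tz mul0r subr0 => /eqP.
    rewrite -subr_eq0 -mulrBl mulf_eq0 subr_eq0 eqr_nat => /orP[/eqP|/eqP //].
    by move=> ?; exfalso; lia.
  have := hS (n + k)%N; rewrite IH mulr0 sub0r => /esym/eqP.
  rewrite mulf_eq0 pnatr_eq0 /= oppr_eq0 mulf_eq0 -addnS.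
  by rewrite -cmod_eq0 cmodR normr_eq0 (negPf tnz) /= => /eqP.
have h0 k : h k = 0.
  have [kn|/ltnW nk] := leqP k n; first by rewrite -(subKn kn) below// leq_subr.
  by rewrite -(subnKC nk) above.
apply/funext => k; apply/eqP.
by rewrite -subr_eq0 {2}/dual_seq dual_scaleE -/(dual_seq y k) yE -/(h k) h0.
Qed.

Lemma cesaro_point_spectrum : point_spectrum Ct = @Lambda R.
Proof.
apply/seteqP; split=> l.
  apply: contra_notP => lL x z; apply: cesaro_op_inj => n.
  by apply/eqP => ln; apply: lL; exists n.
move=> [m _ <-] inj; have [tau [K [tau01 K0 dom]]] := binomial_dominated m t01.
have cv := tame_mem tameX tau01 K0 (carrier_unit X m) dom.
have Ce : Ct (elt_of cv) = m.+1%:R^-1 *: elt_of cv.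
  apply: elt_ext => n.
  change (cesaro_op t (binomial_seq t m) n = (m.+1%:R^-1 *: binomial_seq t m) n).
  by rewrite cesaro_binomial.
have /inj /(congr1 (fun x : elt X => x m)) : m.+1%:R^-1 *: elt_of cv - Ct (elt_of cv) =
    m.+1%:R^-1 *: 0 - Ct 0.
  by rewrite Ce subrr scaler0 op_zero subrr.
change (binomial_seq t m m = 0 -> False).
by rewrite /binomial_seq subnn binn mulr1 => /eqP; rewrite oner_eq0.
Qed.

End Spectra.

Theorem proposition6p7 (R : realType) (t : R) (X : lcseq R) :
  0 <= t < 1 -> listed_space X ->
  exists (Ct : lin_op (elt X)) (Ct' : lin_op (strong_dual (elt X))),
    (forall x, seq_of (Ct x) = cesaro_op t (seq_of x)) /\
    (forall y x, Ct' y x = y (Ct x)) /\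
    (compact_op Ct' /\
     forall y i,
       \sum_(i <= k < n) t%:C ^+ (k - i) / k.+1%:R * dual_seq y k
         @[n --> \oo] --> dual_seq (Ct' y) i) /\
    (point_spectrum Ct' = point_spectrum Ct /\
     point_spectrum Ct = Lambda) /\
    (forall n : nat,
       simple_eigenvalue Ct' (n.+1%:R^-1) /\
       exists y : strong_dual (elt X),
         [/\ dual_seq y = eigen_seq t n, y != 0 &
             op_eigenspace Ct' (n.+1%:R^-1) = line y]) /\
    (spectrum_star Ct' = spectrum Ct' /\
     spectrum Ct' = Lambda `|` [set 0]).
Proof.
move=> t01 lX; have tX := tame_listed t01 lX.
pose Ct := cesaro_lin t01 tX; exists Ct, (adjoint Ct).
have eig n : exists y : strong_dual (elt X),
    [/\ dual_seq y = eigen_seq t n, y != 0 &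
        op_eigenspace (adjoint Ct) (n.+1%:R^-1) = line y].
  have [y yE] := eigen_dual tX n; exists y; split=> //.
    apply/eqP => y0; have := congr1 (fun v : omega R => v n) yE.
    rewrite y0 eigen_seqE leqnn subnn binn mulr1 => /esym/eqP.
    by rewrite /dual_seq dual_zeroE oner_eq0.
  apply/seteqP; split=> z.
    by move=> /(adjoint_eigenspace yE) zE; exists (dual_seq z n).
  move=> [a _ <-]; change (n.+1%:R^-1 *: (a *: y) - adjoint Ct (a *: y) = 0).
  have := op_scaleB (adjoint Ct) a y 0; rewrite subr0 op_zero subr0 => ->.
  by rewrite (adjoint_eigen t01 tX yE) !scalerA mulrC subrr.
have pt : point_spectrum (adjoint Ct) = @Lambda R.
  apply/seteqP; split=> l.
    apply: contra_notP => lL.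
    have [->|l0] := eqVneq l 0.
      move=> y1 y2; rewrite !scale0r !sub0r => /oppr_inj.
      exact: adjoint_cesaro_inj.
    have lL' n : l != n.+1%:R^-1 by apply/eqP => ln; apply: lL; exists n.
    have [S [Sl _]] := resolvent_star_sub (cesaro_resolvent_star t01 tX l0 lL').
    by move=> y1 y2 h; rewrite -(Sl y1) h Sl.
  move=> [n _ <-] inj; have [y [yE y0 yL]] := eig n.
  have : op_eigenspace (adjoint Ct) n.+1%:R^-1 y by rewrite yL; exists 1; rewrite ?scale1r.
  move=> yeig; case/eqP: y0; apply: inj.
  by rewrite [LHS]yeig scaler0 op_zero subr0.
(* With [sub] and [sup] this closes a cycle of inclusions from [Lambda] with 0 through the spectrum
   and [spectrum_star] back, which yields both equalities. *)
have star l : spectrum_star (adjoint Ct) l -> (@Lambda R `|` [set 0]) l.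
  apply: contra_notP => lL; apply: cesaro_resolvent_star.
    by apply/eqP => l0; apply: lL; right.
  by move=> n; apply/eqP => ln; apply: lL; left; exists n.
have sub : spectrum (adjoint Ct) `<=` spectrum_star (adjoint Ct).
  by move=> l nl /resolvent_star_sub.
have sup : @Lambda R `|` [set 0] `<=` spectrum (adjoint Ct).
  move=> l [lL|->]; last exact: zero_spectrum.
  by apply: point_spectrum_sub; rewrite pt.
split=> //; split=> //.
split; first by split; [exact: cesaro_compact|exact: adjoint_series].
split; first by rewrite pt cesaro_point_spectrum.
split.
  move=> n; split; last exact: eig.
  by have [y [_ y0 yL]] := eig n; exists y.
split; apply/seteqP; split=> l.
- by move=> /star /sup.
- exact: sub.
- by move=> /sub /star.
- exact: sup.
Qed.
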